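(* Let $k\ge2$ and let $H$ be a real-analytic Hamiltonian on $(\mathbb{R}^2,\omega)$, with $\omega$ a real-analytic symplectic structure, having an $A_{k-1}$ singularity at the origin $O$. Then under the fibration-preserving equivalence, the pair $(H,\omega)$ has the following local symplectic analytic normal form near $O$: $$\Big(H=\xi^2\pm x^k,\ \ \omega=\Big(1+\sum_{i=1}^{k-2}x^i\,\hat c_i(H)\Big)\,d\xi\wedge dx\Big)$$ for some real-analytic function germs $\hat c_i$ of one variable at $0$, defined uniquely up to simultaneously changing the sign of the functions $\hat c_{2i+1}(H)$, $i=0,\dots,\ell-2$, when $k=2\ell$ is even. In other words: - if $k$ is odd, then (the Taylor series at $0$ of) $\hat c_i$, $i=1,\dots,k-2$, form a complete and minimal set of symplectic invariants; - if $k=2\ell$ is even, then (the Taylor series at $0$ of) $\hat c_i$, $i=1,\dots,k-2$, form a complete set of symplectic invariants with the only relation given by changing the sign of $\sum_{i=0}^{\ell-2}x^{2i+1}\hat c_{2i+1}(H)$.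
   Context: All objects are real-analytic germs at the origin of $\mathbb{R}^2$. $H$ has an $A_{k-1}$ singularity at the origin if in some real-analytic (generally non-canonical) local coordinates $(x,\xi)$ it has the form $\xi^2\pm x^k$ (additive constant normalized to $0$); the sign is fixed throughout. $\mathrm{Diff}(\mathbb{R}^2,0)$, the group of real-analytic diffeomorphism germs fixing the origin (orientation-reversing ones allowed), acts on pairs by $(H,\omega)\mapsto(\psi^*H,\psi^*\omega)$. Fibration-preserving equivalence: $(H_0,\omega_0)$ and $(H_1,\omega_1)$ are equivalent if there exists a Hamiltonian $\tilde H_1$ defining the same (singular) foliation as $H_1$ such that $(H_0,\omega_0)$ and $(\tilde H_1,\omega_1)$ lie in the same orbit of $\mathrm{Diff}(\mathbb{R}^2,0)$. ''$(H,\omega)$ has the given normal form'' means that it is equivalent to that pair. ''Complete set of invariants, with uniqueness modulo a relation'' means: two normal forms (with the same $k$ and the same sign in $H$) given by $(\hat c_i)$ and $(\hat c_i')$ are equivalent if and only if $(\hat c_i)$ and $(\hat c_i')$ coincide modulo the stated relation. *)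

(* Defs.v *)
From HB Require Import structures.
From mathcomp Require Import all_boot all_order all_algebra.
From mathcomp Require Import all_classical all_reals all_analysis.
Set Implicit Arguments.
Unset Strict Implicit.
Unset Printing Implicit Defensive.
Import Order.TTheory GRing.Theory Num.Theory.
Import numFieldNormedType.Exports.

Local Open Scope classical_set_scope.
Local Open Scope ring_scope.

(* A point p : R * R has coordinates x = p.1 and xi = p.2.  A germ at the      *)
(* origin is represented by a total function; only its values near the origin  *)
(* are ever used, and germs are compared with [\near].                         *)

Section Germs.
Variable R : realType.

Definition analytic1 (f : R -> R) : Prop :=
  exists a : nat -> R, \forall x \near (0 : R), pseries a x @ \oo --> f x.

Definition psum2 (a : nat -> nat -> R) (p : R * R) (n : nat) : R :=
  \sum_(i < n) \sum_(j < n) a i j * p.1 ^+ i * p.2 ^+ j.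

(* The double series is required to converge absolutely, so that its sum does  *)
(* not depend on the choice of square partial sums.                            *)
Definition analytic2 (f : R * R -> R) : Prop :=
  exists a : nat -> nat -> R, \forall p \near (0 : R * R),
    cvgn (psum2 (fun i j => `|a i j|) (`|p.1|, `|p.2|)) /\
    psum2 a p @ \oo --> f p.

Definition analytic_map (psi : R * R -> R * R) : Prop :=
  analytic2 (fun p => (psi p).1) /\ analytic2 (fun p => (psi p).2).

(* Diff(R^2, 0); there is no condition on the orientation.                     *)
Definition diffeo_germ (psi : R * R -> R * R) : Prop :=
  [/\ analytic_map psi, psi 0 = 0 &
    exists phi : R * R -> R * R, [/\ analytic_map phi, phi 0 = 0,
      \forall p \near (0 : R * R), phi (psi p) = p &
      \forall p \near (0 : R * R), psi (phi p) = p]].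

Definition jac (psi : R * R -> R * R) (p : R * R) : R :=
  let d1 := (1, 0) : R * R in
  let d2 := (0, 1) : R * R in
  let psi1 := fun q => (psi q).1 : R in
  let psi2 := fun q => (psi q).2 : R in
  'D_d1 psi1 p * 'D_d2 psi2 p - 'D_d2 psi1 p * 'D_d1 psi2 p.

(* A 2-form on the plane is encoded by its density w: omega = w dxi /\ dx.     *)
(* Closedness is automatic in dimension 2, so omega is symplectic if and only  *)
(* if w does not vanish.                                                       *)
Definition symplectic (w : R * R -> R) : Prop :=
  analytic2 w /\ \forall p \near (0 : R * R), w p != 0.

Definition pullback_fun (psi : R * R -> R * R) (H : R * R -> R) : R * R -> R :=
  fun p => H (psi p).

Definition pullback_form (psi : R * R -> R * R) (w : R * R -> R) :
    R * R -> R :=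
  fun p => w (psi p) * jac psi p.

(* The leaves of the singular foliation of a neighbourhood U of the origin by  *)
(* H are the connected components of the level sets of H in U.                 *)
Definition leaf (U : set (R * R)) (H : R * R -> R) (p : R * R) :
    set (R * R) :=
  connected_component (U `&` [set q | H q = H p]) p.

(* If the leaves agree in U then they agree in every smaller neighbourhood of  *)
(* the origin, so this is a relation between germs.                            *)
Definition same_foliation (H H' : R * R -> R) : Prop :=
  exists U : set (R * R), open_nbhs (0 : R * R) U /\
    forall p, U p -> leaf U H p = leaf U H' p.

Definition same_orbit (H0 w0 H1 w1 : R * R -> R) : Prop :=
  exists psi : R * R -> R * R, [/\ diffeo_germ psi,
    \forall p \near (0 : R * R), H0 p = pullback_fun psi H1 p &
    \forall p \near (0 : R * R), w0 p = pullback_form psi w1 p].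

Definition fibration_equiv (H0 w0 H1 w1 : R * R -> R) : Prop :=
  exists Ht : R * R -> R, [/\ analytic2 Ht, same_foliation Ht H1 &
    same_orbit H0 w0 Ht w1].

(* xi^2 + x^k if s = false and xi^2 - x^k if s = true.                         *)
Definition nfH (k : nat) (s : bool) (p : R * R) : R :=
  p.2 ^+ 2 + (-1) ^+ s * p.1 ^+ k.

Definition A_singularity (k : nat) (s : bool) (H : R * R -> R) : Prop :=
  exists phi : R * R -> R * R, diffeo_germ phi /\
    \forall p \near (0 : R * R), H p = pullback_fun phi (nfH k s) p.

(* In a family c : nat -> R -> R only the functions c 1, ..., c (k - 2) are    *)
(* meaningful.                                                                 *)
Definition inv_index (k i : nat) : bool := (1 <= i <= k - 2)%N.

Definition nfw (k : nat) (s : bool) (c : nat -> R -> R) (p : R * R) : R :=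
  1 + \sum_(1 <= i < (k - 2).+1) p.1 ^+ i * c i (nfH k s p).

Definition analytic_family (k : nat) (c : nat -> R -> R) : Prop :=
  forall i, inv_index k i -> analytic1 (c i).

Definition has_normal_form (k : nat) (s : bool) (H w : R * R -> R)
    (c : nat -> R -> R) : Prop :=
  fibration_equiv H w (nfH k s) (nfw k s c).

Definition nf_equiv (k : nat) (s : bool) (c c' : nat -> R -> R) : Prop :=
  fibration_equiv (nfH k s) (nfw k s c) (nfH k s) (nfw k s c').

Definition same_germs (k : nat) (c c' : nat -> R -> R) : Prop :=
  forall i, inv_index k i -> \forall t \near (0 : R), c i t = c' i t.

Definition same_taylor (k : nat) (c c' : nat -> R -> R) : Prop :=
  forall i, inv_index k i ->
    forall n, derive1n n (c i) 0 = derive1n n (c' i) 0.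

Definition change_odd_signs (c : nat -> R -> R) : nat -> R -> R :=
  fun i t => if odd i then - c i t else c i t.

(* No Taylor coefficient of any of the invariants can be dropped: the          *)
(* remaining ones do not separate the equivalence classes.                     *)
Definition minimal_invariants (k : nat) (s : bool) : Prop :=
  forall i n, inv_index k i ->
    exists c c' : nat -> R -> R,
      [/\ analytic_family k c, analytic_family k c',
          forall j m, inv_index k j -> (j, m) != (i, n) ->
            derive1n m (c j) 0 = derive1n m (c' j) 0 &
          ~ nf_equiv k s c c'].

End Germs.

(* Main.v *)
Require Import Defs.
From HB Require Import structures.
From mathcomp Require Import all_boot all_order all_algebra.
From mathcomp Require Import all_classical all_reals all_analysis.
From mathcomp Require Import ring lra zify.
Set Implicit Arguments.
Unset Strict Implicit.
Unset Printing Implicit Defensive.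
Import Order.TTheory GRing.Theory Num.Theory.
Import numFieldNormedType.Exports.
Local Open Scope classical_set_scope.
Local Open Scope ring_scope.

(** Write f = xi^2 +- x^k and let X0 u = f_xi u_x - f_x u_xi be the derivation
along the Hamiltonian field of f.  An area form is a density w, and three facts
about densities carry the proof.

Densities modulo X0.  Replacing xi^2 by f -+ x^k writes w as
F(x, f) + xi G(x, f).  The second summand is X0 of a primitive of G in x.  On
functions of (x, t), X0 of xi B(x, f) is a first order operator B |-> opB B, and
every monomial x^m t^e is a combination of x^i c_i(t), i <= k - 2, plus a value of
opB, with bounds good enough to sum over a power series.  So
w = sum_(i <= k-2) x^i c_i(f) + X0 tau ([cohomology]), and the c_i are unique
([cohomology_unique]); the latter also says that the germs killed by X0 are the
germs of functions of f.

Existence.  The term X0 tau is removed by a diffeomorphism along the fibres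
([moser]).  No differential equation has to be solved: with X = X0 / N, where
N = sum x^i c_i(f), the series sum_n tau^n X^n g / n! is a ring homomorphism in g,
hence a substitution, it fixes the functions of f, and it multiplies the area
form N dxi /\ dx by 1 + X tau.  The map (x, xi) |-> (l(f)^2 x, l(f)^k xi) with a
suitable l then makes c_0 equal to 1 ([nform_scaling]).

Uniqueness.  A function with the leaves of f is killed by X0, hence is h(f), and
the equivalence of the statement becomes the existence of a diffeomorphism germ
psi with f o psi = g o f and w_0 = psi^* w_1 ([fibration_streq]).  Decompose
psi^*(x^j dxi /\ dx) = sum_i x^i M_ij(f) + X0 tau_j.  The form
(2j + k + 2) x^j dxi /\ dx is the exterior derivative of x^j (k xi dx - 2 x dxi),
whose exterior product with df is 2 k f x^j dxi /\ dx.  Pulling back both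
identities shows that every M_ij solves an equation of Fuchs type
(2j + k + 2) M = (2i + k + 2) e M + 2k t (e M)', where e = g / (t g')
([connection]).  As the exponents 2i + k + 2 are distinct modulo 2k, M is diagonal.
The normalisation c_0 = 1 gives M_00 = 1, whence e = 1, g is linear, and
the M_jj are constants a^j, where a is the x-derivative at 0 of the first component
of psi ([diag_value]).  Comparing the lowest order terms of f o psi = mu f forces
a = 1, or a = -1 with k even ([linear_part]), so that c_j = a^j c'_j ([rigidity]).
For even k the rotation (x, xi) |-> (-x, -xi) realises a = -1.

The analytic tools (composition, derivatives, inverse functions, identity theorem)
are derived from one device: [maj f r M] says that f is the sum of a power series
in two variables whose coefficients satisfy sum |a_ij| r^(i+j) <= M. *)

(** * Absolutely convergent double sums *)

Section DoubleSums.
Variable R : realType.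
Implicit Types (t M : nat -> nat -> R) (u : nat -> R).

Lemma cvgnP u (l : R) : u @ \oo --> l <->
  (forall e : R, 0 < e -> exists N, forall n, (N <= n)%N -> `|l - u n| <= e).
Proof.
split=> [/cvgrPdist_le h e /h [N _ hN]|h]; first by exists N => n; exact: hN.
by apply/cvgrPdist_le => e /h [N hN]; exists N.
Qed.

Definition dsum t m n := \sum_(i < m) \sum_(j < n) t i j.

Lemma dsum_widen t m n K : (m <= K)%N -> (n <= K)%N ->
  dsum t m n =
  \sum_(i < K) \sum_(j < K) (if (i < m)%N && (j < n)%N then t i j else 0).
Proof.
move=> mK nK; rewrite /dsum (big_ord_widen K (fun i => \sum_(j < n) t i j))//.
rewrite big_mkcond/=; apply: eq_bigr => i _; case: ifP => im.
  by rewrite (big_ord_widen K (t i))// big_mkcond/=; apply: eq_bigr => j _.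
by rewrite big1.
Qed.

(** The tail of a double sum is controlled by the square sums of absolute values
   only, so rectangles may be used in place of squares. *)
Lemma dsum_diff t m n N K : (N <= m <= K)%N -> (N <= n <= K)%N ->
  `|dsum t m n - dsum t N N| <=
  dsum (fun i j => `|t i j|) K K - dsum (fun i j => `|t i j|) N N.
Proof.
move=> /andP[Nm mK] /andP[Nn nK].
have NK := leq_trans Nm mK.
rewrite !(@dsum_widen _ _ _ K)// -!sumrB.
apply: le_trans (ler_norm_sum _ _ _) _; apply: ler_sum => i _.
rewrite -!sumrB; apply: le_trans (ler_norm_sum _ _ _) _; apply: ler_sum => j _.
rewrite !ltn_ord/=.
case: (ltnP i N) => iN; case: (ltnP j N) => jN /=.
- by rewrite (leq_trans iN Nm) (leq_trans jN Nn)/= !subrr normr0.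
- by case: ifP => _; rewrite ?subr0 ?normr0.
- by case: ifP => _; rewrite ?subr0 ?normr0.
- by case: ifP => _; rewrite ?subr0 ?normr0.
Qed.

Lemma dsum_norm_mono t : nondecreasing_seq (fun N => dsum (fun i j => `|t i j|) N N).
Proof.
move=> N K NK; rewrite -subr_ge0; apply: le_trans (@dsum_diff t N N N K _ _) => //;
by rewrite leqnn.
Qed.

(** Absolute summability with an explicit bound B for the sum of the |t i j|;
   the bounds are propagated through all constructions. *)
Definition absum t (B : R) := forall N, dsum (fun i j => `|t i j|) N N <= B.

Lemma absum_tail t B : absum t B -> forall e : R, 0 < e -> exists N, forall K,
  (N <= K)%N ->
  dsum (fun i j => `|t i j|) K K - dsum (fun i j => `|t i j|) N N <= e.
Proof.
move=> hB e e0; set v := fun N => dsum (fun i j => `|t i j|) N N.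
have : cvgn v.
  apply: nondecreasing_is_cvgn; first exact: dsum_norm_mono.
  by exists B => _ [N _ <-]; exact: hB.
move/cvg_ex => [l /cvgnP/(_ (e/2))]; case; first by rewrite divr_gt0.
move=> N hN; exists N => K NK.
have := hN _ NK; have := hN _ (leqnn N); rewrite /v; set a := dsum _ K K; set b := dsum _ N N.
move=> /ler_normlP[] ? ? /ler_normlP[] ? ?; lra.
Qed.

Lemma absum_cvg_ex t B : absum t B -> exists l : R, dsum t n n @[n --> \oo] --> l.
Proof.
move=> hB; suff : cvgn (fun n => dsum t n n) by move=> /cvg_ex.
apply/cauchy_cvgP/cauchyP => e e0.
have [N hN] := absum_tail hB (divr_gt0 e0 (ltr0n R 3)).
exists (dsum t N N); exists N => // n /= Nn.
rewrite -ball_normE/= distrC.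
have := @dsum_diff t n n N n; rewrite Nn leqnn => /(_ isT isT)/le_lt_trans; apply.
apply: le_lt_trans (hN _ Nn) _; by rewrite ltr_pdivrMr// ltr_pMr// ltr1n.
Qed.

Lemma dsum_rect t B (l : R) (m n : nat -> nat) : absum t B ->
  dsum t N N @[N --> \oo] --> l ->
  (forall N, (N <= m N)%N /\ (N <= n N)%N) ->
  dsum t (m N) (n N) @[N --> \oo] --> l.
Proof.
move=> hB /cvgnP hl mn; apply/cvgnP => e e0.
have e2 : 0 < e / 2 by rewrite divr_gt0.
have [N hN] := absum_tail hB e2; have [N' hN'] := hl _ e2.
exists (maxn N N') => K; rewrite geq_max => /andP[NK NK'].
have [Km Kn] := mn K; set Q := maxn (m K) (n K).
have := @dsum_diff t (m K) (n K) K Q.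
rewrite Km Kn leq_maxl leq_maxr => /(_ isT isT) h1.
have h2 := hN Q (leq_trans NK (leq_trans Km (leq_maxl _ _))).
have h3 := dsum_norm_mono t NK.
have h4 := hN' _ NK'.
rewrite -[l](subrK (dsum t K K)) -addrA.
apply: le_trans (ler_normD _ _) _; rewrite distrC in h1.
lra.
Qed.

Lemma dsum_lim_le t B (l : R) : absum t B -> dsum t N N @[N --> \oo] --> l -> `|l| <= B.
Proof.
move=> hB /cvg_norm hl; apply: (cvgr_to_le hl); apply: nearW => N.
apply: le_trans (hB N); apply: le_trans (ler_norm_sum _ _ _) _.
by apply: ler_sum => i _; exact: ler_norm_sum.
Qed.

Lemma cvg_sumr (T : Type) (F : set_system T) (FF : Filter F) (I : Type)
    (r : seq I) (f : I -> T -> R) (l : I -> R) :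
  (forall i, f i x @[x --> F] --> l i) ->
  \sum_(i <- r) f i x @[x --> F] --> \sum_(i <- r) l i.
Proof. by move=> h; apply: cvg_big => //; exact: add_continuous. Qed.

Lemma cvg_dsum (u : nat -> nat -> nat -> R) (v : nat -> nat -> R) m n :
  (forall i j, u i j @ \oo --> v i j) ->
  dsum (fun i j => u i j N) m n @[N --> \oo] --> dsum v m n.
Proof.
by move=> h; apply: cvg_sumr => i; apply: cvg_sumr => j; exact: h.
Qed.

(** Dominated convergence for double sums: the part outside a large square is
   small uniformly in N, and the square itself is a finite sum. *)
Lemma tannery (u : nat -> nat -> nat -> R) (v : nat -> nat -> R) M B (S : nat -> R) (s : R) :
  (forall i j N, `|u i j N| <= M i j) -> absum M B ->
  (forall i j, u i j @ \oo --> v i j) ->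
  (forall N, dsum (fun i j => u i j N) n n @[n --> \oo] --> S N) ->
  dsum v n n @[n --> \oo] --> s ->
  S @ \oo --> s.
Proof.
move=> uM MB uv uS vs; apply/cvgnP => e e0.
have e3 : 0 < e / 3 by rewrite divr_gt0.
have [K hK] := absum_tail MB e3.
have /cvgnP/(_ _ e3)[N0 hN0] := @cvg_dsum _ _ K K uv.
exists N0 => N /hN0 hN.
have vM i j : `|v i j| <= M i j.
  by apply: (cvgr_to_le (cvg_norm (uv i j))); apply: nearW => n; exact: uM.
have tail (w : nat -> nat -> R) (l : R) : (forall i j, `|w i j| <= M i j) ->
    dsum w n n @[n --> \oo] --> l -> `|l - dsum w K K| <= e / 3.
  move=> wM hw.
  have h : (dsum w n n - dsum w K K) @[n --> \oo] --> l - dsum w K K.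
    by apply: cvgB => //; exact: cvg_cst.
  apply: (cvgr_to_le (cvg_norm h)); near=> n.
  have Kn : (K <= n)%N by near: n; exact: nbhs_infty_ge.
  have := @dsum_diff w n n K n; rewrite Kn leqnn => /(_ isT isT)/le_trans; apply.
  apply: le_trans (hK n Kn).
  rewrite !(@dsum_widen _ _ _ n)// -!sumrB; apply: ler_sum => i _.
  rewrite -!sumrB; apply: ler_sum => j _; rewrite !ltn_ord/=.
  have := le_trans (wM i j) (ler_norm (M i j)).
  by case: ifP => _; rewrite ?subrr ?subr0.
have h1 := tail _ _ vM vs.
have h2 := tail _ _ (fun i j => uM i j N) (uS N).
rewrite (_ : s - S N = (s - dsum v K K) + (dsum v K K - dsum (fun i j => u i j N) K K)
   - (S N - dsum (fun i j => u i j N) K K)); last by ring.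
apply: le_trans (ler_normB _ _) _; apply: le_trans (lerD (ler_normD _ _) (lexx _)) _.
lra.
Unshelve. all: by end_near. Qed.

End DoubleSums.

(** * Power series of two variables with a majorant *)

Section PowerSeriesBound.
Variable R : realType.
Implicit Types (a t : nat -> nat -> R) (f g : R * R -> R) (r M : R).

Lemma dsum_rect_le t m n K : (m <= K)%N -> (n <= K)%N ->
  dsum (fun i j => `|t i j|) m n <= dsum (fun i j => `|t i j|) K K.
Proof.
move=> mK nK; rewrite !(@dsum_widen _ _ _ _ K)//.
apply: ler_sum => i _; apply: ler_sum => j _; rewrite !ltn_ord/=.
by case: ifP.
Qed.

Lemma dsumD t t' m n :
  dsum (fun i j => t i j + t' i j) m n = dsum t m n + dsum t' m n.
Proof. by rewrite /dsum -big_split; apply: eq_bigr => i _; rewrite -big_split. Qed.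

Lemma dsumZ c t m n : dsum (fun i j => c * t i j) m n = c * dsum t m n.
Proof. by rewrite /dsum mulr_sumr; apply: eq_bigr => i _; rewrite mulr_sumr. Qed.

Lemma eq_dsum t t' m n : (forall i j, t i j = t' i j) -> dsum t m n = dsum t' m n.
Proof. by move=> h; apply: eq_bigr => i _; apply: eq_bigr => j _. Qed.

Lemma le_dsum t t' m n : (forall i j, t i j <= t' i j) -> dsum t m n <= dsum t' m n.
Proof. by move=> h; apply: ler_sum => i _; apply: ler_sum => j _. Qed.

Lemma le_absum t t' M : (forall i j, `|t i j| <= `|t' i j|) -> absum t' M -> absum t M.
Proof. by move=> h hM N; apply: le_trans (hM N); exact: le_dsum. Qed.

Definition inbox r (p : R * R) := `|p.1| <= r /\ `|p.2| <= r.

Definition mono a (p : R * R) i j := a i j * p.1 ^+ i * p.2 ^+ j.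

(** On the closed box of radius r, f is the sum of the power series with
   coefficients a, and the sum of the |a i j| r^(i+j) is at most M. *)
Definition pser a r M f := absum (mono a (r, r)) M /\
  forall p, inbox r p -> dsum (mono a p) n n @[n --> \oo] --> f p.

Definition maj f r M := exists a, pser a r M f.

Lemma inbox_le r s p : r <= s -> inbox r p -> inbox s p.
Proof. by move=> rs [h1 h2]; split; [exact: le_trans h1 rs|exact: le_trans h2 rs]. Qed.

Lemma inbox0 r : 0 <= r -> inbox r 0.
Proof. by move=> r0; split; rewrite normr0. Qed.

Lemma mono_le a r p i j : inbox r p -> `|mono a p i j| <= `|mono a (r, r) i j|.
Proof.
move=> [h1 h2]; have r0 := le_trans (normr_ge0 _) h1.
rewrite /mono !normrM !normrX ler_pM ?mulr_ge0 ?exprn_ge0//.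
  by rewrite ler_pM ?exprn_ge0// lerXn2r ?nnegrE// (ger0_norm r0).
by rewrite lerXn2r ?nnegrE// (ger0_norm r0).
Qed.

Lemma pser_absum a r M f p : pser a r M f -> inbox r p -> absum (mono a p) M.
Proof. by move=> [h _] hp; apply: le_absum h => i j; exact: mono_le. Qed.

Lemma inboxxx r : 0 <= r -> inbox r (r, r).
Proof. by move=> r0; split; rewrite ger0_norm. Qed.

Lemma pser_ext a r M f g : (forall p, inbox r p -> f p = g p) -> pser a r M f -> pser a r M g.
Proof. by move=> h [h1 h2]; split=> // p hp; rewrite -h//; exact: h2. Qed.

Lemma maj_ext r M f g : (forall p, inbox r p -> f p = g p) -> maj f r M -> maj g r M.
Proof. by move=> h [a ha]; exists a; exact: pser_ext h ha. Qed.

Lemma pser_le a r s M M' f : 0 <= s -> s <= r -> M <= M' -> pser a r M f -> pser a s M' f.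
Proof.
move=> s0 sr MM' [h1 h2]; split=> [N|p hp].
  apply: le_trans (le_trans (h1 N) MM'); apply: le_dsum => i j.
  by apply: mono_le; split; rewrite ger0_norm.
by apply: h2; exact: inbox_le hp.
Qed.

Lemma maj_le r s M M' f : 0 <= s -> s <= r -> M <= M' -> maj f r M -> maj f s M'.
Proof. by move=> s0 sr MM' [a ha]; exists a; exact: pser_le ha. Qed.

Lemma pser_ge0 a r M f : pser a r M f -> 0 <= M.
Proof. by move=> [/(_ 0%N) + _]; rewrite /dsum big_ord0. Qed.

Lemma maj_ge0 f r M : maj f r M -> 0 <= M.
Proof. by case=> a /pser_ge0. Qed.

Lemma maj_bound f r M p : maj f r M -> inbox r p -> `|f p| <= M.
Proof. by move=> [a ha] hp; exact: dsum_lim_le (pser_absum ha hp) (ha.2 p hp). Qed.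

(** A double series of power series with summable majorants is a power series:
   its coefficients are the sums of the coefficients, and the order of summation
   is exchanged by [tannery].  Products, substitutions, primitives and the
   solution of the cohomological equation are all obtained in this way. *)
Lemma maj_series (m : nat -> nat -> R * R -> R) (B : nat -> nat -> R) K F r : 0 < r ->
  (forall i j, maj (m i j) r (B i j)) -> absum B K ->
  (forall p, inbox r p -> dsum (fun i j => m i j p) n n @[n --> \oo] --> F p) ->
  maj F r K.
Proof.
move=> r0 hm hB hF.
have B0 i j : 0 <= B i j by exact: maj_ge0 (hm i j).
have /choice[al hal] : forall ij : nat * nat, exists a, pser a r (B ij.1 ij.2) (m ij.1 ij.2).
  by move=> ij; exact: hm.
have rr := inboxxx (ltW r0).
have al_le i j k l : `|mono (al (i, j)) (r, r) k l| <= B i j.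
  have [+ _] := hal (i, j) => /(_ (maxn k l).+1); apply: le_trans.
  rewrite /dsum (bigD1 (inord k))//= (bigD1 (inord l))//= !inordK ?ltnS ?leq_maxl ?leq_maxr//.
  rewrite -addrA lerDl addr_ge0// sumr_ge0// => i' _; exact: sumr_ge0.
have hA k l : exists A : R, dsum (fun i j => al (i, j) k l) n n @[n --> \oo] --> A.
  apply: (@absum_cvg_ex _ _ (K / (r ^+ k * r ^+ l))) => N.
  rewrite ler_pdivlMr ?mulr_gt0 ?exprn_gt0// mulrC -dsumZ.
  apply: le_trans (hB N); apply: le_dsum => i j; rewrite (ger0_norm (B0 i j)).
  apply: le_trans (al_le i j k l); rewrite /mono/= !normrM.
  by rewrite (ger0_norm (exprn_ge0 k (ltW r0))) (ger0_norm (exprn_ge0 l (ltW r0))) mulrC mulrA.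
have /choice[A0 hA0] : forall kl : nat * nat, exists A : R,
  dsum (fun i j => al (i, j) kl.1 kl.2) n n @[n --> \oo] --> A by move=> kl; exact: hA.
pose A k l := A0 (k, l).
have exch p N n : dsum (fun k l => dsum (fun i j => mono (al (i, j)) p k l) n n) N N =
   dsum (fun i j => dsum (mono (al (i, j)) p) N N) n n.
  rewrite /dsum; under eq_bigr do rewrite exchange_big/=.
  rewrite exchange_big/=; apply: eq_bigr => i _.
  under eq_bigr do rewrite exchange_big/=.
  by rewrite exchange_big.
have cA p k l : dsum (fun i j => mono (al (i, j)) p k l) n n @[n --> \oo] --> mono A p k l.
  rewrite /mono -mulrA mulrC.
  under eq_fun do (rewrite (@eq_dsum _ (fun i j => (p.1 ^+ k * p.2 ^+ l) * al (i, j) k l));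
    [rewrite dsumZ|by move=> i j; rewrite -mulrA mulrC]).
  by apply: cvgMr; exact: (hA0 (k, l)).
exists A; split.
  move=> N.
  have h : dsum (fun k l => `|dsum (fun i j => mono (al (i, j)) (r, r) k l) n n|) N N @[n --> \oo]
       --> dsum (fun k l => `|mono A (r, r) k l|) N N.
    by apply: cvg_dsum => k l; apply: cvg_norm; exact: cA.
  apply: (cvgr_to_le h); apply: nearW => n.
  apply: (@le_trans _ _ (dsum (fun k l => dsum (fun i j => `|mono (al (i, j)) (r, r) k l|) n n) N N)).
    apply: le_dsum => k l; apply: le_trans (ler_norm_sum _ _ _) _.
    by apply: ler_sum => i _; exact: ler_norm_sum.
  have -> : dsum (fun k l => dsum (fun i j => `|mono (al (i, j)) (r, r) k l|) n n) N N =
     dsum (fun i j => dsum (fun k l => `|mono (al (i, j)) (r, r) k l|) N N) n n.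
    rewrite /dsum; under eq_bigr do rewrite exchange_big/=.
    rewrite exchange_big/=; apply: eq_bigr => i _.
    under eq_bigr do rewrite exchange_big/=.
    by rewrite exchange_big.
  apply: le_trans (hB n); apply: le_dsum => i j.
  apply: le_trans (ler_norm _); exact: (hal (i, j)).1.
move=> p hp.
apply: (@tannery _ (fun i j N => dsum (mono (al (i, j)) p) N N) (fun i j => m i j p) B K).
- move=> i j N; apply: le_trans ((hal (i, j)).1 N).
  apply: le_trans (ler_norm_sum _ _ _) _; apply: ler_sum => k _.
  apply: le_trans (ler_norm_sum _ _ _) _; apply: ler_sum => l _.
  exact: mono_le.
- exact: hB.
- by move=> i j; exact: (hal (i, j)).2.
- move=> N; under eq_fun do rewrite -exch.
  by apply: cvg_dsum => k l; exact: cA.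
- exact: hF.
Qed.

Lemma maj_series_ex (m : nat -> nat -> R * R -> R) (B : nat -> nat -> R) K r : 0 < r ->
  (forall i j, maj (m i j) r (B i j)) -> absum B K ->
  exists2 F, maj F r K &
  (forall p, inbox r p -> dsum (fun i j => m i j p) n n @[n --> \oo] --> F p).
Proof.
move=> r0 hm hB.
have /choice[F hF] : forall p, exists l : R, inbox r p ->
    dsum (fun i j => m i j p) n n @[n --> \oo] --> l.
  move=> p; have [hp|hp] := pselect (inbox r p); last by exists 0.
  have [l hl] : exists l : R, dsum (fun i j => m i j p) n n @[n --> \oo] --> l.
    apply: (@absum_cvg_ex _ _ K); apply: le_absum hB => i j.
    by apply: le_trans (maj_bound (hm i j) hp) (ler_norm _).
  by exists l.
by exists F => //; exact: maj_series hm hB hF.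
Qed.

Lemma maj_cst (c r : R) : 0 <= r -> maj (fun=> c) r `|c|.
Proof.
move=> r0; exists (fun i j => if (i == 0%N) && (j == 0%N) then c else 0).
have h p n : dsum (mono (fun i j => if (i == 0%N) && (j == 0%N) then c else 0) p) n.+1 n.+1 = c.
  rewrite /dsum big_ord_recl big_ord_recl/= /mono/= !mulr1 big1 ?addr0.
    by rewrite big1 ?addr0// => i _; rewrite big1// => j _; rewrite !mul0r.
  by move=> i _; rewrite !mul0r.
split=> [[|N]|p hp].
- by rewrite /dsum big_ord0.
- rewrite (@eq_dsum _ (mono (fun i j => if (i == 0%N) && (j == 0%N) then `|c| else 0) (r,r))).
    rewrite /dsum big_ord_recl big_ord_recl/= /mono/= !mulr1 big1 ?addr0.
      by rewrite big1 ?addr0// => i _; rewrite big1// => j _; rewrite !mul0r.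
    by move=> i _; rewrite !mul0r.
  move=> i j; rewrite /mono !normrM/= (ger0_norm (exprn_ge0 i r0)) (ger0_norm (exprn_ge0 j r0)).
  by case: ifP => //; rewrite normr0.
- rewrite -cvg_shiftS /=; under eq_fun do rewrite h; exact: cvg_cst.
Qed.

Lemma pser_add a b f g r M N : pser a r M f -> pser b r N g ->
  pser (fun i j => a i j + b i j) r (M + N) (fun p => f p + g p).
Proof.
move=> [a1 a2] [b1 b2].
have h p i j : mono (fun i j => a i j + b i j) p i j = mono a p i j + mono b p i j.
  by rewrite /mono !mulrDl.
split=> [n|p hp].
  apply: le_trans (lerD (a1 n) (b1 n)); rewrite -dsumD; apply: le_dsum => i j.
  by rewrite h ler_normD.
under eq_fun do rewrite (eq_dsum _ _ (h p)) dsumD.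
by apply: cvgD; [exact: a2|exact: b2].
Qed.

Lemma pser_scale c a f r M : pser a r M f -> pser (fun i j => c * a i j) r (`|c| * M) (fun p => c * f p).
Proof.
move=> [a1 a2].
have h p i j : mono (fun i j => c * a i j) p i j = c * mono a p i j.
  by rewrite /mono !mulrA.
split=> [n|p hp].
  rewrite (@eq_dsum _ (fun i j => `|c| * `|mono a (r, r) i j|)); last first.
    by move=> i j; rewrite h normrM.
  by rewrite dsumZ ler_wpM2l.
under eq_fun do rewrite (eq_dsum _ _ (h p)) dsumZ.
by apply: cvgMr; exact: a2.
Qed.

Lemma maj_add f g r M N : maj f r M -> maj g r N -> maj (fun p => f p + g p) r (M + N).
Proof. by move=> [a ha] [b hb]; eexists; exact: pser_add ha hb. Qed.

Lemma maj_scale c f r M : maj f r M -> maj (fun p => c * f p) r (`|c| * M).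
Proof. by move=> [a ha]; eexists; exact: pser_scale ha. Qed.

Lemma maj_opp f r M : maj f r M -> maj (fun p => - f p) r M.
Proof.
move=> /(maj_scale (-1)); rewrite normrN1 mul1r; apply: maj_ext => p _.
by rewrite mulN1r.
Qed.

Lemma maj_sub f g r M N : maj f r M -> maj g r N -> maj (fun p => f p - g p) r (M + N).
Proof. by move=> hf /maj_opp hg; exact: maj_add hf hg. Qed.

Definition shiftx a i j := if i is i'.+1 then a i' j else 0.
Definition shifty a i j := if j is j'.+1 then a i j' else 0.

Lemma pser_mulx a f r M : 0 <= r -> pser a r M f -> pser (shiftx a) r (r * M) (fun p => p.1 * f p).
Proof.
move=> r0 ha.
have h p m n : dsum (mono (shiftx a) p) m.+1 n = p.1 * dsum (mono a p) m n.
  rewrite /dsum big_ord_recl/= big1 ?add0r; last by move=> j _; rewrite /mono/= !mul0r.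
  rewrite mulr_sumr; apply: eq_bigr => i _; rewrite mulr_sumr; apply: eq_bigr => j _.
  by rewrite /mono/= exprS; ring.
have h' m n : dsum (fun i j => `|mono (shiftx a) (r,r) i j|) m.+1 n =
              r * dsum (fun i j => `|mono a (r,r) i j|) m n.
  rewrite /dsum big_ord_recl/= big1 ?add0r; last by move=> j _; rewrite /mono/= !mul0r normr0.
  rewrite mulr_sumr; apply: eq_bigr => i _; rewrite mulr_sumr; apply: eq_bigr => j _.
  by rewrite /mono/= exprS !normrM (ger0_norm r0); ring.
have M0 := pser_ge0 ha.
split=> [[|n]|p hp]; first by rewrite /dsum big_ord0 mulr_ge0.
  rewrite h' ler_wpM2l//; apply: le_trans (ha.1 n.+1); exact: dsum_rect_le.
rewrite -cvg_shiftS/=; under eq_fun do rewrite h; apply: cvgMr.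
have /cvgnP hd := dsum_rect (pser_absum ha hp) (ha.2 p hp) (m := id) (n := S) (fun N => conj (leqnn N) (leqnSn N)).
by apply/cvgnP.
Qed.

Lemma pser_muly a f r M : 0 <= r -> pser a r M f -> pser (shifty a) r (r * M) (fun p => p.2 * f p).
Proof.
move=> r0 ha.
have h p m n : dsum (mono (shifty a) p) m n.+1 = p.2 * dsum (mono a p) m n.
  rewrite /dsum mulr_sumr; apply: eq_bigr => i _; rewrite big_ord_recl/= {1}/mono/= !mul0r add0r.
  rewrite mulr_sumr; apply: eq_bigr => j _.
  by rewrite /mono/= exprS; ring.
have h' m n : dsum (fun i j => `|mono (shifty a) (r,r) i j|) m n.+1 =
              r * dsum (fun i j => `|mono a (r,r) i j|) m n.
  rewrite /dsum mulr_sumr; apply: eq_bigr => i _; rewrite big_ord_recl/= {1}/mono/= !mul0r normr0 add0r.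
  rewrite mulr_sumr; apply: eq_bigr => j _.
  by rewrite /mono/= exprS !normrM (ger0_norm r0); ring.
have M0 := pser_ge0 ha.
split=> [[|n]|p hp]; first by rewrite /dsum big_ord0 mulr_ge0.
  rewrite h' ler_wpM2l//; apply: le_trans (ha.1 n.+1); exact: dsum_rect_le.
rewrite -cvg_shiftS/=; under eq_fun do rewrite h; apply: cvgMr.
have /cvgnP hd := dsum_rect (pser_absum ha hp) (ha.2 p hp) (m := S) (n := id) (fun N => conj (leqnSn N) (leqnn N)).
by apply/cvgnP.
Qed.

Lemma maj_mulx f r M : 0 <= r -> maj f r M -> maj (fun p => p.1 * f p) r (r * M).
Proof. by move=> r0 [a /(pser_mulx r0) ha]; exists (shiftx a). Qed.

Lemma maj_muly f r M : 0 <= r -> maj f r M -> maj (fun p => p.2 * f p) r (r * M).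
Proof. by move=> r0 [a /(pser_muly r0) ha]; exists (shifty a). Qed.

Lemma maj_mono f r M i j : 0 <= r -> maj f r M ->
  maj (fun p => p.1 ^+ i * p.2 ^+ j * f p) r (r ^+ i * r ^+ j * M).
Proof.
move=> r0 hf; elim: i => [|i IH].
  elim: j => [|j IH]; first by rewrite !mul1r; apply: maj_ext hf => p _; rewrite !mul1r.
  rewrite (_ : _ * M = r * (r ^+ 0 * r ^+ j * M)); last by rewrite exprS; ring.
  by apply: maj_ext (maj_muly r0 IH) => p _; rewrite (exprS _ j); ring.
rewrite (_ : _ * M = r * (r ^+ i * r ^+ j * M)); last by rewrite exprS; ring.
by apply: maj_ext (maj_mulx r0 IH) => p _; rewrite (exprS _ i); ring.
Qed.

(** The product is the series of the functions a i j x^i xi^j g. *)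
Lemma maj_mul f g r M N : 0 < r -> maj f r M -> maj g r N -> maj (fun p => f p * g p) r (M * N).
Proof.
move=> r0 [a ha] hg; have N0 := maj_ge0 hg.
apply: (@maj_series (fun i j p => a i j * (p.1 ^+ i * p.2 ^+ j * g p))
  (fun i j => `|a i j| * (r ^+ i * r ^+ j * N))) => //.
- by move=> i j; apply: maj_scale; apply: maj_mono => //; exact: ltW.
- move=> n; rewrite (@eq_dsum _ (fun i j => N * `|mono a (r,r) i j|)); last first.
    move=> i j; rewrite /mono !normrM normr_id (ger0_norm N0).
    by ring.
  by rewrite dsumZ mulrC ler_wpM2r// ha.1.
move=> p hp; under eq_fun do (rewrite (@eq_dsum _ (fun i j => g p * mono a p i j));
    [rewrite dsumZ|by move=> i j; rewrite /mono; ring]).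
by rewrite mulrC; apply: cvgMr; exact: ha.2.
Qed.

Lemma maj_exp f r M n : 0 < r -> maj f r M -> maj (fun p => f p ^+ n) r (M ^+ n).
Proof.
move=> r0 hf; elim: n => [|n IH].
  by have := @maj_cst 1 r (ltW r0); rewrite normr1; apply: maj_ext => p _.
by rewrite exprS; apply: maj_ext (maj_mul r0 hf IH) => p _; rewrite exprS.
Qed.

Lemma maj_fst r : 0 <= r -> maj (fun p => p.1) r r.
Proof.
move=> r0; have := maj_mulx r0 (maj_cst 1 r0); rewrite normr1 mulr1.
by apply: maj_ext => p _; rewrite mulr1.
Qed.

Lemma maj_snd r : 0 <= r -> maj (fun p => p.2) r r.
Proof.
move=> r0; have := maj_muly r0 (maj_cst 1 r0); rewrite normr1 mulr1.
by apply: maj_ext => p _; rewrite mulr1.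
Qed.

(** Substitution needs only that the majorants of u and v do not exceed the
   radius of F. *)
Lemma maj_comp F u v r rho M : 0 < r -> maj F rho M -> maj u r rho -> maj v r rho ->
  maj (fun p => F (u p, v p)) r M.
Proof.
move=> r0 [a ha] hu hv; have rho0 := maj_ge0 hu.
apply: (@maj_series (fun i j p => a i j * (u p ^+ i * v p ^+ j))
  (fun i j => `|a i j| * (rho ^+ i * rho ^+ j))) => //.
- by move=> i j; apply: maj_scale; apply: maj_mul => //; exact: maj_exp.
- apply: le_absum ha.1 => i j.
  by rewrite /mono !normrM normr_id !mulrA.
move=> p hp.
have h i j : a i j * (u p ^+ i * v p ^+ j) = mono a (u p, v p) i j by rewrite /mono mulrA.
under eq_fun do rewrite (eq_dsum _ _ h).
by apply: ha.2; split; [exact: maj_bound hu hp|exact: maj_bound hv hp].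
Qed.

Lemma pser_00 a r M f : 0 <= r -> pser a r M f -> a 0%N 0%N = f 0.
Proof.
move=> r0 ha; have := ha.2 0 (inbox0 r0); rewrite -cvg_shiftS/= => h.
apply: (cvg_unique _ _ h) => //=.
suff E n : dsum (mono a 0) n.+1 n.+1 = a 0%N 0%N.
  by under eq_fun do rewrite E; exact: cvg_cst.
rewrite /dsum big_ord_recl big_ord_recl/= /mono/= !mulr1 big1 ?addr0; last first.
  by move=> i _; rewrite exprS mul0r mulr0.
by rewrite big1 ?addr0// => i _; rewrite big1// => j _; rewrite exprS mul0r mulr0 mul0r.
Qed.

(** Without constant term every monomial contains at least one factor s / r
   after the radius is reduced from r to s.  This makes small majorants
   available in a small box. *)
Lemma maj_shrink f r s M : 0 < r -> 0 <= s <= r -> maj f r M -> f 0 = 0 -> maj f s (s / r * M).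
Proof.
move=> r0 /andP[s0 sr] [a ha] f0; exists a; split=> [n|p hp]; last first.
  by apply: ha.2; exact: inbox_le hp.
have sr0 : 0 <= s / r by rewrite divr_ge0// ltW.
have sr1 : s / r <= 1 by rewrite ler_pdivrMr// mul1r.
apply: le_trans (ler_wpM2l sr0 (ha.1 n)); rewrite -dsumZ; apply: le_dsum => i j.
rewrite /mono/= !normrM !(ger0_norm (exprn_ge0 _ s0)) !(ger0_norm (exprn_ge0 _ (ltW r0))).
have [/andP[/eqP-> /eqP->]|ij] := boolP ((i == 0%N) && (j == 0%N)).
  by rewrite (pser_00 (ltW r0) ha) f0 normr0 !mul0r mulr0.
have h : s ^+ (i + j) <= s / r * r ^+ (i + j).
  have : (0 < i + j)%N by case: i j ij => [|i] [|j].
  case: (i + j)%N => // k _; rewrite !exprS mulrA divfK ?gt_eqF//.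
  by rewrite ler_wpM2l// lerXn2r// nnegrE ltW.
have := ler_wpM2l (normr_ge0 (a i j)) h; rewrite !exprD.
by rewrite [leLHS]mulrA [leRHS]mulrCA !(mulrA `|a i j|).
Qed.

End PowerSeriesBound.

(** * Derivatives of power series and the identity theorem *)

Section Derivatives.
Variable R : realType.
Implicit Types (a t : nat -> nat -> R) (f g : R * R -> R) (r M s d : R) (p q : R * R).

Lemma nearboxP (p0 : R * R) (Q : set (R * R)) : (\forall p \near p0, Q p) <->
  exists2 r : R, 0 < r & forall q, inbox r q -> Q (p0 + q).
Proof.
split.
  move=> /nbhs_ballP[e /= e0 he]; exists (e / 2); first by rewrite divr_gt0.
  move=> q [q1 q2]; apply: he; rewrite -ball_normE/=.
  rewrite opprD addNKr prod_normE/= !normrN gt_max.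
  have e2 : e / 2 < e by rewrite ltr_pdivrMr// ltr_pMr// ltr1n.
  by rewrite (le_lt_trans q1 e2) (le_lt_trans q2 e2).
move=> [r r0 hr]; apply/nbhs_ballP; exists r => //= p; rewrite -ball_normE/= => hp.
rewrite -(subrK p0 p) addrC; apply: hr.
move: hp; rewrite -normrN opprB prod_normE gt_max/= => /andP[h1 h2].
by split; exact: ltW.
Qed.

Lemma near0P (Q : set (R * R)) : (\forall p \near (0 : R * R), Q p) <->
  exists2 r : R, 0 < r & forall q, inbox r q -> Q q.
Proof.
rewrite nearboxP; split=> -[r r0 h]; exists r => // q /h; by rewrite add0r.
Qed.

(** Declared as a linear function, so that it can be recognised as a
   differential. *)
Definition lin2 (a b : R) (q : R * R) : R := q.1 * a + q.2 * b.
Lemma lin2_is_linear (a b : R) : linear (lin2 a b).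
Proof. by move=> k u v; rewrite /lin2/= /GRing.scale/=; ring. Qed.
HB.instance Definition _ (a b : R) := GRing.isLinear.Build R (R * R)%type R _ (lin2 a b) (lin2_is_linear a b).

Definition dX f p : R := 'D_((1, 0) : R * R) f p.
Definition dY f p : R := 'D_((0, 1) : R * R) f p.

(** A remainder that is quadratic on a fixed box determines the differential.
   Derivatives of power series are obtained through this criterion, which passes
   to sums of series. *)
Lemma quad_diff f p (a b C d : R) : 0 < d ->
  (forall q, inbox d q ->
     `|f (p + q) - f p - q.1 * a - q.2 * b| <= C * (`|q.1| + `|q.2|) ^+ 2) ->
  [/\ differentiable f p, dX f p = a & dY f p = b].
Proof.
move=> d0 h.
have cl : continuous (lin2 a b).
  move=> x; rewrite /lin2; apply: cvgD; apply: cvgMl; [exact: cvg_fst|exact: cvg_snd].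
have C0 : 0 <= C.
  have := h (d, d); rewrite /inbox/= (gtr0_norm d0) => /(_ (conj (lexx _) (lexx _))).
  move=> /(le_trans (normr_ge0 _)); rewrite pmulr_lge0// exprn_gt0// addr_gt0//.
have E : f \o shift p = cst (f p) + lin2 a b +o_ (0 : R * R) id.
  apply/eqaddoP => e /= e0.
  apply/near0P; exists (Num.min d (e / (4 * (C + 1)))).
    by rewrite lt_min d0/= divr_gt0// mulr_gt0// ltr_wpDl.
  move=> q hq; have hd : inbox d q by apply: inbox_le hq; rewrite ge_min lexx.
  have [h1 h2] : inbox (e / (4 * (C + 1))) q by apply: inbox_le hq; rewrite ge_min lexx orbT.
  have H := h q hd.
  rewrite [X in `|X|](_ : _ = f (p + q) - f p - q.1 * a - q.2 * b); last first.
    rewrite (addrC p q).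
    transitivity (f (q + p) - (f p + (q.1 * a + q.2 * b))); [by []|ring].
  apply: le_trans H _.
  have qn1 : `|q.1| <= `|q| by rewrite prod_normE le_max lexx.
  have qn2 : `|q.2| <= `|q| by rewrite prod_normE le_max lexx orbT.
  have qe : `|q| <= e / (4 * (C + 1)) by rewrite prod_normE ge_max h1 h2.
  have : (`|q.1| + `|q.2|) ^+ 2 <= 4 * (`|q| * `|q|).
    rewrite (_ : 4 * _ = (`|q| + `|q|) ^+ 2); last by ring.
    by rewrite lerXn2r ?nnegrE ?addr_ge0// lerD.
  move=> H2; apply: le_trans (ler_wpM2l C0 H2) _.
  rewrite (_ : C * _ = (C * 4 * `|q|) * `|q|); last by ring.
  apply: ler_wpM2r => //.
  apply: (@le_trans _ _ (C * 4 * (e / (4 * (C + 1))))).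
    by rewrite ler_wpM2l// mulr_ge0.
  rewrite (_ : C * 4 * _ = e * (C / (C + 1))); last first.
    by field; rewrite gt_eqF// ltr_wpDl.
  by rewrite ler_piMr ?(ltW e0)// ler_pdivrMr ?mul1r ?ltr_wpDl// lerDl.
have D := diff_unique cl E.
have df : differentiable f p.
  apply/diff_locallyP; split; rewrite D//.
split=> //.
  rewrite /dX deriveE// D; change (lin2 a b (1, 0) = a).
  by rewrite /lin2 mul1r mul0r addr0.
rewrite /dY deriveE// D; change (lin2 a b (0, 1) = b).
by rewrite /lin2 mul1r mul0r add0r.
Qed.

(** The derivative of x^i, kept as a closed term because its values at the
   radius occur as a majorant. *)
Definition dpow i (x : R) := i%:R * x ^+ i.-1.

(** The Taylor remainder of x^i is quadratic in h, with the constant given by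
   the remainder at the extreme values x = s, h = d, where all terms are
   nonnegative. *)
Lemma pow_rem i (x h s d : R) : `|x| <= s -> `|h| <= d -> 0 < d ->
  `|(x + h) ^+ i - x ^+ i - h * dpow i x| <=
   (`|h| / d) ^+ 2 * ((s + d) ^+ i - s ^+ i - d * dpow i s).
Proof.
move=> xs hd d0; have s0 := le_trans (normr_ge0 _) xs.
elim: i => [|i IH]; first by rewrite /dpow !expr0 !mul0r !mulr0 !subrr normr0 mulr0.
have E (y k : R) : (y + k) ^+ i.+1 - y ^+ i.+1 - k * dpow i.+1 y =
   (y + k) * ((y + k) ^+ i - y ^+ i - k * dpow i y) + i%:R * k ^+ 2 * y ^+ i.-1.
  rewrite /dpow/=; case: i {IH} => [|i]; first by rewrite /=; ring.
  by rewrite /= !exprS -!natr1; ring.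
rewrite E [in leRHS]E; set X := _ ^+ i - _ - _ in IH *; set Y := (s + d) ^+ i - _ - _ in IH *.
apply: le_trans (ler_normD _ _) _; rewrite [leRHS]mulrDr; apply: lerD.
  rewrite normrM mulrCA; apply: ler_pM => //.
  by apply: le_trans (ler_normD _ _) _; exact: lerD.
rewrite !normrM !normrX (ger0_norm (ler0n _ _)).
rewrite (_ : (`|h| / d) ^+ 2 * (i%:R * d ^+ 2 * s ^+ i.-1) = i%:R * `|h| ^+ 2 * s ^+ i.-1); last first.
  by field; rewrite gt_eqF.
by rewrite ler_wpM2l ?mulr_ge0 ?exprn_ge0// lerXn2r// nnegrE.
Qed.

Lemma dpow_le i (x s d : R) : `|x| <= s -> 0 < d -> `|d * dpow i x| <= (s + d) ^+ i.
Proof.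
move=> xs d0; have s0 := le_trans (normr_ge0 _) xs.
have sd0 : 0 <= s + d by rewrite addr_ge0// ltW.
apply: (@le_trans _ _ (d * dpow i s)).
  rewrite /dpow !normrM (gtr0_norm d0) normr_nat normrX ler_wpM2l ?(ltW d0)// ler_wpM2l//.
  by rewrite lerXn2r// nnegrE.
have := @pow_rem i s d s d; rewrite (ger0_norm s0) (gtr0_norm d0) divff ?gt_eqF// expr1n mul1r.
move=> /(_ (lexx _) (lexx _) d0) /(le_trans (normr_ge0 _)).
have := exprn_ge0 i s0; lra.
Qed.

Lemma pow_rem2 i (x h s d : R) : `|x| <= s -> `|h| <= d -> 0 < d ->
  [/\ `|(x + h) ^+ i - x ^+ i - h * dpow i x| <= (`|h| / d) ^+ 2 * (s + d) ^+ i,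
      `|h * dpow i x| <= (`|h| / d) * (s + d) ^+ i &
      `|(x + h) ^+ i - x ^+ i| <= (`|h| / d) * (s + d) ^+ i].
Proof.
move=> xs hd d0; have s0 := le_trans (normr_ge0 _) xs.
have sd0 : 0 <= s + d by rewrite addr_ge0// ltW.
have hd0 : 0 <= `|h| / d by rewrite divr_ge0// ltW.
have hd1 : `|h| / d <= 1 by rewrite ler_pdivrMr// mul1r.
have B := @pow_rem i x h s d xs hd d0.
have ds0 : 0 <= d * dpow i s by rewrite /dpow !mulr_ge0 ?exprn_ge0// ltW.
have si0 := exprn_ge0 i s0.
have D : `|h * dpow i x| <= (`|h| / d) * (d * dpow i s).
  rewrite [leRHS]mulrA divfK ?gt_eqF// normrM ler_wpM2l// /dpow normrM normr_nat normrX.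
  by rewrite ler_wpM2l// lerXn2r// nnegrE.
split.
- apply: le_trans B _; rewrite ler_wpM2l ?exprn_ge0//; lra.
- apply: le_trans D _; rewrite ler_wpM2l//.
  have := @dpow_le i s s d; rewrite (ger0_norm s0) (ger0_norm ds0); exact.
- rewrite -[X in `|X|](subrK (h * dpow i x)).
  apply: le_trans (ler_normD _ _) _.
  have : (`|h| / d) ^+ 2 * ((s + d) ^+ i - s ^+ i - d * dpow i s) <=
         (`|h| / d) * ((s + d) ^+ i - s ^+ i - d * dpow i s).
    apply: ler_wpM2r; last by rewrite expr2 ler_piMl.
    have := @pow_rem i s d s d; rewrite (ger0_norm s0) (gtr0_norm d0) divff ?gt_eqF// expr1n mul1r.
    by move=> /(_ (lexx _) (lexx _) d0) /(le_trans (normr_ge0 _)).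
  move=> H; apply: le_trans (lerD (le_trans B H) D) _.
  rewrite -mulrDr subrK ler_wpM2l//; lra.
Qed.

Lemma mono_rem i j p q s d : inbox s p -> inbox d q -> 0 < d ->
  `|(p + q).1 ^+ i * (p + q).2 ^+ j - p.1 ^+ i * p.2 ^+ j
     - q.1 * (dpow i p.1 * p.2 ^+ j) - q.2 * (p.1 ^+ i * dpow j p.2)| <=
  ((`|q.1| + `|q.2|) / d) ^+ 2 * ((s + d) ^+ i * (s + d) ^+ j).
Proof.
move=> [p1 p2] [q1 q2] d0.
have [A1 A2 A3] := pow_rem2 i p1 q1 d0; have [B1 B2 B3] := pow_rem2 j p2 q2 d0.
have s0 := le_trans (normr_ge0 _) p1.
have sd0 : 0 <= s + d by rewrite addr_ge0// ltW.
rewrite /= (_ : _ - _ - _ - _ =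
   ((p.1 + q.1) ^+ i - p.1 ^+ i - q.1 * dpow i p.1) * (p.2 + q.2) ^+ j
   + (q.1 * dpow i p.1) * ((p.2 + q.2) ^+ j - p.2 ^+ j)
   + p.1 ^+ i * ((p.2 + q.2) ^+ j - p.2 ^+ j - q.2 * dpow j p.2)); last by ring.
have hd1 : 0 <= `|q.1| / d by rewrite divr_ge0// ltW.
have hd2 : 0 <= `|q.2| / d by rewrite divr_ge0// ltW.
have P1 : `|(p.2 + q.2) ^+ j| <= (s + d) ^+ j.
  by rewrite normrX lerXn2r ?nnegrE//; apply: le_trans (ler_normD _ _) _; exact: lerD.
have P2 : `|p.1 ^+ i| <= (s + d) ^+ i.
  by rewrite normrX lerXn2r ?nnegrE//; apply: le_trans p1 _; rewrite lerDl ltW.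
set U := (s + d) ^+ i in A1 A2 A3 P2 *; set V := (s + d) ^+ j in B1 B2 B3 P1 *.
have U0 : 0 <= U by exact: exprn_ge0. have V0 : 0 <= V by exact: exprn_ge0.
have T3 (A B C D E F : R) : `|A * B + C * D + E * F| <= `|A| * `|B| + `|C| * `|D| + `|E| * `|F|.
  rewrite -!normrM; apply: le_trans (ler_normD _ _) _; apply: lerD => //; exact: ler_normD.
apply: le_trans (T3 _ _ _ _ _ _) _.
apply: le_trans (lerD (lerD (ler_pM _ _ A1 P1) (ler_pM _ _ A2 B3)) (ler_pM _ _ P2 B1)) _ => //.
rewrite mulrDl; set x := _ / d; set y := _ / d.
have xyUV : 0 <= x * y * (U * V) by apply: mulr_ge0; apply: mulr_ge0.
rewrite -subr_ge0; apply: le_trans xyUV _; rewrite le_eqVlt; apply/orP; left; apply/eqP; ring.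
Qed.

Definition dx a i j := i.+1%:R * a i.+1 j.
Definition dy a i j := j.+1%:R * a i j.+1.
(** Terms of the differentiated series before the index shift: [mono_dx] and
   [mono_dy] compare them with the power series of coefficients dx a and dy a.
   *)
Definition dmx a p i j := a i j * (dpow i p.1 * p.2 ^+ j).
Definition dmy a p i j := a i j * (p.1 ^+ i * dpow j p.2).

Lemma dmx_absum a r M f s p : pser a r M f -> s < r -> inbox s p -> absum (dmx a p) (M / (r - s)).
Proof.
move=> ha sr [p1 p2] N; have d0 : 0 < r - s by rewrite subr_gt0.
have s0 := le_trans (normr_ge0 _) p1.
rewrite ler_pdivlMr// mulrC -dsumZ; apply: le_trans (ha.1 N); apply: le_dsum => i j.
have := dpow_le i p1 d0; rewrite (addrC s) subrK => H.
have T (A B C : R) : (r - s) * `|A * (B * C)| = `|A| * (`|(r - s) * B| * `|C|).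
  by rewrite !normrM (gtr0_norm d0); ring.
rewrite /dmx T /mono !(normrM (a i j * _)) (normrM (a i j))/=.
rewrite -mulrA ler_wpM2l// ler_pM// ?normrX.
  by apply: le_trans H _; rewrite lerXn2r ?nnegrE// ?ler_norm// ltW// (le_lt_trans s0).
rewrite lerXn2r ?nnegrE//; apply: le_trans p2 _; apply: le_trans (ltW sr) (ler_norm _).
Qed.

Lemma dmy_absum a r M f s p : pser a r M f -> s < r -> inbox s p -> absum (dmy a p) (M / (r - s)).
Proof.
move=> ha sr [p1 p2] N; have d0 : 0 < r - s by rewrite subr_gt0.
have s0 := le_trans (normr_ge0 _) p1.
rewrite ler_pdivlMr// mulrC -dsumZ; apply: le_trans (ha.1 N); apply: le_dsum => i j.
have := dpow_le j p2 d0; rewrite (addrC s) subrK => H.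
have T (A B C : R) : (r - s) * `|A * (B * C)| = `|A| * (`|B| * `|(r - s) * C|).
  by rewrite !normrM (gtr0_norm d0); ring.
rewrite /dmy T /mono !(normrM (a i j * _)) (normrM (a i j))/=.
rewrite -mulrA ler_wpM2l// ler_pM// ?normrX.
  rewrite lerXn2r ?nnegrE//; apply: le_trans p1 _; apply: le_trans (ltW sr) (ler_norm _).
by apply: le_trans H _; rewrite lerXn2r ?nnegrE// ?ler_norm// ltW// (le_lt_trans s0).
Qed.

Lemma mono_dx a p m n : dsum (mono (dx a) p) m n = dsum (dmx a p) m.+1 n.
Proof.
rewrite /dsum big_ord_recl/= [X in _ = X + _]big1 ?add0r; last first.
  by move=> j _; rewrite /dmx /dpow !mul0r mulr0.
by apply: eq_bigr => i _; apply: eq_bigr => j _; rewrite /mono /dx /dmx /dpow/= /bump/= ?add1n/=; ring.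
Qed.

Lemma mono_dy a p m n : dsum (mono (dy a) p) m n = dsum (dmy a p) m n.+1.
Proof.
apply: eq_bigr => i _; rewrite big_ord_recl/= /dmy /dpow mul0r !mulr0 add0r.
by apply: eq_bigr => j _; rewrite /mono /dy /dmy /dpow /= /bump/= ?add1n/=; ring.
Qed.

Lemma norm_mono_dx a p m n : dsum (fun i j => `|mono (dx a) p i j|) m n = dsum (fun i j => `|dmx a p i j|) m.+1 n.
Proof.
rewrite /dsum big_ord_recl/= [X in _ = X + _]big1 ?add0r; last first.
  by move=> j _; rewrite /dmx /dpow !mul0r mulr0 normr0.
by apply: eq_bigr => i _; apply: eq_bigr => j _; congr `|_|; rewrite /mono /dx /dmx /dpow/= /bump/= ?add1n/=; ring.
Qed.

Lemma norm_mono_dy a p m n : dsum (fun i j => `|mono (dy a) p i j|) m n = dsum (fun i j => `|dmy a p i j|) m n.+1.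
Proof.
apply: eq_bigr => i _; rewrite big_ord_recl/= /dmy /dpow mul0r !mulr0 normr0 add0r.
by apply: eq_bigr => j _; congr `|_|; rewrite /mono /dy /dmy /dpow /= /bump/= ?add1n/=; ring.
Qed.

(** Cauchy estimates: passing from radius r to s < r costs a factor 1 / (r - s)
   for a derivative and 1 / (r - s)^2 for the second order remainder. *)
Lemma pser_quad a r M f s : 0 <= s < r -> pser a r M f ->
  exists g1 g2, [/\ pser (dx a) s (M / (r - s)) g1, pser (dy a) s (M / (r - s)) g2 &
    forall p q, inbox s p -> inbox (r - s) q ->
     `|f (p + q) - f p - q.1 * g1 p - q.2 * g2 p| <=
       M / (r - s) ^+ 2 * (`|q.1| + `|q.2|) ^+ 2].
Proof.
move=> /andP[s0 sr] ha; have d0 : 0 < r - s by rewrite subr_gt0.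
have /choice[g1 hg1] : forall p, exists l : R, inbox s p -> dsum (dmx a p) n n @[n --> \oo] --> l.
  move=> p; have [hp|hp] := pselect (inbox s p); last by exists 0.
  by have [l hl] := absum_cvg_ex (dmx_absum ha sr hp); exists l.
have /choice[g2 hg2] : forall p, exists l : R, inbox s p -> dsum (dmy a p) n n @[n --> \oo] --> l.
  move=> p; have [hp|hp] := pselect (inbox s p); last by exists 0.
  by have [l hl] := absum_cvg_ex (dmy_absum ha sr hp); exists l.
exists g1, g2; split.
- split=> [N|p hp].
    rewrite norm_mono_dx; apply: le_trans (dmx_absum ha sr (inboxxx s0) N.+1).
    exact: dsum_rect_le.
  under eq_fun do rewrite mono_dx.
  have /cvgnP hd := dsum_rect (dmx_absum ha sr hp) (hg1 p hp) (m := S) (n := id) (fun N => conj (leqnSn N) (leqnn N)).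
  by apply/cvgnP.
- split=> [N|p hp].
    rewrite norm_mono_dy; apply: le_trans (dmy_absum ha sr (inboxxx s0) N.+1).
    exact: dsum_rect_le.
  under eq_fun do rewrite mono_dy.
  have /cvgnP hd := dsum_rect (dmy_absum ha sr hp) (hg2 p hp) (m := id) (n := S) (fun N => conj (leqnn N) (leqnSn N)).
  by apply/cvgnP.
move=> p q hp hq.
have hp' : inbox r p by apply: inbox_le hp; exact: ltW.
have hpq : inbox r (p + q).
  case: hp hq => [p1 p2] [q1 q2]; split.
    by rewrite -(subrK s r) addrC; apply: le_trans (ler_normD _ _) _; exact: lerD.
  by rewrite -(subrK s r) addrC; apply: le_trans (ler_normD _ _) _; exact: lerD.
have h : (dsum (mono a (p + q)) n n - dsum (mono a p) n n - q.1 * dsum (dmx a p) n n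
    - q.2 * dsum (dmy a p) n n) @[n --> \oo] --> f (p + q) - f p - q.1 * g1 p - q.2 * g2 p.
  apply: cvgB; last by apply: cvgMr; exact: hg2.
  apply: cvgB; last by apply: cvgMr; exact: hg1.
  by apply: cvgB; exact: ha.2.
apply: (cvgr_to_le (cvg_norm h)); apply: nearW => n.
rewrite (_ : M / _ * _ = ((`|q.1| + `|q.2|) / (r - s)) ^+ 2 * M); last first.
  by field; rewrite gt_eqF.
apply: le_trans (ler_wpM2l (sqr_ge0 _) (ha.1 n)).
rewrite -!dsumZ /dsum -!sumrB; apply: le_trans (ler_norm_sum _ _ _) _.
apply: ler_sum => i _; rewrite -!sumrB; apply: le_trans (ler_norm_sum _ _ _) _.
apply: ler_sum => j _.
have := mono_rem i j hp hq d0; rewrite (addrC s) subrK => H.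
rewrite /mono /dmx /dmy.
rewrite (_ : _ - _ - _ - _ = a i j * ((p + q).1 ^+ i * (p + q).2 ^+ j - p.1 ^+ i * p.2 ^+ j
     - q.1 * (dpow i p.1 * p.2 ^+ j) - q.2 * (p.1 ^+ i * dpow j p.2))); last by ring.
rewrite !normrM; apply: le_trans (ler_wpM2l (normr_ge0 _) H) _.
rewrite /= mulrCA ler_wpM2l ?sqr_ge0// !mulrA ler_pM ?mulr_ge0 ?exprn_ge0 ?(le_trans s0 (ltW sr))//.
  by rewrite ler_wpM2l// ler_norm.
exact: ler_norm.
Qed.

Lemma pser_der a r M f s : 0 <= s < r -> pser a r M f ->
  [/\ pser (dx a) s (M / (r - s)) (dX f), pser (dy a) s (M / (r - s)) (dY f) &
    forall p, inbox s p -> differentiable f p /\ (forall q, inbox (r - s) q ->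
     `|f (p + q) - f p - q.1 * dX f p - q.2 * dY f p| <=
       M / (r - s) ^+ 2 * (`|q.1| + `|q.2|) ^+ 2)].
Proof.
move=> sr ha; have [g1 [g2 [h1 h2 h3]]] := pser_quad sr ha.
have d0 : 0 < r - s by rewrite subr_gt0; case/andP: sr.
have H p (hp : inbox s p) := quad_diff d0 (h3 p ^~ hp).
split.
- by apply: pser_ext h1 => p /H[].
- by apply: pser_ext h2 => p /H[].
move=> p hp; have [? -> ->] := H p hp; split=> // q hq; exact: h3.
Qed.

Lemma maj_der r M f s : 0 <= s < r -> maj f r M ->
  [/\ maj (dX f) s (M / (r - s)), maj (dY f) s (M / (r - s)) &
    forall p, inbox s p -> differentiable f p /\ (forall q, inbox (r - s) q ->
     `|f (p + q) - f p - q.1 * dX f p - q.2 * dY f p| <=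
       M / (r - s) ^+ 2 * (`|q.1| + `|q.2|) ^+ 2)].
Proof.
move=> sr [a ha]; have [h1 h2 h3] := pser_der sr ha.
by split=> //; [exists (dx a)|exists (dy a)].
Qed.

(** Termwise differentiation: the quadratic remainders of the terms add up, so
   [quad_diff] applies to the sum. *)
Lemma maj_series_der (m : nat -> nat -> R * R -> R) (B : nat -> nat -> R) K F r s : 0 <= s < r ->
  (forall i j, maj (m i j) r (B i j)) -> absum B K ->
  (forall p, inbox r p -> dsum (fun i j => m i j p) n n @[n --> \oo] --> F p) ->
  forall p, inbox s p ->
   dsum (fun i j => dX (m i j) p) n n @[n --> \oo] --> dX F p /\
   dsum (fun i j => dY (m i j) p) n n @[n --> \oo] --> dY F p.
Proof.
move=> sr hm hB hF p hp.
have d0 : 0 < r - s by rewrite subr_gt0; case/andP: sr.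
have B0 i j : 0 <= B i j by exact: maj_ge0 (hm i j).
have absB (G : nat -> nat -> R) : (forall i j, `|G i j| <= B i j / (r - s)) -> absum G (K / (r - s)).
  move=> hG N; rewrite ler_pdivlMr// mulrC -dsumZ; apply: le_trans (hB N); apply: le_dsum => i j.
  by rewrite mulrC -ler_pdivlMr// (ger0_norm (B0 _ _)).
have [L1 hL1] : exists l : R, dsum (fun i j => dX (m i j) p) n n @[n --> \oo] --> l.
  apply: absum_cvg_ex; apply: absB => i j; have [h _ _] := maj_der sr (hm i j).
  exact: maj_bound h hp.
have [L2 hL2] : exists l : R, dsum (fun i j => dY (m i j) p) n n @[n --> \oo] --> l.
  apply: absum_cvg_ex; apply: absB => i j; have [_ h _] := maj_der sr (hm i j).
  exact: maj_bound h hp.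
have [|_ -> ->] := @quad_diff F p L1 L2 (K / (r - s) ^+ 2) (r - s) d0; last by [].
move=> q hq.
have hp' : inbox r p by apply: inbox_le hp; apply: ltW; case/andP: sr.
have hpq : inbox r (p + q).
  case: hp hq => [p1 p2] [q1 q2]; split.
    by rewrite -(subrK s r) addrC; apply: le_trans (ler_normD _ _) _; exact: lerD.
  by rewrite -(subrK s r) addrC; apply: le_trans (ler_normD _ _) _; exact: lerD.
have h : (dsum (fun i j => m i j (p + q)) n n - dsum (fun i j => m i j p) n n
    - q.1 * dsum (fun i j => dX (m i j) p) n n
    - q.2 * dsum (fun i j => dY (m i j) p) n n) @[n --> \oo] --> F (p + q) - F p - q.1 * L1 - q.2 * L2.
  apply: cvgB; last by apply: cvgMr; exact: hL2.
  apply: cvgB; last by apply: cvgMr; exact: hL1.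
  by apply: cvgB; exact: hF.
apply: (cvgr_to_le (cvg_norm h)); apply: nearW => n.
rewrite (_ : K / _ * _ = ((`|q.1| + `|q.2|) / (r - s)) ^+ 2 * K); last first.
  by field; rewrite gt_eqF.
apply: le_trans (ler_wpM2l (sqr_ge0 _) (hB n)).
rewrite -!dsumZ /dsum -!sumrB; apply: le_trans (ler_norm_sum _ _ _) _.
apply: ler_sum => i _; rewrite -!sumrB; apply: le_trans (ler_norm_sum _ _ _) _.
apply: ler_sum => j _; have [_ _ H] := maj_der sr (hm i j).
have [_ {}H] := H p hp; apply: le_trans (H q hq) _.
rewrite (ger0_norm (B0 i j)) le_eqVlt; apply/orP; left; apply/eqP.
by field; rewrite gt_eqF.
Qed.

(** The identity theorem on a quadrant touching the origin, by induction on i +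
   j through the derivatives.  Vanishing on a quadrant suffices, which permits
   to divide by x or xi, or to take square roots, before concluding. *)
Lemma pser_eq0 a r M f d : 0 < r -> 0 < d -> pser a r M f ->
  (forall p, 0 < p.1 < d -> 0 < p.2 < d -> f p = 0) -> forall i j, a i j = 0.
Proof.
move=> r0 d0 ha hf i j; have [n ijn] : exists n, (i + j = n)%N by exists (i + j)%N.
elim: n i j a r M f r0 ha hf ijn => [|n IH] i j a r M f r0 ha hf.
  move/eqP; rewrite addn_eq0 => /andP[/eqP-> /eqP->].
  rewrite (pser_00 (ltW r0) ha).
  have sr : 0 <= (0 : R) < r by rewrite lexx r0.
  have [_ _ /(_ 0 (inbox0 (lexx 0)))[/differentiable_continuous + _]] := pser_der sr ha.
  move=> /cvgrPdist_le h; apply/eqP; rewrite -normr_eq0 eq_le normr_ge0 andbT.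
  apply/ler_addgt0Pr => e e0; rewrite add0r.
  have /near0P[b b0 hb] := h e e0.
  pose c := Num.min (d / 2) b.
  have c0 : 0 < c by rewrite lt_min b0 divr_gt0.
  have cd : c < d by rewrite gt_min ltr_pdivrMr// ltr_pMr// ltr1n.
  have := hb (c, c); rewrite (hf (c, c)) ?subr0 /= ?c0 ?cd//; apply.
  by apply: inbox_le (inboxxx (ltW c0)); rewrite ge_min lexx orbT.
have sr : 0 <= r / 2 < r by rewrite divr_ge0 ?ltW//= ltr_pdivrMr// ltr_pMr// ltr1n.
have [h1 h2 _] := pser_der sr ha.
have s0 : 0 < r / 2 by rewrite divr_gt0.
have near_q p : 0 < p.1 < d -> 0 < p.2 < d -> \forall q \near p, f q = (cst 0) q.
  move=> /andP[a1 a2] /andP[a3 a4].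
  apply/nearboxP; exists (Num.min (Num.min (p.1 / 2) ((d - p.1) / 2)) (Num.min (p.2 / 2) ((d - p.2) / 2))).
    by rewrite !lt_min !divr_gt0// subr_gt0.
  move=> q [q1 q2]; move: q1 q2; rewrite !le_min => /andP[/andP[q1 q2] _] /andP[_ /andP[q3 q4]].
  rewrite hf//=; move: q1 q2 q3 q4 => /ler_normlP[? ?] /ler_normlP[? ?] /ler_normlP[? ?] /ler_normlP[? ?].
    by apply/andP; split; lra.
  by apply/andP; split; lra.
case: i => [|i]; last first.
  rewrite addSn => -[ij].
  have hX p : 0 < p.1 < d -> 0 < p.2 < d -> dX f p = 0.
    by move=> p1 p2; rewrite /dX (near_eq_derive _ (near_q p p1 p2)) derive_cst.
  by have /eqP := IH i j _ _ _ _ s0 h1 hX ij; rewrite mulf_eq0 pnatr_eq0/= => /eqP.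
case: j => [//|j]; rewrite addnS => -[ij].
have hY p : 0 < p.1 < d -> 0 < p.2 < d -> dY f p = 0.
  by move=> p1 p2; rewrite /dY (near_eq_derive _ (near_q p p1 p2)) derive_cst.
by have /eqP := IH 0%N j _ _ _ _ s0 h2 hY ij; rewrite mulf_eq0 pnatr_eq0/= => /eqP.
Qed.

End Derivatives.

(** * Series of power series, division by a coordinate *)

Section SeriesOfFunctions.
Variable R : realType.
Implicit Types (a : nat -> nat -> R) (f g : R * R -> R) (r M s d : R) (p q : R * R).

(** A simple sequence seen as a double one, so that the results on double series
   apply to simple series. *)
Definition column0 (u : nat -> R) i j : R := if j == 0%N then u i else 0.

Lemma dsum_col0 (u : nat -> R) m n : dsum (column0 u) m n.+1 = \sum_(i < m) u i.
Proof.
by apply: eq_bigr => i _; rewrite big_ord_recl big1 ?addr0.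
Qed.

Lemma absum_col0 (u : nat -> R) K : (forall i, 0 <= u i) -> (forall N, \sum_(i < N) u i <= K) ->
  absum (column0 u) K.
Proof.
move=> u0 hK [|N]; first by have := hK 0%N; rewrite /dsum !big_ord0.
rewrite (@eq_dsum _ _ (column0 u)) ?dsum_col0// => i j; rewrite /column0.
by case: ifP => _; rewrite ger0_norm.
Qed.

Lemma cvg_col0 (u : nat -> R) (l : R) :
  (\sum_(i < n) u i @[n --> \oo] --> l) <-> (dsum (column0 u) n n @[n --> \oo] --> l).
Proof.
rewrite -[X in X <-> _]cvg_shiftS -[X in _ <-> X]cvg_shiftS/=.
by under [in X in _ <-> X]eq_fun do rewrite dsum_col0.
Qed.

Definition fcolumn (m : nat -> R * R -> R) i j p : R := column0 (m ^~ p) i j.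

Lemma maj_fcol0 (m : nat -> R * R -> R) (B : nat -> R) r : 0 <= r ->
  (forall i, maj (m i) r (B i)) -> forall i j, maj (fcolumn m i j) r (column0 B i j).
Proof.
move=> r0 h i j; rewrite /fcolumn /column0; case: ifP => _; first exact: h.
by have := @maj_cst _ 0 r r0; rewrite normr0.
Qed.

Lemma maj_series1 (m : nat -> R * R -> R) (B : nat -> R) K F r : 0 < r ->
  (forall i, maj (m i) r (B i)) -> (forall N, \sum_(i < N) B i <= K) ->
  (forall p, inbox r p -> \sum_(i < n) m i p @[n --> \oo] --> F p) ->
  maj F r K.
Proof.
move=> r0 hm hB hF.
apply: (@maj_series _ (fcolumn m) (column0 B)) => //.
- by apply: maj_fcol0 => //; exact: ltW.
- by apply: absum_col0 => // i; exact: maj_ge0 (hm i).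
- by move=> p hp; apply/(cvg_col0 (m ^~ p)); exact: hF.
Qed.

Lemma maj_series1_ex (m : nat -> R * R -> R) (B : nat -> R) K r : 0 < r ->
  (forall i, maj (m i) r (B i)) -> (forall N, \sum_(i < N) B i <= K) ->
  exists2 F, maj F r K & forall p, inbox r p -> \sum_(i < n) m i p @[n --> \oo] --> F p.
Proof.
move=> r0 hm hB.
have [||F hF h] := @maj_series_ex _ (fcolumn m) (column0 B) K r r0.
- by apply: maj_fcol0 => //; exact: ltW.
- by apply: absum_col0 => // i; exact: maj_ge0 (hm i).
by exists F => // p hp; apply/(cvg_col0 (m ^~ p)); exact: h.
Qed.

Lemma maj_series1_der (m : nat -> R * R -> R) (B : nat -> R) K F r s : 0 <= s < r ->
  (forall i, maj (m i) r (B i)) -> (forall N, \sum_(i < N) B i <= K) ->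
  (forall p, inbox r p -> \sum_(i < n) m i p @[n --> \oo] --> F p) ->
  forall p, inbox s p ->
   (\sum_(i < n) dX (m i) p @[n --> \oo] --> dX F p) /\
   (\sum_(i < n) dY (m i) p @[n --> \oo] --> dY F p).
Proof.
move=> sr hm hB hF p hp.
have r0 : 0 <= r by case/andP: sr => s0 /ltW; exact: le_trans.
have [||h1 h2] := maj_series_der sr (maj_fcol0 r0 hm) (absum_col0 _ hB) _ hp (F := F).
- by move=> i; exact: maj_ge0 (hm i).
- by move=> q hq; apply/(cvg_col0 (m ^~ q)); exact: hF.
split.
  have E i j : column0 (fun i => dX (m i) p) i j = dX (fcolumn m i j) p.
    by rewrite /column0 /fcolumn /column0; case: ifP => // _; rewrite /dX derive_cst.
  apply/(cvg_col0 (fun i => dX (m i) p)).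
  rewrite (funext (fun n => eq_dsum n n E)); exact: h1.
have E i j : column0 (fun i => dY (m i) p) i j = dY (fcolumn m i j) p.
  by rewrite /column0 /fcolumn /column0; case: ifP => // _; rewrite /dY derive_cst.
apply/(cvg_col0 (fun i => dY (m i) p)).
rewrite (funext (fun n => eq_dsum n n E)); exact: h2.
Qed.

Lemma pser_unique a r M M' f g p : pser a r M f -> pser a r M' g -> inbox r p -> f p = g p.
Proof.
by move=> [_ h1] [_ h2] hp; apply: cvg_unique (h1 p hp) (h2 p hp).
Qed.

Lemma pser_splity a r M f : 0 < r -> pser a r M f ->
  exists g, pser (fun i j => a i j.+1) r (M / r) g /\
    forall p, inbox r p -> f p = f (p.1, 0) + p.2 * g p.
Proof.
move=> r0 ha; have rr := inboxxx (ltW r0).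
have E p m n : p.2 * dsum (mono (fun i j => a i j.+1) p) m n =
    dsum (mono a p) m n.+1 - dsum (mono a (p.1, 0)) m n.+1.
  rewrite /dsum mulr_sumr -sumrB; apply: eq_bigr => i _.
  rewrite mulr_sumr -sumrB big_ord_recl/= {1 2}/mono/= subrr add0r.
  apply: eq_bigr => j _; rewrite /mono/= /bump/= add1n !exprS mul0r; ring.
have B : absum (mono (fun i j => a i j.+1) (r, r)) (M / r).
  move=> N; rewrite ler_pdivlMr// mulrC -dsumZ; apply: le_trans (ha.1 N.+1).
  apply: (@le_trans _ _ (dsum (fun i j => `|mono a (r, r) i j|) N N.+1)); last exact: dsum_rect_le.
  apply: ler_sum => i _; rewrite big_ord_recl/= ler_wpDl//.
  apply: ler_sum => j _; rewrite /mono/= /bump/= add1n exprS !normrM (gtr0_norm r0).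
  by rewrite le_eqVlt; apply/orP; left; apply/eqP; ring.
have /choice[g hg] : forall p, exists l : R, inbox r p ->
    dsum (mono (fun i j => a i j.+1) p) n n @[n --> \oo] --> l.
  move=> p; have [hp|hp] := pselect (inbox r p); last by exists 0.
  have [|l hl] := @absum_cvg_ex R (mono (fun i j => a i j.+1) p) (M / r).
    by apply: le_absum B => i j; exact: mono_le.
  by exists l.
exists g; split=> // p hp.
have hp0 : inbox r (p.1, 0) by case: hp => h1 h2; split=> //; rewrite normr0 ltW.
have h1 : (p.2 * dsum (mono (fun i j => a i j.+1) p) n n) @[n --> \oo] --> p.2 * g p.
  by apply: cvgMr; exact: hg.
have h2 : (p.2 * dsum (mono (fun i j => a i j.+1) p) n n) @[n --> \oo] --> f p - f (p.1, 0).
  under eq_fun do rewrite E.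
  have rc t B' (l : R) : absum t B' -> dsum t n n @[n --> \oo] --> l ->
      dsum t n n.+1 @[n --> \oo] --> l.
    move=> tB tl; have /cvgnP hd := dsum_rect tB tl (m := id) (n := S) (fun N => conj (leqnn N) (leqnSn N)).
    by apply/cvgnP.
  apply: cvgB; apply: rc.
  - exact: pser_absum ha hp.
  - exact: ha.2.
  - exact: pser_absum ha hp0.
  - exact: ha.2.
by rewrite (cvg_unique _ h1 h2)//= addrC subrK.
Qed.

Lemma pser_swap a r M f : pser a r M f -> pser (fun i j => a j i) r M (fun p => f (p.2, p.1)).
Proof.
move=> ha; have E p n : dsum (mono (fun i j => a j i) p) n n = dsum (mono a (p.2, p.1)) n n.
  by rewrite /dsum exchange_big; apply: eq_bigr => i _; apply: eq_bigr => j _; rewrite /mono/=; ring.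
split.
  move=> N; apply: le_trans (ha.1 N); rewrite /dsum exchange_big; apply: ler_sum => i _.
  by apply: ler_sum => j _; rewrite /mono/= -mulrA (mulrC (r ^+ j)) mulrA.
by move=> p [h1 h2]; under eq_fun do rewrite E; apply: ha.2.
Qed.

Lemma pser_splitx a r M f : 0 < r -> pser a r M f ->
  exists g, pser (fun i j => a i.+1 j) r (M / r) g /\
    forall p, inbox r p -> f p = f (0, p.2) + p.1 * g p.
Proof.
move=> r0 /pser_swap/(pser_splity r0)[g [/pser_swap hg h]].
exists (fun p => g (p.2, p.1)); split=> // p [h1 h2].
by have := h (p.2, p.1) (conj h2 h1); rewrite /= -surjective_pairing.
Qed.

End SeriesOfFunctions.

(** * Differentiation rules for functions of two variables *)

Section Grad.
Variable R : realType.
Implicit Types (f g F u v : R * R -> R) (p q : R * R).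

(** Bundling differentiability with the values of the partial derivatives lets
   derivatives be computed by composing rules, as the partial derivatives alone
   do not obey the chain rule. *)
Variant grad f p (a b : R) : Prop := Grad of differentiable f p & dX f p = a & dY f p = b.

Lemma gradE f p : differentiable f p -> grad f p (dX f p) (dY f p).
Proof. by split. Qed.

Lemma grad_eq f p a b a' b' : grad f p a b -> a = a' -> b = b' -> grad f p a' b'.
Proof. by move=> h <- <-. Qed.

Lemma near_differentiable f g p : (\forall q \near p, f q = g q) ->
  differentiable f p -> differentiable g p.
Proof.
move=> fg df; have [cd /eqaddoP E] := (diff_locallyP p f).1 df.
have E' : g \o shift p = cst (g p) + 'd f p +o_ (0 : R * R) id.
  apply/eqaddoP => e e0.
  have h2 : \forall q \near (0 : R * R), f (q + p) = g (q + p).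
    move/nearboxP: fg => [r r0 h]; apply/near0P; exists r => // q /h.
    by rewrite (addrC q).
  near=> q.
  rewrite [X in `|X|](_ : _ = (f \o shift p - (cst (f p) + 'd f p)) q); first by near: q; exact: E.
  have e1 : f (q + p) = g (q + p) by near: q.
  transitivity (g (q + p) - (g p + 'd f p q)) => //.
  by rewrite -e1 -(nbhs_singleton fg).
have D := diff_unique cd E'.
by apply/diff_locallyP; split; rewrite D.
Unshelve. all: by end_near. Qed.

Lemma grad_ext f g p a b : (\forall q \near p, f q = g q) -> grad f p a b -> grad g p a b.
Proof.
move=> h [h1 h2 h3]; split.
- exact: near_differentiable h h1.
- by rewrite -h2 /dX; apply: esym; exact: near_eq_derive.
- by rewrite -h3 /dY; apply: esym; exact: near_eq_derive.
Qed.

Lemma grad_eqf f g p a b : (forall q, f q = g q) -> grad f p a b -> grad g p a b.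
Proof. by move=> /funext ->. Qed.

Lemma diffE_lin2 f p q : differentiable f p -> 'd f p q = q.1 * dX f p + q.2 * dY f p.
Proof.
move=> h; rewrite /dX /dY !deriveE//.
rewrite {1}(_ : q = q.1 *: ((1, 0) : R * R) + q.2 *: ((0, 1) : R * R)); last first.
  transitivity ((q.1 * 1 + q.2 * 0, q.1 * 0 + q.2 * 1)); last by [].
  by rewrite !mulr1 !mulr0 addr0 add0r -surjective_pairing.
by rewrite linearD !linearZ.
Qed.

Lemma grad_cst c p : grad (fun=> c) p 0 0.
Proof. by split; [exact: differentiable_cst|rewrite /dX derive_cst|rewrite /dY derive_cst]. Qed.

Lemma gradD f g p a b a' b' : grad f p a b -> grad g p a' b' ->
  grad (fun q => f q + g q) p (a + a') (b + b').
Proof.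
move=> [h1 <- <-] [h1' <- <-]; split; first exact: differentiableD.
  by rewrite /dX deriveD//; exact: diff_derivable.
by rewrite /dY deriveD//; exact: diff_derivable.
Qed.

Lemma gradN f p a b : grad f p a b -> grad (fun q => - f q) p (- a) (- b).
Proof.
move=> [h1 <- <-]; split; first exact: differentiableN.
  by rewrite /dX deriveN//; exact: diff_derivable.
by rewrite /dY deriveN//; exact: diff_derivable.
Qed.

Lemma gradB f g p a b a' b' : grad f p a b -> grad g p a' b' ->
  grad (fun q => f q - g q) p (a - a') (b - b').
Proof. by move=> hf hg; exact: gradD hf (gradN hg). Qed.

Lemma gradM f g p a b a' b' : grad f p a b -> grad g p a' b' ->
  grad (fun q => f q * g q) p (f p * a' + g p * a) (f p * b' + g p * b).
Proof.
move=> [h1 <- <-] [h1' <- <-]; split; first exact: differentiableM.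
  by rewrite /dX deriveM//; exact: diff_derivable.
by rewrite /dY deriveM//; exact: diff_derivable.
Qed.

Lemma gradX f p a b n : grad f p a b ->
  grad (fun q => f q ^+ n) p (n%:R * f p ^+ n.-1 * a) (n%:R * f p ^+ n.-1 * b).
Proof.
move=> h; elim: n => [|n IH]; first by apply: grad_eq (grad_cst 1 p) _ _; rewrite !mul0r.
apply: (@grad_eq _ _ (f p * (n%:R * f p ^+ n.-1 * a) + f p ^+ n * a)
  (f p * (n%:R * f p ^+ n.-1 * b) + f p ^+ n * b)).
- by apply: grad_eqf (gradM h IH) => q; rewrite exprS.
- by case: n {IH} => [|n]/=; rewrite ?exprS -?natr1; ring.
- by case: n {IH} => [|n]/=; rewrite ?exprS -?natr1; ring.
Qed.

Lemma quad_grad f p (a b C d : R) : 0 < d ->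
  (forall q, inbox d q ->
     `|f (p + q) - f p - q.1 * a - q.2 * b| <= C * (`|q.1| + `|q.2|) ^+ 2) -> grad f p a b.
Proof. by move=> d0 /(quad_diff d0)[]. Qed.

Lemma grad_fst p : grad (fun q => q.1) p 1 0.
Proof.
have h : grad (lin2 1 0) p 1 0.
  apply: (@quad_grad _ _ _ _ 0 1) => // q _; rewrite mul0r /lin2/=.
  by rewrite le_eqVlt; apply/orP; left; apply/eqP; apply/normr0P; apply/eqP; ring.
by apply: grad_eqf h => q; rewrite /lin2 mulr1 mulr0 addr0.
Qed.

Lemma grad_snd p : grad (fun q => q.2) p 0 1.
Proof.
have h : grad (lin2 0 1) p 0 1.
  apply: (@quad_grad _ _ _ _ 0 1) => // q _; rewrite mul0r /lin2/=.
  by rewrite le_eqVlt; apply/orP; left; apply/eqP; apply/normr0P; apply/eqP; ring.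
by apply: grad_eqf h => q; rewrite /lin2 mulr1 mulr0 add0r.
Qed.

Lemma grad_sum (I : Type) (s : seq I) (f : I -> R * R -> R) p (a b : I -> R) :
  (forall i, grad (f i) p (a i) (b i)) ->
  grad (fun q => \sum_(i <- s) f i q) p (\sum_(i <- s) a i) (\sum_(i <- s) b i).
Proof.
move=> h; elim: s => [|i s IH].
  rewrite !big_nil; by apply: grad_eqf (grad_cst 0 p) => q; rewrite big_nil.
rewrite !big_cons; by apply: grad_eqf (gradD (h i) IH) => q; rewrite big_cons.
Qed.

Lemma grad_comp F u v p A B a b c d : grad F (u p, v p) A B ->
  grad u p a b -> grad v p c d ->
  grad (fun q => F (u q, v q)) p (A * a + B * c) (A * b + B * d).
Proof.
move=> [hF <- <-] [hu <- <-] [hv <- <-].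
have huv : differentiable (fun q => (u q, v q)) p by exact: differentiable_pair.
have hc : differentiable (F \o (fun q => (u q, v q))) p by exact: differentiable_comp.
have E w : 'D_w (F \o (fun q => (u q, v q))) p =
    'd u p w * dX F (u p, v p) + 'd v p w * dY F (u p, v p).
  apply: (etrans (deriveE _ hc)).
  apply: (etrans (congr1 (fun L : R * R -> R => L w) (diff_comp huv hF))).
  apply: (etrans (congr1 (fun z => 'd F (u p, v p) z)
    (congr1 (fun L : R * R -> R * R => L w) (diff_pair hu hv)))).
  exact: (diffE_lin2 _ hF).
split; first exact: hc.
  have -> : dX (fun q => F (u q, v q)) p = 'D_((1, 0) : R * R) (F \o (fun q => (u q, v q))) p by [].
  by rewrite E -(deriveE _ hu) -(deriveE _ hv) mulrC [X in _ + X]mulrC.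
have -> : dY (fun q => F (u q, v q)) p = 'D_((0, 1) : R * R) (F \o (fun q => (u q, v q))) p by [].
by rewrite E -(deriveE _ hu) -(deriveE _ hv) mulrC [X in _ + X]mulrC.
Qed.

End Grad.

(** * Analytic germs of two variables *)

Section Germs2.
Variable R : realType.
Implicit Types (a : nat -> nat -> R) (f g F u v w : R * R -> R) (r M s d : R) (p q : R * R).

(** The passage between the definition of an analytic germ and majorants:
   convergence of the series of absolute values at the corner (r, r) of a box
   gives the bound M. *)
Lemma analytic2P f : analytic2 f <-> exists r M, 0 < r /\ maj f r M.
Proof.
split.
  move=> [a /near0P[r r0 h]].
  have [h1 h2] := h (r, r) (inboxxx (ltW r0)).
  have E N : psum2 (fun i j => `|a i j|) (`|(r, r).1|, `|(r, r).2|) N =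
      dsum (fun i j => `|mono a (r, r) i j|) N N.
    by rewrite /psum2; apply: eq_bigr => i _; apply: eq_bigr => j _; rewrite /mono/= !normrM !normrX.
  exists r, (limn (psum2 (fun i j => `|a i j|) (`|(r, r).1|, `|(r, r).2|))); split=> //.
  exists a; split=> [N|p hp]; last by have [_] := h p hp.
  rewrite -E; apply: nondecreasing_cvgn_le => //.
  by rewrite (funext E); exact: dsum_norm_mono.
move=> [r [M [r0 [a ha]]]]; exists a; apply/near0P; exists r => // p hp; split; last exact: ha.2.
have E N : psum2 (fun i j => `|a i j|) (`|p.1|, `|p.2|) N =
      dsum (fun i j => `|mono a p i j|) N N.
  by rewrite /psum2; apply: eq_bigr => i _; apply: eq_bigr => j _; rewrite /mono/= !normrM !normrX.
rewrite (funext E); apply: nondecreasing_is_cvgn; first exact: dsum_norm_mono.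
by exists M => _ [N _ <-]; exact: (pser_absum ha hp).
Qed.

Lemma analytic2_maj f : analytic2 f -> exists2 r, 0 < r & exists M, maj f r M.
Proof. by move=> /analytic2P [r [M [r0 h]]]; exists r => //; exists M. Qed.

Lemma maj_analytic2 f r M : 0 < r -> maj f r M -> analytic2 f.
Proof. by move=> r0 h; apply/analytic2P; exists r, M. Qed.

Lemma an_eqf f g : (forall p, f p = g p) -> analytic2 f -> analytic2 g.
Proof. by move=> /funext ->. Qed.

Lemma an2_maj f g : analytic2 f -> analytic2 g -> exists r, 0 < r /\ exists M N, maj f r M /\ maj g r N.
Proof.
move=> /analytic2_maj[r r0 [M hM]] /analytic2_maj[s s0 [N hN]].
have m0 : 0 < Num.min r s by rewrite lt_min r0.
exists (Num.min r s); split => //; exists M, N; split.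
  by apply: maj_le hM => //; [exact: ltW|rewrite ge_min lexx].
by apply: maj_le hN => //; [exact: ltW|rewrite ge_min lexx orbT].
Qed.

Lemma an_cst c : analytic2 (fun _ : R * R => c).
Proof. exact: (maj_analytic2 ltr01 (@maj_cst _ c 1 ler01)). Qed.
Lemma an_fst : analytic2 (fun p : R * R => p.1).
Proof. exact: (maj_analytic2 ltr01 (@maj_fst _ 1 ler01)). Qed.
Lemma an_snd : analytic2 (fun p : R * R => p.2).
Proof. exact: (maj_analytic2 ltr01 (@maj_snd _ 1 ler01)). Qed.

Lemma an_add f g : analytic2 f -> analytic2 g -> analytic2 (fun p => f p + g p).
Proof.
move=> hf hg; have [r [r0 [M [N [h1 h2]]]]] := an2_maj hf hg.
exact: (maj_analytic2 r0 (maj_add h1 h2)).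
Qed.

Lemma an_mul f g : analytic2 f -> analytic2 g -> analytic2 (fun p => f p * g p).
Proof.
move=> hf hg; have [r [r0 [M [N [h1 h2]]]]] := an2_maj hf hg.
exact: (maj_analytic2 r0 (maj_mul r0 h1 h2)).
Qed.

Lemma an_opp f : analytic2 f -> analytic2 (fun p => - f p).
Proof. by move=> /analytic2_maj[r r0 [M h]]; exact: (maj_analytic2 r0 (maj_opp h)). Qed.

Lemma an_sub f g : analytic2 f -> analytic2 g -> analytic2 (fun p => f p - g p).
Proof. by move=> hf hg; apply: an_add => //; exact: an_opp. Qed.

Lemma an_exp f n : analytic2 f -> analytic2 (fun p => f p ^+ n).
Proof. by move=> /analytic2_maj[r r0 [M h]]; exact: (maj_analytic2 r0 (maj_exp n r0 h)). Qed.

Lemma an_sum (I : eqType) (s : seq I) (f : I -> R * R -> R) :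
  (forall i, i \in s -> analytic2 (f i)) -> analytic2 (fun p => \sum_(i <- s) f i p).
Proof.
elim: s => [|i s IH] h.
  by apply: an_eqf (an_cst 0) => p; rewrite big_nil.
apply: (@an_eqf (fun p => f i p + \sum_(i <- s) f i p)); first by move=> p; rewrite big_cons.
apply: an_add; first by apply: h; rewrite mem_head.
by apply: IH => j js; apply: h; rewrite inE js orbT.
Qed.

Lemma an_small f e : analytic2 f -> f 0 = 0 -> 0 < e ->
  exists2 r, 0 < r & forall s, 0 <= s <= r -> maj f s e.
Proof.
move=> /analytic2_maj[r r0 [M h]] f0 e0; have M0 := maj_ge0 h.
have c0 : 0 < e * r / (M + 1) by rewrite divr_gt0 ?mulr_gt0// ltr_wpDl.
exists (Num.min r (e * r / (M + 1))); first by rewrite lt_min r0.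
move=> s /andP[s0]; rewrite le_min => /andP[sr se].
apply: maj_le (maj_shrink r0 _ h f0) => //; last by rewrite s0.
rewrite mulrAC ler_pdivrMr//.
move: se; rewrite ler_pdivlMr ?ltr_wpDl// => /(le_trans _); apply.
by rewrite ler_wpM2l// lerDl.
Qed.

Lemma near_comp (Q : R * R -> Prop) u v : (\forall p \near (0 : R * R), Q p) ->
  analytic2 u -> analytic2 v -> u 0 = 0 -> v 0 = 0 ->
  \forall p \near (0 : R * R), Q (u p, v p).
Proof.
move=> /near0P[r r0 h] hu hv u0 v0.
have [r1 r10 h1] := an_small hu u0 r0; have [r2 r20 h2] := an_small hv v0 r0.
have m0 : 0 < Num.min r1 r2 by rewrite lt_min r10.
apply/near0P; exists (Num.min r1 r2) => // q hq; apply: h; split.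
  by apply: (maj_bound (h1 (Num.min r1 r2) _)) => //; rewrite (ltW m0) ge_min lexx.
by apply: (maj_bound (h2 (Num.min r1 r2) _)) => //; rewrite (ltW m0) ge_min lexx orbT.
Qed.

Lemma an_comp F u v : analytic2 F -> analytic2 u -> analytic2 v -> u 0 = 0 -> v 0 = 0 ->
  analytic2 (fun p => F (u p, v p)).
Proof.
move=> /analytic2_maj[r r0 [M h]] hu hv u0 v0.
have [r1 r10 h1] := an_small hu u0 r0; have [r2 r20 h2] := an_small hv v0 r0.
have m0 : 0 < Num.min r1 r2 by rewrite lt_min r10.
apply: (maj_analytic2 m0 (maj_comp m0 h _ _)).
  by apply: h1; rewrite (ltW m0) ge_min lexx.
by apply: h2; rewrite (ltW m0) ge_min lexx orbT.
Qed.

Lemma sum_half_le2 N : \sum_(i < N) (2^-1 : R) ^+ i <= 2.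
Proof.
have -> : \sum_(i < N) (2^-1 : R) ^+ i = 2 * (1 - 2^-1 ^+ N).
  elim: N => [|N IH]; first by rewrite big_ord0 expr0 subrr mulr0.
  by rewrite big_ord_recr/= IH exprS; field.
have : (2^-1 : R) ^+ N >= 0 by rewrite exprn_ge0// invr_ge0.
by move=> ?; lra.
Qed.

Lemma half_lt (r : R) : 0 < r -> 0 <= r / 2 < r.
Proof. by move=> r0; rewrite divr_ge0 ?ltW//= ltr_pdivrMr// ltr_pMr// ltr1n. Qed.

Lemma an_dX f : analytic2 f -> analytic2 (dX f).
Proof.
move=> /analytic2_maj[r r0 [M h]]; have [h1 _ _] := maj_der (half_lt r0) h.
by apply: maj_analytic2 h1; rewrite divr_gt0.
Qed.

Lemma an_dY f : analytic2 f -> analytic2 (dY f).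
Proof.
move=> /analytic2_maj[r r0 [M h]]; have [_ h1 _] := maj_der (half_lt r0) h.
by apply: maj_analytic2 h1; rewrite divr_gt0.
Qed.

Lemma an_diff f : analytic2 f -> \forall p \near (0 : R * R), differentiable f p.
Proof.
move=> /analytic2_maj[r r0 [M h]]; have [_ _ h1] := maj_der (half_lt r0) h.
by apply/near0P; exists (r / 2); [rewrite divr_gt0|move=> p /h1[]].
Qed.

Lemma an_grad f : analytic2 f -> \forall p \near (0 : R * R), grad f p (dX f p) (dY f p).
Proof. by move=> /an_diff; apply: filterS => p; exact: gradE. Qed.

Lemma an_diff0 f : analytic2 f -> differentiable f (0 : R * R).
Proof. by move=> /an_diff /nbhs_singleton. Qed.

Lemma an_cont0 f : analytic2 f -> f p @[p --> (0 : R * R)] --> f 0.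
Proof. by move=> /an_diff0 /differentiable_continuous. Qed.

Lemma an_neq0 f : analytic2 f -> f 0 != 0 -> \forall p \near (0 : R * R), f p != 0.
Proof.
move=> /an_cont0 h f0.
have : \forall p \near (0 : R * R), `|f 0 - f p| < `|f 0|.
  by move/cvgrPdist_lt : h; apply; rewrite normr_gt0.
apply: filterS => p; apply: contraTN => /eqP ->.
by rewrite subr0 ltxx.
Qed.

(** Both mixed derivatives have the same coefficients. *)
Lemma an_mixed f : analytic2 f -> \forall p \near (0 : R * R), dX (dY f) p = dY (dX f) p.
Proof.
move=> /analytic2_maj[r r0 [M [a ha]]].
have [h1 h2 _] := pser_der (half_lt r0) ha.
have s0 : 0 < r / 2 by rewrite divr_gt0.
have [_ h3 _] := pser_der (half_lt s0) h1.
have [h4 _ _] := pser_der (half_lt s0) h2.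
apply/near0P; exists (r / 2 / 2); first by rewrite divr_gt0.
move=> p hp; apply: (pser_unique h4 _ hp).
have E : dx (dy a) = dy (dx a).
  by apply/funext => i; apply/funext => j; rewrite /dx /dy mulrCA.
by rewrite E; exact: h3.
Qed.

(** The form in which the identity theorem is used: equality for x > 0, xi > 0
   is enough. *)
Lemma an_eq_quadrant f g : analytic2 f -> analytic2 g ->
  (\forall p \near (0 : R * R), 0 < p.1 -> 0 < p.2 -> f p = g p) ->
  \forall p \near (0 : R * R), f p = g p.
Proof.
move=> hf hg /near0P[d d0 h].
have /analytic2_maj[r r0 [M [a ha]]] := an_sub hf hg.
have E := pser_eq0 r0 d0 ha.
apply/near0P; exists r => // p hp; apply/eqP; rewrite -subr_eq0; apply/eqP.
apply: cvg_unique (ha.2 p hp) _ => //=.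
have -> : dsum (mono a p) = fun _ _ => 0.
  apply/funext => m; apply/funext => n; rewrite /dsum big1// => i _; rewrite big1// => j _.
  rewrite /mono E ?mul0r// => q /andP[q1 q2] /andP[q3 q4].
  apply/eqP; rewrite subr_eq0; apply/eqP; apply: h => //.
  by split; rewrite gtr0_norm// ltW.
exact: cvg_cst.
Qed.

(** Write 1 / f as 1 / f(0) times the geometric series in 1 - f / f(0). *)
Lemma an_inv f : analytic2 f -> f 0 != 0 -> analytic2 (fun p => (f p)^-1).
Proof.
move=> hf f0.
have geo : analytic2 (fun p : R * R => (1 + p.1)^-1).
  have h2 : 0 < (2^-1 : R) by rewrite invr_gt0.
  apply: (maj_analytic2 h2 (M := 2)).
  apply: (@maj_series1 _ (fun i p => (- p.1) ^+ i) (fun i => 2^-1 ^+ i)) => //.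
  - by move=> i; apply: maj_exp => //; apply: maj_opp; apply: maj_fst; exact: ltW.
  - exact: sum_half_le2.
  move=> p [p1 _].
  have n1 : `|- p.1| < 1 by rewrite normrN (le_lt_trans p1)// invf_lt1// ltr1n.
  have := @cvg_geometric_series R 1 (- p.1) n1.
  rewrite opprK mul1r (_ : series _ = fun n => \sum_(i < n) (- p.1) ^+ i)//.
  by apply/funext => n; rewrite /series/= big_mkord; apply: eq_bigr => i _; rewrite mul1r.
have h := @an_comp _ (fun p => f p / f 0 - 1) (fun=> 0) geo _ (an_cst 0) _ erefl.
apply: (@an_eqf (fun p => (f 0)^-1 * (1 + (f p / f 0 - 1))^-1)).
  by move=> p /=; rewrite addrC subrK invfM invrK mulrCA mulVf// mulr1.
apply: an_mul; first exact: an_cst.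
apply: h; last by rewrite divff// subrr.
by apply: an_sub; [apply: an_mul => //; exact: an_cst|exact: an_cst].
Qed.

Lemma an_splity f : analytic2 f -> exists2 g, analytic2 g &
  \forall p \near (0 : R * R), f p = f (p.1, 0) + p.2 * g p.
Proof.
move=> /analytic2_maj[r r0 [M [a ha]]]; have [g [hg h]] := pser_splity r0 ha.
exists g; first by apply: (maj_analytic2 r0); eexists; exact: hg.
by apply/near0P; exists r.
Qed.

Lemma an_splitx f : analytic2 f -> exists2 g, analytic2 g &
  \forall p \near (0 : R * R), f p = f (0, p.2) + p.1 * g p.
Proof.
move=> /analytic2_maj[r r0 [M [a ha]]]; have [g [hg h]] := pser_splitx r0 ha.
exists g; first by apply: (maj_analytic2 r0); eexists; exact: hg.
by apply/near0P; exists r.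
Qed.

(** Termwise integration in x; the majorant is multiplied by r at most. *)
Lemma an_antix f : analytic2 f -> exists2 g, analytic2 g & \forall p \near (0 : R * R), dX g p = f p.
Proof.
move=> /analytic2_maj[r r0 [M [a ha]]].
pose m i j (p : R * R) := a i j / i.+1%:R * (p.1 ^+ i.+1 * p.2 ^+ j * 1).
have hm i j : maj (m i j) r (`|a i j / i.+1%:R| * (r ^+ i.+1 * r ^+ j * `|1|)).
  by apply: maj_scale; apply: maj_mono; [exact: ltW|apply: maj_cst; exact: ltW].
have hB : absum (fun i j => `|a i j / i.+1%:R| * (r ^+ i.+1 * r ^+ j * `|1 : R|)) (r * M).
  move=> N; apply: le_trans (ler_wpM2l (ltW r0) (ha.1 N)); rewrite -dsumZ; apply: le_dsum => i j.
  rewrite normr1 mulr1 ger0_norm ?mulr_ge0 ?exprn_ge0 ?(ltW r0)//.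
  rewrite /mono/= !normrM !normrX (gtr0_norm r0) exprS.
  rewrite [leRHS](_ : _ = `|a i j| * (r * r ^+ i * r ^+ j)); last by ring.
  apply: ler_wpM2r; first by rewrite !mulr_ge0 ?exprn_ge0 ?(ltW r0).
  by rewrite ler_piMr// normfV normr_nat invf_le1// ler1n.
have [F hF h] := maj_series_ex r0 hm hB.
exists F; first exact: maj_analytic2 hF.
apply/near0P; exists (r / 2); first by rewrite divr_gt0.
move=> p hp; have [h1 _] := maj_series_der (half_lt r0) hm hB h hp.
apply: cvg_unique h1 _ => //=.
have E i j : dX (m i j) p = mono a p i j.
  have [_ -> _] : grad (m i j) p (mono a p i j) (a i j / i.+1%:R * (p.1 ^+ i.+1 * (j%:R * p.2 ^+ j.-1))).
    apply: grad_eq (gradM (grad_cst (a i j / i.+1%:R) p)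
      (gradM (gradM (gradX i.+1 (grad_fst p)) (gradX j (grad_snd p))) (grad_cst 1 p))) _ _.
      by rewrite /mono/=; field; rewrite ?nat1r ?natr1 pnatr_eq0.
    by rewrite /=; ring.
  by [].
rewrite (funext (fun n => eq_dsum n n E)).
by apply: ha.2; apply: inbox_le hp; case/andP: (half_lt r0) => _ /ltW.
Qed.

End Germs2.

(** * Analytic germs of one variable *)

Section OneVariable.
Variable R : realType.
Implicit Types (f g F u v w : R * R -> R) (c e : R -> R) (p q : R * R) (t r M : R).

Lemma near1P (Q : set R) : (\forall t \near (0 : R), Q t) <->
  exists2 r : R, 0 < r & forall t, `|t| <= r -> Q t.
Proof.
split.
  move=> /nbhs_ballP[e /= e0 he]; exists (e / 2); first by rewrite divr_gt0.
  move=> q q1; apply: he; rewrite -ball_normE/= sub0r normrN.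
  by rewrite (le_lt_trans q1)// ltr_pdivrMr// ltr_pMr// ltr1n.
move=> [r r0 hr]; apply/nbhs_ballP; exists r => //= p; rewrite -ball_normE/= sub0r normrN => /ltW.
exact: hr.
Qed.

Lemma near_along (Q : R -> Prop) f : (\forall t \near (0 : R), Q t) -> analytic2 f -> f 0 = 0 ->
  \forall p \near (0 : R * R), Q (f p).
Proof.
move=> /near1P[r r0 h] hf f0; have [s s0 /(_ s)H] := an_small hf f0 r0.
apply/near0P; exists s => // p hp; apply: h; apply: (maj_bound (H _)) => //.
by rewrite lexx ltW.
Qed.

Lemma near_xaxis (Q : R * R -> Prop) : (\forall p \near (0 : R * R), Q p) ->
  \forall t \near (0 : R), Q (t, 0).
Proof.
move=> /near0P[r r0 h]; apply/near1P; exists r => // t ht; apply: h; split=> //=.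
by rewrite normr0 ltW.
Qed.

(** An analytic germ of one variable is an analytic germ of two variables
   depending on x only, so that the whole calculus is inherited.  A convergent
   series of one variable converges absolutely, with a geometric bound, at half
   the radius. *)
Lemma an1P c : analytic1 c <-> analytic2 (fun p : R * R => c p.1).
Proof.
split.
  move=> [a /near1P[r r0 h]].
  have r_ : `|r| <= r by rewrite gtr0_norm.
  have cv : cvgn (series (fun i => a i * r ^+ i)) by apply: cvgP; exact: (h r r_).
  have [M0 [_ hM]] := cvg_series_bounded cv.
  have {hM}hM i : `|a i * r ^+ i| <= M0 + 1.
    by apply: (hM (M0 + 1)) => //; rewrite ltrDl ltr01.
  have C0 : 0 <= M0 + 1 := le_trans (normr_ge0 _) (hM 0%N).
  have s0 : 0 < r / 2 by rewrite divr_gt0.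
  apply: (maj_analytic2 s0 (M := 2 * (M0 + 1))).
  apply: (@maj_series1 _ (fun i p => a i * (p.1 ^+ i)) (fun i => `|a i| * (r / 2) ^+ i)) => //.
  - by move=> i; apply: maj_scale; apply: maj_exp => //; apply: maj_fst; exact: ltW.
  - move=> N; apply: (@le_trans _ _ (\sum_(i < N) (2^-1) ^+ i * (M0 + 1))).
      apply: ler_sum => i _; rewrite exprMn mulrA mulrC ler_wpM2l ?exprn_ge0 ?invr_ge0//.
      by have := hM i; rewrite normrM normrX (gtr0_norm r0).
    by rewrite -mulr_suml ler_wpM2r//; exact: sum_half_le2.
  move=> p [p1 _]; have := h p.1 (le_trans p1 _).
  rewrite (_ : pseries _ _ = fun n => \sum_(i < n) a i * p.1 ^+ i); last first.
    by apply/funext => n; rewrite /pseries/series/= big_mkord.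
  by apply; case/andP: (half_lt r0) => _ /ltW.
move=> /analytic2_maj[r r0 [M [a ha]]].
exists (fun i => a i 0%N); apply/near1P; exists r => // t ht.
have := ha.2 (t, 0); rewrite -cvg_shiftS/= => H.
rewrite -cvg_shiftS/= (_ : (fun n => _) = fun n => dsum (mono a (t, 0)) n.+1 n.+1).
  by apply: H; split=> //=; rewrite normr0 ltW.
apply/funext => n; rewrite /pseries/series/= big_mkord; apply: eq_bigr => i _.
rewrite big_ord_recl big1 ?addr0; first by rewrite /mono/= mulr1.
by move=> j _; rewrite /mono/= exprS mul0r mulr0.
Qed.

Lemma an1_restr f : analytic2 f -> analytic1 (fun t => f (t, 0)).
Proof. by move=> hf; apply/an1P; exact: (an_comp hf (an_fst R) (an_cst 0) erefl erefl). Qed.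

Lemma an1_comp2 c u : analytic1 c -> analytic2 u -> u 0 = 0 -> analytic2 (fun p => c (u p)).
Proof. by move=> /an1P hc hu u0; exact: (an_comp hc hu (an_cst 0) u0 erefl). Qed.

Lemma an1_comp c e : analytic1 c -> analytic1 e -> e 0 = 0 -> analytic1 (fun t => c (e t)).
Proof. by move=> hc /an1P he e0; apply/an1P; apply: an1_comp2. Qed.

Lemma an1_cst k : analytic1 (fun _ : R => k).
Proof. by apply/an1P; exact: an_cst. Qed.
Lemma an1_id : analytic1 (fun t : R => t).
Proof. by apply/an1P; exact: an_fst. Qed.
Lemma an1_add c e : analytic1 c -> analytic1 e -> analytic1 (fun t => c t + e t).
Proof. by move=> /an1P hc /an1P he; apply/an1P; exact: an_add. Qed.
Lemma an1_sub c e : analytic1 c -> analytic1 e -> analytic1 (fun t => c t - e t).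
Proof. by move=> /an1P hc /an1P he; apply/an1P; exact: an_sub. Qed.
Lemma an1_opp c : analytic1 c -> analytic1 (fun t => - c t).
Proof. by move=> /an1P hc; apply/an1P; exact: an_opp. Qed.
Lemma an1_mul c e : analytic1 c -> analytic1 e -> analytic1 (fun t => c t * e t).
Proof. by move=> /an1P hc /an1P he; apply/an1P; exact: an_mul. Qed.
Lemma an1_exp c n : analytic1 c -> analytic1 (fun t => c t ^+ n).
Proof. by move=> /an1P hc; apply/an1P; exact: an_exp. Qed.
Lemma an1_inv c : analytic1 c -> c 0 != 0 -> analytic1 (fun t => (c t)^-1).
Proof. by move=> /an1P hc c0; apply/an1P; exact: (an_inv hc). Qed.

Lemma an1_neq0 c : analytic1 c -> c 0 != 0 -> \forall t \near (0 : R), c t != 0.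
Proof. by move=> /an1P/an_neq0 h /h /near_xaxis. Qed.

Lemma derive1_dX c t (y : R) : (derive1 c) t = dX (fun p => c p.1) (t, y).
Proof. by rewrite derive1E. Qed.

Lemma grad_an1 c t (y : R) : differentiable (fun p : R * R => c p.1) (t, y) ->
  grad (fun p => c p.1) (t, y) ((derive1 c) t) 0.
Proof.
move=> h; rewrite (derive1_dX _ _ y); split=> //.
have := grad_comp (F := fun p => c p.1) (u := fun p => p.1) (v := fun=> y) (p := (t, y))
  (gradE h) (grad_fst _) (grad_cst _ _).
by case=> _ _; rewrite !mulr0 addr0.
Qed.

Lemma grad_comp1 c u p a b : differentiable (fun p : R * R => c p.1) (u p, 0) ->
  grad u p a b -> grad (fun q => c (u q)) p ((derive1 c) (u p) * a) ((derive1 c) (u p) * b).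
Proof.
move=> h hu; have := grad_comp (grad_an1 h) hu (grad_cst 0 p).
by rewrite !mulr0 !addr0.
Qed.

Lemma an1_diff c : analytic1 c -> \forall t \near (0 : R), differentiable (fun p : R * R => c p.1) (t, 0).
Proof. by move=> /an1P /an_diff /near_xaxis. Qed.

Lemma an1_derive c : analytic1 c -> analytic1 ((derive1 c)).
Proof.
move=> /an1P /an_dX /an1_restr; congr analytic1.
by apply/funext => t; rewrite -derive1_dX.
Qed.

Lemma an1_eq_pos c e : analytic1 c -> analytic1 e ->
  (\forall t \near (0 : R), 0 < t -> c t = e t) -> \forall t \near (0 : R), c t = e t.
Proof.
move=> /an1P hc /an1P he h.
suff : \forall p \near (0 : R * R), c p.1 = e p.1 by move=> /near_xaxis.
apply: an_eq_quadrant => //.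
by have := near_along h (@an_fst R) erefl; apply: filterS => p hp p1 _; exact: hp.
Qed.

Lemma an1_factor c : analytic1 c -> c 0 = 0 ->
  exists2 e, analytic1 e & \forall t \near (0 : R), c t = t * e t.
Proof.
move=> /an1P /an_splitx [g hg h] c0.
exists (fun t => g (t, 0)); first exact: an1_restr.
by have := near_xaxis h; apply: filterS => t /=; rewrite c0 add0r.
Qed.

(** Either all Taylor coefficients vanish or the first nonzero one can be split
   off. *)
Lemma an1_order c : analytic1 c -> (\forall t \near (0 : R), c t = 0) \/
  exists n, exists2 e, analytic1 e & e 0 != 0 /\ \forall t \near (0 : R), c t = t ^+ n * e t.
Proof.
move=> /an1P /analytic2_maj[r r0 [M [a ha]]].
have rt t : `|t| <= r -> inbox r (t, 0) by move=> ?; split=> //=; rewrite normr0 ltW.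
have [|/existsNP ex] := pselect (forall n, a n 0%N = 0).
  move=> a0; left; apply/near1P; exists r => // t ht.
  apply: cvg_unique (ha.2 (t, 0) (rt t ht)) _ => //=.
  have -> : dsum (mono a (t, 0)) = fun _ _ => 0.
    apply/funext => m; apply/funext => n; rewrite /dsum big1// => i _; rewrite big1// => -[[|j] jn] _.
      by rewrite /mono a0 !mul0r.
    by rewrite /mono/= exprS mul0r mulr0.
  exact: cvg_cst.
right; have {}ex : exists n, a n 0%N != 0 by case: ex => n /eqP; exists n.
pose n := ex_minn ex; exists n.
have [n0 nmin] : a n 0%N != 0 /\ forall m, (m < n)%N -> a m 0%N = 0.
  rewrite /n; case: ex_minnP => m m0 hm; split=> // k km; apply/eqP.
  by apply: contraTT km => /hm; rewrite -leqNgt.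
suff H f M' a' m : pser a' r M' f -> (forall k, (k < m)%N -> a' k 0%N = 0) ->
    exists w M2, pser (fun i j => a' (m + i)%N j) r M2 w /\
      forall t, `|t| <= r -> f (t, 0) = t ^+ m * w (t, 0).
  have [w [M2 [hw E]]] := H _ _ _ _ ha nmin.
  exists (fun t => w (t, 0)).
    by apply: an1_restr; apply: (maj_analytic2 r0); eexists; exact: hw.
  split; last by apply/near1P; exists r => // t /E.
  by have := pser_00 (ltW r0) hw; rewrite addn0 => <-.
elim: m f M' a' {ha ex n n0 nmin} => [|m IH] f M' a' ha h0.
  by exists f, M'; split=> // t _; rewrite expr0 mul1r.
have [g [hg E]] := pser_splitx r0 ha.
have [|w [M2 [hw E2]]] := IH g _ _ hg; first by move=> k km; exact: h0.
exists w, M2; split; first exact: hw.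
move=> t ht; rewrite (E _ (rt t ht)) /= E2// exprS mulrA.
by rewrite -[(0, 0)]/(0 : R * R) -(pser_00 (ltW r0) ha) h0// add0r.
Qed.

Lemma near_eq_derive1 c e : (\forall t \near (0 : R), c t = e t) ->
  \forall t \near (0 : R), (derive1 c) t = (derive1 e) t.
Proof.
move=> /near_join; apply: filterS => t h; rewrite !derive1E; exact: near_eq_derive.
Qed.

Lemma near_eq_derive1n c e n : (\forall t \near (0 : R), c t = e t) ->
  derive1n n c 0 = derive1n n e 0.
Proof.
elim: n c e => [|n IH] c e h; first by move/nbhs_singleton: h.
by rewrite !derive1Sn; apply: IH; exact: near_eq_derive1.
Qed.

Lemma derive1n_factor n c e : analytic1 c -> analytic1 e ->
  (\forall t \near (0 : R), c t = t ^+ n * e t) -> derive1n n c 0 = n`!%:R * e 0.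
Proof.
elim: n c e => [|n IH] c e hc he h.
  by move/nbhs_singleton: h; rewrite /= expr0 !mul1r.
rewrite derive1Sn.
rewrite (IH _ (fun t => n.+1%:R * e t + t * (derive1 e) t)).
- by rewrite mul0r addr0 factS natrM; ring.
- exact: an1_derive.
- apply: an1_add; apply: an1_mul => //; [exact: an1_cst|exact: an1_id|exact: an1_derive].
have h' := near_eq_derive1 h.
near=> t.
have -> : (derive1 c) t = derive1 (fun t => t ^+ n.+1 * e t) t by near: t.
have de : differentiable (fun p : R * R => e p.1) (t, 0) by near: t; exact: an1_diff.
rewrite (derive1_dX _ _ 0).
have [_ -> _] := gradM (gradX n.+1 (grad_fst (t, 0))) (grad_an1 de).
by rewrite /= exprS; ring.
Unshelve. all: by end_near. Qed.

Lemma an1_taylor0 c : analytic1 c -> (forall n, derive1n n c 0 = 0) ->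
  \forall t \near (0 : R), c t = 0.
Proof.
move=> hc h; have [//|[n [e he [e0 E]]]] := an1_order hc.
have := derive1n_factor hc he E; rewrite h => /esym/eqP.
by rewrite mulf_eq0 (negbTE e0) orbF pnatr_eq0 eqn0Ngt fact_gt0.
Qed.

Lemma an1_derive1nB c e n : analytic1 c -> analytic1 e ->
  derive1n n (fun t => c t - e t) 0 = derive1n n c 0 - derive1n n e 0.
Proof.
elim: n c e => [//|n IH] c e hc he; rewrite !derive1Sn -IH; [|exact: an1_derive..].
apply: near_eq_derive1n; near=> t.
have d1 : differentiable (fun p : R * R => c p.1) (t, 0) by near: t; exact: an1_diff.
have d2 : differentiable (fun p : R * R => e p.1) (t, 0) by near: t; exact: an1_diff.
by rewrite (derive1_dX _ _ 0); have [_ -> _] := gradB (grad_an1 d1) (grad_an1 d2).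
Unshelve. all: by end_near. Qed.

Lemma an1_taylorP c e : analytic1 c -> analytic1 e ->
  (forall n, derive1n n c 0 = derive1n n e 0) <-> \forall t \near (0 : R), c t = e t.
Proof.
move=> hc he; split=> [h|h n]; last exact: near_eq_derive1n.
have := an1_taylor0 (an1_sub hc he); move=> H.
have {H} : \forall t \near (0 : R), c t - e t = 0.
  by apply: H => n; rewrite an1_derive1nB// h subrr.
by apply: filterS => t /eqP; rewrite subr_eq0 => /eqP.
Qed.

Lemma derive1n_monomial (k : R) n m :
  derive1n m (fun t : R => k * t ^+ n) 0 = if m == n then n`!%:R * k else 0.
Proof.
elim: m n k => [|m IH] n k.
  by case: n => [|n]/=; rewrite ?expr0 ?mulr1 ?mul1r// exprS mul0r mulr0.
have E : derive1 (fun t : R => k * t ^+ n) = (fun t => (k * n%:R) * t ^+ n.-1).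
  apply/funext => t; rewrite (derive1_dX _ _ 0).
  by have [_ -> _] := gradM (grad_cst k (t, 0)) (gradX n (grad_fst (t, 0))); rewrite /=; ring.
rewrite derive1Sn E IH; case: n {E} => [|n]/=.
  by rewrite mulr0 mulr0; case: ifP.
by rewrite eqSS; case: ifP => // _; rewrite factS natrM; ring.
Qed.

End OneVariable.

(** * The inverse function theorem *)

Section InverseFunction.
Variable R : realType.
Implicit Types (a : nat -> nat -> R) (f g F u v w U V : R * R -> R) (p q : R * R) (r M s d rho : R).

Lemma maj_powdiff u v s rho d n : 0 < s -> maj u s rho -> maj v s rho -> maj (fun p => u p - v p) s d ->
  maj (fun p => u p ^+ n - v p ^+ n) s (dpow n rho * d).
Proof.
move=> s0 hu hv huv; elim: n => [|n IH].
  by have := @maj_cst R 0 s (ltW s0); rewrite normr0 /dpow !mul0r; apply: maj_ext => p _; rewrite subrr.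
have := maj_add (maj_mul s0 hu IH) (maj_mul s0 huv (maj_exp n s0 hv)).
have -> : rho * (dpow n rho * d) + d * rho ^+ n = dpow n.+1 rho * d.
  by rewrite /dpow/=; case: n {IH} => [|n]; rewrite /= ?expr0 ?exprS -?natr1; ring.
by apply: maj_ext => p _; rewrite !exprS; ring.
Qed.

(** For i + j >= 2 the derivative of the monomial contains a factor rho; this
   makes a series without terms of order < 2 contracting on a small box. *)
Lemma dpow2_le i j r rho : 0 < rho -> rho <= r / 2 -> (1 < i + j)%N ->
  dpow i rho * rho ^+ j + rho ^+ i * dpow j rho <= 2 * rho / r ^+ 2 * (r ^+ i * r ^+ j).
Proof.
move=> rho0 rr ij; have r0 : 0 < r by lra.
have -> : dpow i rho * rho ^+ j + rho ^+ i * dpow j rho = (i + j)%:R * rho ^+ (i + j).-1.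
  rewrite /dpow; case: i {ij} => [|i]; case: j => [|j].
  - by rewrite !expr0 !mul0r mulr0 addr0.
  - by rewrite add0n expr0 !mul0r add0r mul1r.
  - by rewrite addn0 expr0 mul0r mulr0 addr0 mulr1.
  have -> : (i.+1 + j.+1).-1 = (i + j).+1 by lia.
  by rewrite natrD /= !exprS exprD; ring.
rewrite -exprD; move: (i + j)%N ij => n; case: n => [//|[//|n]] _ /=.
elim: n => [|n IH].
  by rewrite expr1 divfK ?expf_neq0 ?gt_eqF.
apply: (@le_trans _ _ (r * (n.+2%:R * rho ^+ n.+1))).
  rewrite exprS mulrA mulrA ler_wpM2r ?exprn_ge0 ?(ltW rho0)//.
  rewrite -natr1 -natr1 ; have := ler0n R n.+1; rewrite -natr1.
  by have := ler0n R n; nra.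
by rewrite [r ^+ n.+3]exprS [leRHS]mulrCA ler_wpM2l// ltW.
Qed.

(** The Lipschitz estimate for the majorants behind the fixed point iteration of
   [inverse_idlin]. *)
Lemma maj_lip a f r M u1 v1 u2 v2 s rho d : 0 < s -> 0 < rho -> rho <= r / 2 ->
  pser a r M f -> (forall i j, (i + j < 2)%N -> a i j = 0) ->
  maj u1 s rho -> maj v1 s rho -> maj u2 s rho -> maj v2 s rho ->
  maj (fun p => u1 p - u2 p) s d -> maj (fun p => v1 p - v2 p) s d ->
  maj (fun p => f (u1 p, v1 p) - f (u2 p, v2 p)) s (2 * rho / r ^+ 2 * M * d).
Proof.
move=> s0 rho0 rr ha a0 hu1 hv1 hu2 hv2 hu hv; have d0 := maj_ge0 hu.
apply: (@maj_series _ (fun i j p => a i j * (u1 p ^+ i * v1 p ^+ j - u2 p ^+ i * v2 p ^+ j))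
  (fun i j => `|a i j| * ((dpow i rho * rho ^+ j + rho ^+ i * dpow j rho) * d))) => //.
- move=> i j; apply: maj_scale.
  have := maj_add (maj_mul s0 (maj_powdiff i s0 hu1 hu2 hu) (maj_exp j s0 hv1))
                (maj_mul s0 (maj_exp i s0 hu2) (maj_powdiff j s0 hv1 hv2 hv)).
  have -> : dpow i rho * d * rho ^+ j + rho ^+ i * (dpow j rho * d) =
    (dpow i rho * rho ^+ j + rho ^+ i * dpow j rho) * d by ring.
  by apply: maj_ext => p _; ring.
- move=> N; have c0 : 0 <= 2 * rho / r ^+ 2 by rewrite divr_ge0 ?sqr_ge0// mulr_ge0// ltW.
  rewrite mulrAC; apply: le_trans (ler_wpM2l (mulr_ge0 c0 d0) (ha.1 N)).
  rewrite -dsumZ; apply: le_dsum => i j.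
  have dp0 k : 0 <= dpow k rho by rewrite /dpow mulr_ge0// exprn_ge0// ltW.
  have e0 k : 0 <= rho ^+ k by rewrite exprn_ge0// ltW.
  have [ij|ij] := ltnP (i + j) 2.
    rewrite {1}a0// normr0 mul0r normr0; exact: mulr_ge0 (mulr_ge0 c0 d0) (normr_ge0 _).
  have H := ler_wpM2l (normr_ge0 (a i j)) (ler_wpM2r d0 (dpow2_le rho0 rr ij)).
  rewrite ger0_norm; last first.
    apply: mulr_ge0 => //; apply: mulr_ge0 => //; apply: addr_ge0; exact: mulr_ge0.
  apply: le_trans H _; rewrite le_eqVlt; apply/orP; left; apply/eqP.
  have r0 : 0 < r by lra.
  rewrite /mono/= !normrM !normrX (gtr0_norm r0); ring.
move=> p hp.
have E n : dsum (fun i j => a i j * (u1 p ^+ i * v1 p ^+ j - u2 p ^+ i * v2 p ^+ j)) n n =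
   dsum (mono a (u1 p, v1 p)) n n - dsum (mono a (u2 p, v2 p)) n n.
  rewrite /dsum -sumrB; apply: eq_bigr => i _; rewrite -sumrB; apply: eq_bigr => j _.
  by rewrite /mono/=; ring.
rewrite (funext E).
have rhor : rho <= r by lra.
by apply: cvgB; apply: ha.2; split; (apply: le_trans rhor; by apply: (maj_bound _ hp)).
Qed.

Definition idlin U V := [/\ grad U (0 : R * R) 1 0, grad V (0 : R * R) 0 1, U 0 = 0 & V 0 = 0].

Lemma pser_low a r M f A B : 0 < r -> pser a r M f -> f 0 = 0 -> grad f (0 : R * R) A B ->
  [/\ a 0%N 0%N = 0, a 1%N 0%N = A & a 0%N 1%N = B].
Proof.
move=> r0 ha f0 [_ <- <-]; have [h1 h2 _] := pser_der (half_lt r0) ha.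
have s0 : 0 <= r / 2 by rewrite divr_ge0 ?ltW.
have := pser_00 s0 h1; have := pser_00 s0 h2; have := pser_00 (ltW r0) ha.
by rewrite /dx /dy f0 !mul1r.
Qed.

(** With U = x + u, V = xi + v, the inverse is the limit of the iteration (A, B)
   |-> (x - u(A, B), xi - v(A, B)), which is a contraction for the majorants. *)
Lemma inverse_idlin U V : analytic2 U -> analytic2 V -> idlin U V ->
  exists A B, [/\ analytic2 A, analytic2 B, A 0 = 0, B 0 = 0 &
    \forall p \near (0 : R * R), U (A p, B p) = p.1 /\ V (A p, B p) = p.2].
Proof.
move=> hU hV [gU gV U0 V0].
pose u p := U p - p.1; pose v p := V p - p.2.
have [r [r0 [M1 [M2 [[a ha] [b hb]]]]]] := an2_maj (an_sub hU (an_fst R)) (an_sub hV (an_snd R)).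
have u0 : u 0 = 0 by rewrite /u U0 subrr.
have v0 : v 0 = 0 by rewrite /v V0 subrr.
have [a00 a10 a01] : [/\ a 0%N 0%N = 0, a 1%N 0%N = 0 & a 0%N 1%N = 0].
  by apply: pser_low r0 ha u0 _; apply: grad_eq (gradB gU (grad_fst 0)) _ _; rewrite subrr.
have [b00 b10 b01] : [/\ b 0%N 0%N = 0, b 1%N 0%N = 0 & b 0%N 1%N = 0].
  by apply: pser_low r0 hb v0 _; apply: grad_eq (gradB gV (grad_snd 0)) _ _; rewrite subrr.
have alow i j : (i + j < 2)%N -> a i j = 0 by case: i j => [|[|i]] [|[|j]].
have blow i j : (i + j < 2)%N -> b i j = 0 by case: i j => [|[|i]] [|[|j]].
pose M := M1 + M2 + 1.
have M10 := pser_ge0 ha; have M20 := pser_ge0 hb.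
have M0 : 0 < M by rewrite /M; lra.
(* rho <= r^2 / (8 M) makes the Lipschitz constant 2 rho M / r^2 at most 1/4;
   the iterates start from the box of radius s = rho / 2 and stay within rho *)
pose rho := Num.min (r / 2) (r ^+ 2 / (8 * M)).
have rho0 : 0 < rho by rewrite lt_min !divr_gt0 ?exprn_gt0// mulr_gt0.
have rho1 : rho <= r / 2 by rewrite ge_min lexx.
have rho2 : 2 * rho / r ^+ 2 * M <= 4^-1.
  have : rho <= r ^+ 2 / (8 * M) by rewrite ge_min lexx orbT.
  rewrite ler_pdivlMr ?mulr_gt0// => H.
  rewrite mulrAC ler_pdivrMr ?exprn_gt0//; lra.
have rhor : rho < r by lra.
pose s := rho / 2; have s0 : 0 < s by rewrite divr_gt0.
have lip f a' M' u1 v1 u2 v2 d : pser a' r M' f -> M' <= M -> (forall i j, (i + j < 2)%N -> a' i j = 0) ->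
    maj u1 s rho -> maj v1 s rho -> maj u2 s rho -> maj v2 s rho ->
    maj (fun p => u1 p - u2 p) s d -> maj (fun p => v1 p - v2 p) s d ->
    maj (fun p => f (u1 p, v1 p) - f (u2 p, v2 p)) s (4^-1 * d).
  move=> hf M'M low h1 h2 h3 h4 h5 h6; have d0 := maj_ge0 h5.
  apply: maj_le (maj_lip s0 rho0 rho1 hf low h1 h2 h3 h4 h5 h6) => //; first exact: ltW.
  rewrite ler_wpM2r//; apply: le_trans rho2; rewrite ler_wpM2l// divr_ge0 ?sqr_ge0// mulr_ge0// ltW//.
have M1M : M1 <= M by rewrite /M; lra.
have M2M : M2 <= M by rewrite /M; lra.
pose step (c : (R * R -> R) * (R * R -> R)) :=
  ((fun p => p.1 - u (c.1 p, c.2 p)) : R * R -> R, (fun p => p.2 - v (c.1 p, c.2 p)) : R * R -> R).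
pose phi n := iter n step (fun p => p.1, fun p => p.2).
have P0 : maj (fun=> 0) s rho.
  by apply: maj_le (maj_cst 0 (ltW s0)) => //; rewrite ?normr0 ltW.
have sub0 f d : maj f s d -> maj (fun p => f p - 0) s d by apply: maj_ext => p _; rewrite subr0.
have hphi n : maj (phi n).1 s rho /\ maj (phi n).2 s rho.
  elim: n => [|n [IH1 IH2]].
    split; [apply: maj_le (maj_fst (ltW s0))|apply: maj_le (maj_snd (ltW s0))] => //; rewrite ?(ltW s0)// /s; lra.
  have H1 := lip u _ _ _ _ _ _ _ ha M1M alow IH1 IH2 P0 P0 (sub0 _ _ IH1) (sub0 _ _ IH2).
  have H2 := lip v _ _ _ _ _ _ _ hb M2M blow IH1 IH2 P0 P0 (sub0 _ _ IH1) (sub0 _ _ IH2).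
  split.
    apply: (maj_le (ltW s0) (lexx _) (M := s + 4^-1 * rho)); first by rewrite /s; lra.
    by apply: maj_ext (maj_sub (maj_fst (ltW s0)) H1) => p _; rewrite -[(0, 0)]/(0 : R * R) -/(u 0) u0 subr0.
  apply: (maj_le (ltW s0) (lexx _) (M := s + 4^-1 * rho)); first by rewrite /s; lra.
  by apply: maj_ext (maj_sub (maj_snd (ltW s0)) H2) => p _; rewrite -[(0, 0)]/(0 : R * R) -/(v 0) v0 subr0.
have hdel n : maj (fun p => (phi n.+1).1 p - (phi n).1 p) s (4^-1 ^+ n * rho) /\
              maj (fun p => (phi n.+1).2 p - (phi n).2 p) s (4^-1 ^+ n * rho).
  elim: n => [|n [IH1 IH2]].
    have [h1 h2] := hphi 0%N.
    have H1 := lip u _ _ _ _ _ _ _ ha M1M alow h1 h2 P0 P0 (sub0 _ _ h1) (sub0 _ _ h2).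
    have H2 := lip v _ _ _ _ _ _ _ hb M2M blow h1 h2 P0 P0 (sub0 _ _ h1) (sub0 _ _ h2).
    split.
      apply: (maj_le (ltW s0) (lexx _) (M := 4^-1 * rho)); first by rewrite expr0; lra.
      by apply: maj_ext (maj_opp H1) => p _; rewrite -[(0, 0)]/(0 : R * R) -/(u 0) u0 subr0 /=; ring.
    apply: (maj_le (ltW s0) (lexx _) (M := 4^-1 * rho)); first by rewrite expr0; lra.
    by apply: maj_ext (maj_opp H2) => p _; rewrite -[(0, 0)]/(0 : R * R) -/(v 0) v0 subr0 /=; ring.
  have [h1 h2] := hphi n.+1; have [h3 h4] := hphi n.
  have H1 := lip u _ _ _ _ _ _ _ ha M1M alow h1 h2 h3 h4 IH1 IH2.
  have H2 := lip v _ _ _ _ _ _ _ hb M2M blow h1 h2 h3 h4 IH1 IH2.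
  rewrite exprS -mulrA; split.
    apply: maj_ext (maj_opp H1) => p _.
    transitivity ((p.1 - u ((phi n.+1).1 p, (phi n.+1).2 p)) - (p.1 - u ((phi n).1 p, (phi n).2 p))); [ring|by []].
  apply: maj_ext (maj_opp H2) => p _.
  transitivity ((p.2 - v ((phi n.+1).1 p, (phi n.+1).2 p)) - (p.2 - v ((phi n).1 p, (phi n).2 p))); [ring|by []].
have geo N : \sum_(i < N) 4^-1 ^+ i * rho <= 2 * rho.
  rewrite -mulr_suml ler_wpM2r ?(ltW rho0)//.
  have : (4^-1 : R) ^+ N >= 0 by rewrite exprn_ge0// invr_ge0.
  have -> : \sum_(i < N) (4^-1 : R) ^+ i = (4 / 3) * (1 - 4^-1 ^+ N).
    elim: N => [|N IH]; first by rewrite big_ord0 expr0 subrr mulr0.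
    by rewrite big_ord_recr/= IH exprS; field.
  by move=> ?; lra.
have [F1 hF1 c1] := maj_series1_ex s0 (fun n => (hdel n).1) geo.
have [F2 hF2 c2] := maj_series1_ex s0 (fun n => (hdel n).2) geo.
have cA p : inbox s p -> (phi n).1 p @[n --> \oo] --> p.1 + F1 p.
  move=> hp; rewrite (_ : (fun n => _) = fun n => p.1 + \sum_(i < n) ((phi i.+1).1 p - (phi i).1 p)).
    by apply: cvgD; [exact: cvg_cst|exact: c1].
  apply/funext; elim=> [|n IH]; first by rewrite big_ord0 addr0.
  by rewrite big_ord_recr/= addrA -IH addrC subrK.
have cB p : inbox s p -> (phi n).2 p @[n --> \oo] --> p.2 + F2 p.
  move=> hp; rewrite (_ : (fun n => _) = fun n => p.2 + \sum_(i < n) ((phi i.+1).2 p - (phi i).2 p)).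
    by apply: cvgD; [exact: cvg_cst|exact: c2].
  apply/funext; elim=> [|n IH]; first by rewrite big_ord0 addr0.
  by rewrite big_ord_recr/= addrA -IH addrC subrK.
have phi0 n : (phi n).1 0 = 0 /\ (phi n).2 0 = 0.
  elim: n => [//|n [IH1 IH2]]; rewrite /= -/(phi n) IH1 IH2 -[(0, 0)]/(0 : R * R) u0 v0.
  by rewrite !subr0.
have hA : analytic2 (fun p => p.1 + F1 p) by apply: an_add; [exact: an_fst|exact: maj_analytic2 s0 hF1].
have hB : analytic2 (fun p => p.2 + F2 p) by apply: an_add; [exact: an_snd|exact: maj_analytic2 s0 hF2].
exists (fun p => p.1 + F1 p), (fun p => p.2 + F2 p); split=> //.
- apply: cvg_unique (cA 0 (inbox0 (ltW s0))) _ => //=.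
  rewrite (_ : (fun n => _) = fun=> 0); first exact: cvg_cst.
  by apply/funext => n; rewrite (phi0 n).1.
- apply: cvg_unique (cB 0 (inbox0 (ltW s0))) _ => //=.
  rewrite (_ : (fun n => _) = fun=> 0); first exact: cvg_cst.
  by apply/funext => n; rewrite (phi0 n).2.
apply/near0P; exists s => // p hp.
have inrho : inbox rho (p.1 + F1 p, p.2 + F2 p).
  split=> /=.
    by apply: (cvgr_to_le (cvg_norm (cA p hp))); apply: nearW => n; exact: maj_bound (hphi n).1 hp.
  by apply: (cvgr_to_le (cvg_norm (cB p hp))); apply: nearW => n; exact: maj_bound (hphi n).2 hp.
have rr : 0 <= rho < r by rewrite ltW.
have lim f a' M' : pser a' r M' f ->
    f ((phi n).1 p, (phi n).2 p) @[n --> \oo] --> f (p.1 + F1 p, p.2 + F2 p).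
  move=> hf; have [_ _ /(_ _ inrho)[/differentiable_continuous + _]] := pser_der rr hf.
  move=> cf; apply: (@continuous2_cvg _ _ _ _ _ _ (fun n => (phi n).1 p) (fun n => (phi n).2 p)
    (fun x y => f (x, y)) _ _ _ (cA p hp) (cB p hp)).
  by rewrite (_ : (fun z : R * R => f (z.1, z.2)) = f)//; apply/funext => -[].
split.
  have h1 := cA p hp; rewrite -cvg_shiftS/= in h1.
  have h2 : (p.1 - u ((phi n).1 p, (phi n).2 p)) @[n --> \oo] --> p.1 - u (p.1 + F1 p, p.2 + F2 p).
    by apply: cvgB; [exact: cvg_cst|exact: lim ha].
  have E : p.1 + F1 p = p.1 - u (p.1 + F1 p, p.2 + F2 p) by apply: (cvg_unique _ h1 h2).
  by move: E; rewrite /u /=; set X := U _ => E; lra.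
have h1 := cB p hp; rewrite -cvg_shiftS/= in h1.
have h2 : (p.2 - v ((phi n).1 p, (phi n).2 p)) @[n --> \oo] --> p.2 - v (p.1 + F1 p, p.2 + F2 p).
  by apply: cvgB; [exact: cvg_cst|exact: lim hb].
have E : p.2 + F2 p = p.2 - v (p.1 + F1 p, p.2 + F2 p) by apply: (cvg_unique _ h1 h2).
by move: E; rewrite /v /=; set X := V _ => E; lra.
Qed.

End InverseFunction.

(** * Diffeomorphism germs and Jacobians *)

Section Diffeo.
Variable R : realType.
Implicit Types (f g F u v w U V : R * R -> R) (p q : R * R) (psi phi chi : R * R -> R * R).

Lemma grad_unique f p a b a' b' : grad f p a b -> grad f p a' b' -> a = a' /\ b = b'.
Proof. by move=> [_ <- <-] [_ <- <-]. Qed.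

Lemma an_pull F psi : analytic2 F -> analytic_map psi -> psi 0 = 0 -> analytic2 (fun p => F (psi p)).
Proof.
move=> hF [h1 h2] p0; apply: (@an_eqf _ (fun p => F ((psi p).1, (psi p).2))).
  by move=> p; rewrite -surjective_pairing.
by apply: an_comp => //; rewrite p0.
Qed.

Lemma near_pull (Q : R * R -> Prop) psi : (\forall p \near (0 : R * R), Q p) ->
  analytic_map psi -> psi 0 = 0 -> \forall p \near (0 : R * R), Q (psi p).
Proof.
move=> hQ [h1 h2] p0.
have := near_comp hQ h1 h2; rewrite p0 => /(_ erefl erefl).
by apply: filterS => p; rewrite -surjective_pairing.
Qed.

Lemma grad_pull F psi p A B a b c d : grad F (psi p) A B ->
  grad (fun q => (psi q).1) p a b -> grad (fun q => (psi q).2) p c d ->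
  grad (fun q => F (psi q)) p (A * a + B * c) (A * b + B * d).
Proof.
move=> hF h1 h2.
apply: (@grad_eqf _ (fun q => F ((psi q).1, (psi q).2))).
  by move=> q; rewrite -surjective_pairing.
by apply: grad_comp => //; rewrite -surjective_pairing.
Qed.

Lemma jacE psi p : jac psi p = dX (fun q => (psi q).1) p * dY (fun q => (psi q).2) p
  - dY (fun q => (psi q).1) p * dX (fun q => (psi q).2) p.
Proof. by []. Qed.

Lemma jac_grad psi p a b c d : grad (fun q => (psi q).1) p a b -> grad (fun q => (psi q).2) p c d ->
  jac psi p = a * d - b * c.
Proof. by move=> [_ <- <-] [_ <- <-]. Qed.

Lemma an_jac psi : analytic_map psi -> analytic2 (jac psi).
Proof.
move=> [h1 h2]; apply: an_sub; apply: an_mul.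
- exact: an_dX h1.
- exact: an_dY h2.
- exact: an_dY h1.
- exact: an_dX h2.
Qed.

Lemma diffeo_an psi : diffeo_germ psi -> analytic_map psi /\ psi 0 = 0.
Proof. by case. Qed.

Lemma analytic_map_comp psi phi : analytic_map psi -> analytic_map phi -> phi 0 = 0 ->
  analytic_map (fun p => psi (phi p)).
Proof. by move=> [h1 h2] hphi p0; split; [exact: an_pull h1 hphi p0|exact: an_pull h2 hphi p0]. Qed.

Lemma diffeo_comp psi phi : diffeo_germ psi -> diffeo_germ phi -> diffeo_germ (fun p => psi (phi p)).
Proof.
move=> [h1 h2 [psi' [h3 h4 h5 h6]]] [k1 k2 [phi' [k3 k4 k5 k6]]]; split.
- exact: analytic_map_comp.
- by rewrite k2.
exists (fun p => phi' (psi' p)); split.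
- exact: analytic_map_comp.
- by rewrite h4.
- have := near_pull h5 k1 k2; move: k5; apply: filterS2 => p E1 E2; by rewrite E2.
- have := near_pull k6 h3 h4; move: h6; apply: filterS2 => p E1 E2; by rewrite E2.
Qed.

Lemma diffeo_inv psi : diffeo_germ psi -> exists phi, [/\ diffeo_germ phi,
  \forall p \near (0 : R * R), phi (psi p) = p & \forall p \near (0 : R * R), psi (phi p) = p].
Proof.
move=> [h1 h2 [phi [h3 h4 h5 h6]]]; exists phi; split=> //; split=> //.
by exists psi.
Qed.

Lemma idlin_inv U V A B : analytic2 U -> analytic2 V -> idlin U V ->
  analytic2 A -> analytic2 B -> A 0 = 0 -> B 0 = 0 ->
  (\forall p \near (0 : R * R), U (A p, B p) = p.1 /\ V (A p, B p) = p.2) -> idlin A B.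
Proof.
move=> hU hV [gU gV U0 V0] hA hB A0 B0 E.
have gA := gradE (an_diff0 hA); have gB := gradE (an_diff0 hB).
have gU' : grad U (A 0, B 0) 1 0 by rewrite A0 B0.
have gV' : grad V (A 0, B 0) 0 1 by rewrite A0 B0.
have E1 : \forall p \near (0 : R * R), U (A p, B p) = p.1 by move: E; apply: filterS => p [].
have E2 : \forall p \near (0 : R * R), V (A p, B p) = p.2 by move: E; apply: filterS => p [].
have h1 := grad_ext E1 (grad_comp gU' gA gB).
have h2 := grad_ext E2 (grad_comp gV' gA gB).
have [e1 e2] := grad_unique h1 (grad_fst 0); have [e3 e4] := grad_unique h2 (grad_snd 0).
split=> //.
  by apply: grad_eq gA _ _; [rewrite -[RHS]e1|rewrite -[RHS]e2]; ring.
by apply: grad_eq gB _ _; [rewrite -[RHS]e3|rewrite -[RHS]e4]; ring.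
Qed.

(** The right inverse has itself a right inverse, so it is two-sided. *)
Lemma inverse_idlin2 U V : analytic2 U -> analytic2 V -> idlin U V ->
  exists A B, [/\ analytic2 A, analytic2 B, A 0 = 0, B 0 = 0 &
    (\forall p \near (0 : R * R), U (A p, B p) = p.1 /\ V (A p, B p) = p.2) /\
    (\forall p \near (0 : R * R), A (U p, V p) = p.1 /\ B (U p, V p) = p.2)].
Proof.
move=> hU hV hid; have [A [B [hA hB A0 B0 E]]] := inverse_idlin hU hV hid.
have hid2 := idlin_inv hU hV hid hA hB A0 B0 E.
exists A, B; split=> //; split=> //.
have [C [D [hC hD C0 D0 E2]]] := inverse_idlin hA hB hid2.
have E3 := near_comp E hC hD C0 D0.
have : \forall p \near (0 : R * R), U p = C p /\ V p = D p.
  move: E2 E3; apply: filterS2 => p [e1 e2] /=; rewrite e1 e2 -surjective_pairing.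
  by [].
move: E2; apply: filterS2 => p [e1 e2] [-> ->]; by [].
Qed.

Lemma diffeo_idlin psi : analytic_map psi -> idlin (fun p => (psi p).1) (fun p => (psi p).2) ->
  diffeo_germ psi.
Proof.
move=> [h1 h2] hid; have [A [B [hA hB A0 B0 [E1 E2]]]] := inverse_idlin2 h1 h2 hid.
case: hid => _ _ U0 V0.
split=> //; first by rewrite [LHS]surjective_pairing U0 V0.
exists (fun p => (A p, B p)); split=> //.
- by rewrite A0 B0.
- by move: E2; apply: filterS => p; rewrite -surjective_pairing => -[-> ->]; rewrite -surjective_pairing.
- by move: E1; apply: filterS => p [e1 e2]; rewrite [LHS]surjective_pairing e1 e2 -surjective_pairing.
Qed.

(** The chain rule for an outer function of one variable, uniformly in the inner
   function, so that it can be evaluated along any germ. *)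
Lemma an1_grad (c : R -> R) : analytic1 c -> \forall t \near (0 : R), forall u p a b,
  grad u p a b -> u p = t -> grad (fun q => c (u q)) p (derive1 c t * a) (derive1 c t * b).
Proof.
by move=> /an1_diff; apply: filterS => t h u p a b hu E; rewrite -E; apply: grad_comp1 => //; rewrite E.
Qed.

Lemma an1_grad2 (c : R -> R) u : analytic1 c -> analytic2 u -> u 0 = 0 -> \forall p \near (0 : R * R),
  forall a b, grad u p a b -> grad (fun q => c (u q)) p (derive1 c (u p) * a) (derive1 c (u p) * b).
Proof.
move=> hc hu u0; have := near_along (an1_grad hc) hu u0.
by apply: filterS => p h a b hu'; exact: h.
Qed.

(** Reduced to two variables: (x, xi) |-> (g(x) / g'(0), xi) is tangent to the
   identity. *)
Lemma inverse1 (g : R -> R) : analytic1 g -> g 0 = 0 -> derive1 g 0 != 0 ->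
  exists h, [/\ analytic1 h, h 0 = 0, derive1 h 0 != 0,
    \forall t \near (0 : R), g (h t) = t & \forall t \near (0 : R), h (g t) = t].
Proof.
move=> hg g0 mu0; set mu := derive1 g 0.
pose U p := mu^-1 * g p.1.
have hU : analytic2 U by apply: an_mul; [exact: an_cst|apply/an1P].
have gg : grad (fun p : R * R => g p.1) (0 : R * R) (mu * 1) (mu * 0).
  have := nbhs_singleton (an1_grad hg); apply; [exact: grad_fst|by []].
have hid : idlin U (fun p => p.2).
  split=> //.
  - apply: grad_eq (gradM (grad_cst mu^-1 (0 : R * R)) gg) _ _.
      by rewrite /= mulr1 mulr0 addr0 mulVf.
    by rewrite /= !mulr0 addr0.
  - exact: grad_snd.
  - by rewrite /U g0 mulr0.
have [A [B [hA hB A0 B0 [E1 E2]]]] := inverse_idlin2 hU (an_snd R) hid.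
pose h t := A (mu^-1 * t, 0).
have hh : analytic1 h.
  apply/an1P; apply: an_comp hA _ (an_cst 0) _ erefl; last by rewrite mulr0.
  by apply: an_mul; [exact: an_cst|exact: an_fst].
have h0 : h 0 = 0 by rewrite /h mulr0.
have E3 : \forall t \near (0 : R), g (h t) = t.
  have : \forall p \near (0 : R * R), U (A (mu^-1 * p.1, 0), B (mu^-1 * p.1, 0)) = mu^-1 * p.1.
    have := near_comp E1 (an_mul (an_cst mu^-1) (an_fst R)) (an_cst 0).
    by rewrite mulr0 => /(_ erefl erefl); apply: filterS => p [].
  move/near_xaxis; apply: filterS => t /=; rewrite /U/= => /(congr1 (fun z => mu * z)).
  by rewrite !mulVKf.
have E4 : \forall t \near (0 : R), h (g t) = t.
  by have := near_xaxis E2; apply: filterS => t [+ _]; rewrite /U/h/=.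
exists h; split=> //.
have gh := nbhs_singleton (an1_grad hh) _ _ _ _ (grad_fst (0 : R * R)) erefl.
have ggh := nbhs_singleton (an1_grad hg) _ _ _ _ gh h0.
have hE := grad_ext (near_along E3 (an_fst R) erefl) ggh.
have [+ _] := grad_unique hE (grad_fst 0).
rewrite mulr1 => /eqP; apply: contraTneq => ->; by rewrite mulr0 eq_sym oner_eq0.
Qed.

Lemma jac_comp psi phi p : differentiable (fun q => (psi q).1) (phi p) ->
  differentiable (fun q => (psi q).2) (phi p) ->
  differentiable (fun q => (phi q).1) p -> differentiable (fun q => (phi q).2) p ->
  jac (fun q => psi (phi q)) p = jac psi (phi p) * jac phi p.
Proof.
move=> /gradE h1 /gradE h2 /gradE h3 /gradE h4.
rewrite (jac_grad (grad_pull h1 h3 h4) (grad_pull h2 h3 h4)) !jacE; ring.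
Qed.

Lemma near_jac_comp psi phi : analytic_map psi -> analytic_map phi -> phi 0 = 0 ->
  \forall p \near (0 : R * R), jac (fun q => psi (phi q)) p = jac psi (phi p) * jac phi p.
Proof.
move=> [h1 h2] hphi p0; case: (hphi) => h3 h4.
have d1 := near_pull (an_diff h1) hphi p0; have d2 := near_pull (an_diff h2) hphi p0.
have d3 := an_diff h3; have d4 := an_diff h4.
near=> p; apply: jac_comp; near: p => //.
Unshelve. all: by end_near. Qed.

Lemma jac_ext psi phi : (\forall p \near (0 : R * R), psi p = phi p) ->
  \forall p \near (0 : R * R), jac psi p = jac phi p.
Proof.
move=> /near_join; apply: filterS => p h; rewrite !jacE /dX /dY.
have h1 : \forall q \near p, (psi q).1 = (phi q).1 by move: h; apply: filterS => q ->.
have h2 : \forall q \near p, (psi q).2 = (phi q).2 by move: h; apply: filterS => q ->.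
by rewrite !(near_eq_derive _ h1) !(near_eq_derive _ h2).
Qed.

Lemma jac_id p : jac (fun q : R * R => q) p = 1.
Proof. by rewrite (jac_grad (grad_fst p) (grad_snd p)) mulr1 mulr0 subr0. Qed.

Lemma jac_inv psi phi : analytic_map psi -> analytic_map phi -> phi 0 = 0 ->
  (\forall p \near (0 : R * R), psi (phi p) = p) ->
  \forall p \near (0 : R * R), jac psi (phi p) * jac phi p = 1.
Proof.
move=> h1 h2 p0 h; have := jac_ext h; have := near_jac_comp h1 h2 p0.
by apply: filterS2 => p <- ->; rewrite jac_id.
Qed.

(** The Jacobians of two inverse maps are inverse to each other. *)
Lemma diffeo_jac0 psi : diffeo_germ psi -> jac psi 0 != 0.
Proof.
move=> [h1 h2 [phi [h3 h4 h5 h6]]].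
have := nbhs_singleton (jac_inv h3 h1 h2 h5); rewrite h2 => /eqP.
by apply: contraTneq => ->; rewrite mulr0 eq_sym oner_eq0.
Qed.

End Diffeo.

(** * The Hamiltonian field of xi^2 +- x^k *)

Section NormalFormFunction.
Variable R : realType.
Variables (k : nat) (s : bool).
Hypothesis k2 : (2 <= k)%N.
Implicit Types (F G u v w A B tau : R * R -> R) (p q : R * R) (r M : R).

Local Notation sg := ((-1) ^+ s : R).
Local Notation f := (@nfH R k s).

Lemma sg2 : sg * sg = 1.
Proof. by rewrite -expr2 sqrr_sign. Qed.

Lemma sg_neq0 : sg != 0.
Proof. by rewrite signr_eq0. Qed.

Lemma sgn1 : `|sg| = 1.
Proof. by rewrite normrX normrN1 expr1n. Qed.

Lemma grad_f p : grad f p (sg * (k%:R * p.1 ^+ k.-1)) (2 * p.2).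
Proof.
apply: grad_eq (gradD (gradX 2 (grad_snd p)) (gradM (grad_cst sg p) (gradX k (grad_fst p)))) _ _.
  by rewrite /=; ring.
by rewrite /=; ring.
Qed.

Lemma an_f : analytic2 f.
Proof.
apply: an_add; first by apply: an_exp; exact: an_snd.
by apply: an_mul; [exact: an_cst|apply: an_exp; exact: an_fst].
Qed.

Lemma f0 : f 0 = 0.
Proof. by rewrite /nfH/= !expr0n/= gtn_eqF ?(ltnW k2)//= mulr0 addr0. Qed.

(** The derivation by the Hamiltonian vector field of f: f_xi times the
   x-derivative minus f_x times the xi-derivative. *)
Definition X0 w p := 2 * p.2 * dX w p - sg * k%:R * p.1 ^+ k.-1 * dY w p.

Lemma X0E w p a b : grad w p a b -> X0 w p = 2 * p.2 * a - sg * k%:R * p.1 ^+ k.-1 * b.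
Proof. by move=> [_ <- <-]. Qed.

Lemma an_X0 w : analytic2 w -> analytic2 (X0 w).
Proof.
move=> hw; apply: an_sub; apply: an_mul; first by apply: an_mul; [exact: an_cst|exact: an_snd].
- exact: an_dX.
- by apply: an_mul; [exact: an_cst|apply: an_exp; exact: an_fst].
- exact: an_dY.
Qed.

Lemma near_X0 u v : (\forall p \near (0 : R * R), u p = v p) -> \forall p \near (0 : R * R), X0 u p = X0 v p.
Proof.
move=> /near_join; apply: filterS => p h.
by rewrite /X0 /dX /dY !(near_eq_derive _ h).
Qed.

(** On the functions of (x, t), the operator B |-> X0 (xi B(x, f)), where xi^2
   is replaced by t - sg x^k. *)
Definition opB B p := 2 * (p.2 - sg * p.1 ^+ k) * dX B p - sg * k%:R * p.1 ^+ k.-1 * B p.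

(** Split the series into even and odd powers of xi. *)
Lemma even_odd w : analytic2 w -> exists F G, [/\ analytic2 F, analytic2 G &
  \forall p \near (0 : R * R), w p = F (p.1, p.2 ^+ 2) + p.2 * G (p.1, p.2 ^+ 2)].
Proof.
move=> /analytic2_maj[r' r'0 [M hM']].
pose r := Num.min r' 1; have r0 : 0 < r by rewrite lt_min r'0 ltr01.
have rr' : r <= r' by rewrite ge_min lexx.
have [a ha] := maj_le (ltW r0) rr' (lexx M) hM'.
have r1 : r <= 1 by rewrite ge_min lexx orbT.
pose rho := r ^+ 2; have rho0 : 0 < rho by rewrite exprn_gt0.
have rhor : rho <= r by rewrite /rho expr2 ler_piMl// ltW.
pose m (b : bool) i j (p : R * R) := (if odd j == b then a i j else 0) * (p.1 ^+ i * p.2 ^+ j./2 * 1).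
have hm b i j : maj (m b i j) rho (`|if odd j == b then a i j else 0| * (rho ^+ i * rho ^+ j./2 * `|1|)).
  by apply: maj_scale; apply: maj_mono; [exact: ltW|apply: maj_cst; exact: ltW].
have hb (b : bool) : absum (fun i j => `|if odd j == b then a i j else 0| * (rho ^+ i * rho ^+ j./2 * `|1 : R|)) (r^-1 ^+ b * M).
  have rb0 : 0 <= r^-1 ^+ b by rewrite exprn_ge0// invr_ge0 ltW.
  move=> N; apply: le_trans (ler_wpM2l rb0 (ha.1 N)); rewrite -dsumZ; apply: le_dsum => i j.
  rewrite normr1 mulr1 ger0_norm; last by rewrite !mulr_ge0// ?exprn_ge0// ltW.
  case: eqP => [<-|_]; last by rewrite normr0 mul0r mulr_ge0 ?exprn_ge0// invr_ge0 ltW.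
  rewrite /mono/= !normrM !normrX (gtr0_norm r0).
  have -> : rho ^+ j./2 = r^-1 ^+ odd j * r ^+ j.
    have -> : r ^+ j = r ^+ odd j * r ^+ (2 * j./2) by rewrite -exprD mul2n odd_double_half.
    by rewrite /rho -exprM mulrA -exprMn mulVf ?gt_eqF// expr1n mul1r.
  rewrite [leLHS](_ : _ = (r^-1 ^+ odd j * (`|a i j| * r ^+ j)) * rho ^+ i); last by ring.
  rewrite [leRHS](_ : _ = (r^-1 ^+ odd j * (`|a i j| * r ^+ j)) * r ^+ i); last by ring.
  rewrite ler_wpM2l//; last by rewrite lerXn2r// nnegrE ltW.
  by rewrite !mulr_ge0// ?exprn_ge0 ?invr_ge0// ltW.
have [F hF cF] := maj_series_ex rho0 (hm false) (hb false).
have [G hG cG] := maj_series_ex rho0 (hm true) (hb true).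
exists F, G; split; [exact: maj_analytic2 hF|exact: maj_analytic2 hG|].
apply/near0P; exists rho => // p hp; have hp2 : inbox rho (p.1, p.2 ^+ 2).
  case: hp => h1 h2; split=> //=; rewrite normrX expr2.
  apply: le_trans (_ : rho * 1 <= _); last by rewrite mulr1.
  by apply: ler_pM => //; apply: le_trans h2 (le_trans rhor r1).
have h1 := ha.2 p (inbox_le rhor hp).
have h3 : (p.2 * dsum (fun i j => m true i j (p.1, p.2 ^+ 2)) n n) @[n --> \oo] --> p.2 * G (p.1, p.2 ^+ 2).
  by apply: cvgMr; exact: cG.
have h2 := cvgD (cF _ hp2) h3.
apply: cvg_unique h1 _ => //=.
rewrite (_ : (fun n => dsum (mono a p) n n) = fun n => dsum (fun i j => m false i j (p.1, p.2 ^+ 2)) n n +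
   p.2 * dsum (fun i j => m true i j (p.1, p.2 ^+ 2)) n n); first exact: h2.
apply/funext => n; rewrite -dsumZ -dsumD; apply: eq_dsum => i j.
have E : p.2 ^+ j = p.2 ^+ odd j * p.2 ^+ (2 * j./2) by rewrite -exprD mul2n odd_double_half.
rewrite /m /mono/= -exprM E.
by case: (odd j); rewrite /= ?mulr1 ?expr0 ?expr1; ring.
Qed.

(** In [even_odd] the variable xi^2 is exchanged for f = xi^2 + sg x^k. *)
Lemma even_odd_in_f w : analytic2 w -> exists F G, [/\ analytic2 F, analytic2 G &
  \forall p \near (0 : R * R), w p = F (p.1, f p) + p.2 * G (p.1, f p)].
Proof.
move=> /even_odd[F [G [hF hG h]]].
have hu : analytic2 (fun p : R * R => p.2 - sg * p.1 ^+ k).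
  apply: an_sub; first exact: an_snd.
  by apply: an_mul; [exact: an_cst|apply: an_exp; exact: an_fst].
have u0 : (0 : R * R).2 - sg * (0 : R * R).1 ^+ k = 0.
  by rewrite /= expr0n gtn_eqF ?(ltnW k2)//= mulr0 subr0.
exists (fun p => F (p.1, p.2 - sg * p.1 ^+ k)), (fun p => G (p.1, p.2 - sg * p.1 ^+ k)); split.
- by apply: an_comp => //; exact: an_fst.
- by apply: an_comp => //; exact: an_fst.
by apply: filterS h => p -> /=; rewrite /nfH addrK.
Qed.

(** The bound produced by the recursion on m, with M = r^k: the factor m + 1
   counts the steps. *)
Definition mono_bound r M (m e : nat) : R := m.+1%:R * r ^+ m * M ^+ e / M.

(** The equation F = sum x^i c_i(t) + opB B for one monomial.  For m < k - 1
   take c_m = t^e.  For m = n + k - 1, opB (x^n t^e) is 2n x^(n-1) t^(e+1) - sg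
   (2n + k) x^m t^e, which reduces x^m t^e to x^(n-1) t^(e+1); the exponent of x
   decreases by k. *)
Lemma solve_mono r m e : 0 < r <= 1 -> exists B (c : nat -> R -> R),
  [/\ maj B (r ^+ k) (mono_bound r (r ^+ k) m e),
      forall i, maj (fun p => c i p.2) (r ^+ k) (mono_bound r (r ^+ k) m e) &
      forall p, differentiable B p /\
        p.1 ^+ m * p.2 ^+ e = \sum_(i < k.-1) p.1 ^+ i * c i p.2 + opB B p].
Proof.
move=> /andP[r0 r1].
set t := r ^+ k; have t0 : 0 < t by exact: exprn_gt0.
have tr i : (i <= k)%N -> t <= r ^+ i by move=> ik; rewrite /t ler_wiXn2l// ltW.
have kpos : (0 < k)%N by exact: ltnW.
have k0 : (k%:R : R) != 0 by rewrite pnatr_eq0 -lt0n.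
elim/ltn_ind: m e => m IH e.
have [mk|mk] := ltnP m k.-1.
  exists (fun=> 0), (fun i y => if i == m then y ^+ e else 0); split.
  - apply: maj_le (maj_cst 0 (ltW t0)) => //; first exact: ltW.
    by rewrite normr0 /mono_bound !mulr_ge0// ?exprn_ge0 ?invr_ge0// ltW.
  - move=> i; have H : t ^+ e <= mono_bound r t m e.
      rewrite /mono_bound mulrAC ler_pMl ?exprn_gt0// ler_pdivlMr// mul1r.
      apply: le_trans (tr m _) _; first by lia.
      by rewrite ler_peMl ?exprn_ge0 ?(ltW r0)// ler1n.
    case: eqP => _.
      apply: maj_le (maj_exp e t0 (maj_snd (ltW t0))) => //; exact: ltW.
    apply: maj_le (maj_cst 0 (ltW t0)) => //; first exact: ltW.
    by rewrite normr0 (le_trans _ H)// exprn_ge0// ltW.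
  move=> p; split; first exact: differentiable_cst.
  have [_ dx0 _] := grad_cst (0 : R) p.
  rewrite /opB dx0 !mulr0 subrr addr0 (bigD1 (Ordinal mk))//= eqxx big1 ?addr0// => i im.
  by rewrite -val_eqE/= in im; rewrite (negbTE im) mulr0.
pose n := (m - k.-1)%N.
have mn : m = (n + k.-1)%N by rewrite /n subnK.
have n2k : ((2 * n + k)%:R : R) != 0 by rewrite pnatr_eq0; lia.
have [B' [c' [hB' hc' E']]] : exists B (c : nat -> R -> R),
  [/\ maj B t (n%:R * r ^+ m * t ^+ e / t),
      forall i, maj (fun p => c i p.2) t (n%:R * r ^+ m * t ^+ e / t) &
      forall p, differentiable B p /\
        n%:R * p.1 ^+ n.-1 * p.2 ^+ e.+1 = n%:R * (\sum_(i < k.-1) p.1 ^+ i * c i p.2 + opB B p)].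
  have [n0|n0] := posnP n.
    exists (fun=> 0), (fun _ _ => 0); rewrite n0 !mul0r; split.
    - by have := maj_cst (0 : R) (ltW t0); rewrite normr0.
    - by move=> i; have := maj_cst (0 : R) (ltW t0); rewrite normr0.
    by move=> p; split; [exact: differentiable_cst|rewrite !mul0r].
  have [|B [c [hB hc E]]] := IH n.-1 _ e.+1; first by lia.
  have Bdn : mono_bound r t n.-1 e.+1 = n%:R * r ^+ m * t ^+ e / t.
    rewrite /mono_bound prednK// exprS mulrA -!mulrA; congr (_ * _); rewrite !mulrA /t -exprD.
    by congr (r ^+ _ * _ / _); lia.
  rewrite Bdn in hB hc; exists B, c; split=> // p; have [? EE] := E p; split=> //.
  by rewrite -EE mulrA.
(* al and be are the coefficients in x^m t^e = al opB (x^n t^e) + be x^(n-1)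
   t^(e+1) *)
pose al : R := - sg / (2 * n + k)%:R; pose be : R := sg * (2 * n)%:R / (2 * n + k)%:R.
have al1 : `|al| <= 1.
  by rewrite /al normrM normrN sgn1 mul1r normfV normr_nat invf_le1 ?ltr0n ?ler1n; lia.
have be1 : `|be| <= 1.
  rewrite /be 2!normrM sgn1 mul1r normfV !normr_nat ler_pdivrMr ?ltr0n; last by lia.
  by rewrite mul1r ler_nat leq_addr.
have K0 : 0 <= n%:R * r ^+ m * t ^+ e / t by rewrite !mulr_ge0// ?exprn_ge0 ?invr_ge0// ltW.
have H : r ^+ m * t ^+ e / t + n%:R * r ^+ m * t ^+ e / t <= mono_bound r t m e.
  rewrite /mono_bound -!mulrA -[X in X + _]mul1r -mulrDl ler_wpM2r//.
    by rewrite !mulr_ge0// ?exprn_ge0 ?invr_ge0// ltW.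
  by rewrite nat1r ler_nat; lia.
have K1 : 0 <= r ^+ m * t ^+ e / t by rewrite !mulr_ge0// ?exprn_ge0 ?invr_ge0// ltW.
exists (fun p => al * (p.1 ^+ n * p.2 ^+ e * 1) + be * B' p), (fun i y => be * c' i y); split.
- apply: (maj_le (ltW t0) (lexx _) _ (maj_add (maj_scale al (maj_mono n e (ltW t0) (maj_cst 1 (ltW t0)))) (maj_scale be hB'))).
  apply: le_trans H; apply: lerD; last by rewrite ler_piMl.
  rewrite normr1 mulr1; apply: (@le_trans _ _ (t ^+ n * t ^+ e)).
    by rewrite ler_piMl// mulr_ge0// exprn_ge0// ltW.
  rewrite [leRHS]mulrAC; apply: ler_wpM2r; first by rewrite exprn_ge0// ltW.
  rewrite ler_pdivlMr// -exprSr /t -exprM.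
  apply: ler_wiXn2l => //; first exact: ltW.
  by nia.
- move=> i; apply: (maj_le (ltW t0) (lexx _) _ (maj_scale be (hc' i))).
  apply: le_trans H; apply: (@le_trans _ _ (n%:R * r ^+ m * t ^+ e / t)).
    by rewrite ler_piMl.
  by rewrite lerDr.
move=> p; have [dB EE] := E' p.
have g1 := gradD (gradM (grad_cst al p) (gradM (gradM (gradX n (grad_fst p)) (gradX e (grad_snd p))) (grad_cst 1 p)))
   (gradM (grad_cst be p) (gradE dB)).
case: (g1) => d1 dx1 _; split; first exact: d1.
have -> : \sum_(i < k.-1) p.1 ^+ i * (be * c' i p.2) = be * \sum_(i < k.-1) p.1 ^+ i * c' i p.2.
  by rewrite mulr_sumr; apply: eq_bigr => i _; rewrite mulrCA.
have ben : be = sg * 2 / (2 * n + k)%:R * n%:R by rewrite /be natrM; ring.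
move: EE; set S := \sum_(i < _) _; rewrite /opB dx1 => EE.
rewrite mn exprD.
have pk : p.1 ^+ k = p.1 * p.1 ^+ k.-1 by rewrite -exprS prednK.
have pn : n%:R * p.1 ^+ n = n%:R * (p.1 * p.1 ^+ n.-1).
  by case: (n) => [|n']; rewrite ?mul0r//= exprS.
move: EE; rewrite /opB => EE.
have EE2 : be * S + (2 * (p.2 - sg * p.1 ^+ k) * (be * dX B' p) - sg * k%:R * p.1 ^+ k.-1 * (be * B' p)) =
   sg * 2 / (2 * n + k)%:R * (n%:R * p.1 ^+ n.-1 * p.2 ^+ e.+1).
  by rewrite EE ben; ring.
rewrite /= !mulr0 !mulr1 !addr0 !add0r.
transitivity (al * (2 * (p.2 - sg * p.1 ^+ k) * (n%:R * p.1 ^+ n.-1 * p.2 ^+ e) - sg * k%:R * p.1 ^+ k.-1 * (p.1 ^+ n * p.2 ^+ e)) +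
  (be * S + (2 * (p.2 - sg * p.1 ^+ k) * (be * dX B' p) - sg * k%:R * p.1 ^+ k.-1 * (be * B' p)))); last by ring.
rewrite EE2 exprS pk.
have ss := sg2.
set X := p.1 ^+ k.-1 in pk *; set Y := p.2 ^+ e.
have -> : al * (2 * (p.2 - sg * (p.1 * X)) * (n%:R * p.1 ^+ n.-1 * Y) - sg * k%:R * X * (p.1 ^+ n * Y)) =
  al * (2 * p.2 * (n%:R * p.1 ^+ n.-1) * Y - sg * X * Y * (2 * (n%:R * (p.1 * p.1 ^+ n.-1)) + k%:R * p.1 ^+ n)) by ring.
rewrite -pn /al.
have -> : 2 * (n%:R * p.1 ^+ n) + k%:R * p.1 ^+ n = (2 * n + k)%:R * p.1 ^+ n by rewrite natrD natrM; ring.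
transitivity (sg * sg * (p.1 ^+ n * X * Y)); first by rewrite ss mul1r.
clear -n2k; move: ((2 * n + k)%:R : R) n2k => d hd.
by field.
Qed.

End NormalFormFunction.

(** * Densities modulo the Hamiltonian field *)

Section Cohomology.
Variable R : realType.
Variables (k : nat) (s : bool).
Hypothesis k2 : (2 <= k)%N.
Implicit Types (F G u v w A B tau : R * R -> R) (p q : R * R) (r M : R).

Local Notation sg := ((-1) ^+ s : R).
Local Notation f := (@nfH R k s).
Local Notation X0 := (@X0 R k s).
Local Notation opB := (@opB R k s).

(** Sum the solutions for the monomials.  The factor m + 1 of the bound is
   absorbed by halving the radius. *)
Lemma solve_opB F : analytic2 F -> exists B (c : nat -> R -> R),
  [/\ analytic2 B, forall i, analytic1 (c i) &
     \forall p \near (0 : R * R), F p = \sum_(i < k.-1) p.1 ^+ i * c i p.2 + opB B p].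
Proof.
move=> /analytic2_maj[r' r'0 [M hM']].
pose r := Num.min r' 1; have r0 : 0 < r by rewrite lt_min r'0 ltr01.
have rr' : r <= r' by rewrite ge_min lexx.
have [a ha] := maj_le (ltW r0) rr' (lexx M) hM'.
have r1 : r <= 1 by rewrite ge_min lexx orbT.
have rh : 0 < r / 2 <= 1.
  by rewrite divr_gt0//= ler_pdivrMr// mul1r (le_trans r1)// ler1n.
set t := (r / 2) ^+ k.
have t0 : 0 < t by apply: exprn_gt0; case/andP: rh.
have tr : t <= r.
  apply: (@le_trans _ _ (r / 2)); last by case/andP: (half_lt r0) => _ /ltW.
  case/andP: rh => h1 h2; rewrite /t -[leRHS](expr1 (r / 2)).
  by apply: ler_wiXn2l => //; [exact: ltW|exact: ltnW].
have /choice[Bc hBc] : forall ij : nat * nat, exists Bc : (R * R -> R) * (nat -> R -> R),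
  [/\ maj Bc.1 t (mono_bound (r / 2) t ij.1 ij.2),
      forall i, maj (fun p => Bc.2 i p.2) t (mono_bound (r / 2) t ij.1 ij.2) &
      forall p, differentiable Bc.1 p /\
        p.1 ^+ ij.1 * p.2 ^+ ij.2 = \sum_(i < k.-1) p.1 ^+ i * Bc.2 i p.2 + opB Bc.1 p].
  by move=> [i j]; have [B [c h]] := @solve_mono R k s k2 (r / 2) i j rh; exists (B, c).
have hB : absum (fun i j => `|a i j| * mono_bound (r / 2) t i j) (M / t).
  move=> N; rewrite ler_pdivlMr// mulrC -dsumZ; apply: le_trans (ha.1 N); apply: le_dsum => i j.
  have r20 : 0 <= r / 2 by case/andP: rh => /ltW.
  have B0 : 0 <= mono_bound (r / 2) t i j by rewrite /mono_bound !mulr_ge0// ?exprn_ge0 ?invr_ge0// ?(ltW t0).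
  rewrite (ger0_norm (mulr_ge0 (normr_ge0 (a i j)) B0)) /mono/= !normrM !normrX (gtr0_norm r0).
  rewrite mulrCA -mulrA ler_wpM2l// /mono_bound mulrC divfK ?gt_eqF//.
  apply: ler_pM.
  - by rewrite mulr_ge0// exprn_ge0.
  - by rewrite exprn_ge0// ltW.
  - rewrite exprMn mulrCA ler_piMr ?exprn_ge0 ?(ltW r0)// exprVn ler_pdivrMr ?exprn_gt0// mul1r.
    by rewrite -natrX ler_nat ltn_expl.
  - by rewrite lerXn2r// nnegrE ltW.
have hm i j : maj (fun p => a i j * (Bc (i, j)).1 p) t (`|a i j| * mono_bound (r / 2) t i j).
  by apply: maj_scale; have [] := hBc (i, j).
have hc l i j : maj (fun p => a i j * (Bc (i, j)).2 l p.2) t (`|a i j| * mono_bound (r / 2) t i j).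
  by apply: maj_scale; have [_ + _] := hBc (i, j); apply.
have [B PB cB] := maj_series_ex t0 hm hB.
have /choice[C hC] : forall l, exists C, maj C t (M / t) /\
   forall p, inbox t p -> dsum (fun i j => a i j * (Bc (i, j)).2 l p.2) n n @[n --> \oo] --> C p.
  by move=> l; have [C h1 h2] := maj_series_ex t0 (hc l) hB; exists C.
exists B, (fun l y => C l (0, y)); split.
- exact: maj_analytic2 PB.
- move=> l; apply/an1P; have hCl := maj_analytic2 t0 (hC l).1.
  exact: (an_comp hCl (an_cst 0) (an_fst R) erefl erefl).
apply/near0P; exists (t / 2); first by rewrite divr_gt0.
move=> p hp; have hpt : inbox t p by apply: inbox_le hp; case/andP: (half_lt t0) => _ /ltW.
have [cD _] := maj_series_der (half_lt t0) hm hB cB hp.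
have CE l : C l (0, p.2) = C l p.
  have h0 : inbox t (0, p.2) by case: hpt => h1 h2; split=> //=; rewrite normr0 ltW.
  by apply: cvg_unique ((hC l).2 _ h0) ((hC l).2 _ hpt).
under eq_bigr do rewrite CE.
have h1 := ha.2 p (inbox_le tr hpt).
have h2 : (\sum_(l < k.-1) p.1 ^+ l * dsum (fun i j => a i j * (Bc (i, j)).2 l p.2) n n +
   (2 * (p.2 - sg * p.1 ^+ k) * dsum (fun i j => dX (fun p => a i j * (Bc (i, j)).1 p) p) n n
   - sg * k%:R * p.1 ^+ k.-1 * dsum (fun i j => a i j * (Bc (i, j)).1 p) n n)) @[n --> \oo] -->
   \sum_(l < k.-1) p.1 ^+ l * C l p + opB B p.
  apply: cvgD.
    by apply: cvg_sumr => l; apply: cvgMr; exact: (hC l).2.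
  by apply: cvgB; apply: cvgMr => //; exact: cB.
suff Efn : (fun n => dsum (mono a p) n n) = (fun n => \sum_(l < k.-1) p.1 ^+ l * dsum (fun i j => a i j * (Bc (i, j)).2 l p.2) n n +
   (2 * (p.2 - sg * p.1 ^+ k) * dsum (fun i j => dX (fun p => a i j * (Bc (i, j)).1 p) p) n n
   - sg * k%:R * p.1 ^+ k.-1 * dsum (fun i j => a i j * (Bc (i, j)).1 p) n n)).
  by rewrite Efn in h1; apply: (cvg_unique _ h1 h2).
apply/funext => n; rewrite -!dsumZ.
have dsumN t' m' n' : - dsum t' m' n' = dsum (fun i j => - t' i j) m' n' :> R.
  by rewrite -mulN1r -dsumZ; apply: eq_dsum => i j; rewrite mulN1r.
rewrite dsumN.
have -> : \sum_(l < k.-1) p.1 ^+ l * dsum (fun i j => a i j * (Bc (i, j)).2 l p.2) n n =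
   dsum (fun i j => \sum_(l < k.-1) p.1 ^+ l * (a i j * (Bc (i, j)).2 l p.2)) n n.
  rewrite /dsum; under eq_bigr do rewrite mulr_sumr; rewrite exchange_big/=; apply: eq_bigr => i _.
  under eq_bigr do rewrite mulr_sumr; by rewrite exchange_big/=.
rewrite -!dsumD; apply: eq_dsum => i j.
have [_ _ /(_ p)[dB E]] := hBc (i, j).
rewrite /mono -mulrA [p.1 ^+ i * _]E/=.
have -> : dX (fun p => a i j * (Bc (i, j)).1 p) p = a i j * dX (Bc (i, j)).1 p.
  by have [_ -> _] := gradM (grad_cst (a i j) p) (gradE dB); rewrite mulr0 addr0.
rewrite mulrDr mulr_sumr; congr (_ + _).
  by apply: eq_bigr => l _; rewrite mulrCA.
by rewrite /opB; ring.
Qed.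

Lemma an_Ff F : analytic2 F -> analytic2 (fun p => F (p.1, f p)).
Proof. by move=> hF; exact: (an_comp hF (an_fst R) (an_f R k s) erefl (f0 R s k2)). Qed.

Lemma near_Ff (Q : R * R -> Prop) : (\forall p \near (0 : R * R), Q p) ->
  \forall p \near (0 : R * R), Q (p.1, f p).
Proof. by move=> hQ; exact: (near_comp hQ (an_fst R) (an_f R k s) erefl (f0 R s k2)). Qed.

(** X0 f = 0 and X0 x = 2 xi, so X0 exchanges the functions even in xi and those
   odd in xi. *)
Lemma X0_split A B : analytic2 A -> analytic2 B ->
  \forall p \near (0 : R * R), X0 (fun p => A (p.1, f p) + p.2 * B (p.1, f p)) p =
     p.2 * (2 * dX A (p.1, f p)) + opB B (p.1, f p).
Proof.
move=> /an_grad/near_Ff hA /an_grad/near_Ff hB; near=> p.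
have gA : grad A (p.1, f p) (dX A (p.1, f p)) (dY A (p.1, f p)) by near: p.
have gB : grad B (p.1, f p) (dX B (p.1, f p)) (dY B (p.1, f p)) by near: p.
have gf := grad_f k s p.
have g1 := grad_comp gA (grad_fst p) gf.
have g2 := grad_comp gB (grad_fst p) gf.
rewrite (X0E k s (gradD g1 (gradM (grad_snd p) g2))) /opB /=.
have E : f p - sg * p.1 ^+ k = p.2 ^+ 2 by rewrite /nfH addrK.
by rewrite E; ring.
Unshelve. all: by end_near. Qed.

(** The odd part of w is X0 of a function A(x, f), the even part is treated by
   [solve_opB]. *)
Lemma cohomology w : analytic2 w -> exists (c : nat -> R -> R) tau,
  [/\ forall i, analytic1 (c i), analytic2 tau &
     \forall p \near (0 : R * R), w p = \sum_(i < k.-1) p.1 ^+ i * c i (f p) + X0 tau p].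
Proof.
move=> hw; have [F [G [hF hG E]]] := even_odd_in_f s k2 hw.
have [B [c [hB hc EF]]] := solve_opB hF.
have [A hA EG] := an_antix (an_mul (an_cst 2^-1) hG).
exists c, (fun p => A (p.1, f p) + p.2 * B (p.1, f p)); split=> //.
  apply: an_add; first exact: an_Ff.
  by apply: an_mul; [exact: an_snd|exact: an_Ff].
have h1 := X0_split hA hB; have h2 := near_Ff EF; have h3 := near_Ff EG.
near=> p.
have -> : w p = F (p.1, f p) + p.2 * G (p.1, f p) by near: p.
have -> : X0 (fun p => A (p.1, f p) + p.2 * B (p.1, f p)) p =
  p.2 * (2 * dX A (p.1, f p)) + opB B (p.1, f p) by near: p.
have -> : F (p.1, f p) = \sum_(i < k.-1) p.1 ^+ i * c i (f p) + opB B (p.1, f p) by near: p.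
have -> : dX A (p.1, f p) = 2^-1 * G (p.1, f p) by near: p.
by rewrite /=; field.
Unshelve. all: by end_near. Qed.

(** The map (x, xi) |-> (x, f) is not open at 0, but its image contains the
   points with t >= sg x^k; shearing by sg x^k turns them into a half plane. *)
Lemma from_f F : analytic2 F -> (\forall p \near (0 : R * R), p.2 != 0 -> F (p.1, f p) = 0) ->
  \forall p \near (0 : R * R), F p = 0.
Proof.
move=> hF /near0P[r r0 h].
have hu e : analytic2 (fun p : R * R => p.2 + e * p.1 ^+ k).
  apply: an_add; first exact: an_snd.
  by apply: an_mul; [exact: an_cst|apply: an_exp; exact: an_fst].
have u0 e : (0 : R * R).2 + e * (0 : R * R).1 ^+ k = 0.
  by rewrite /= expr0n gtn_eqF ?(ltnW k2)//= mulr0 addr0.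
have hF2 : analytic2 (fun p => F (p.1, p.2 + sg * p.1 ^+ k)).
  by apply: an_comp => //; exact: an_fst.
have H : \forall p \near (0 : R * R), F (p.1, p.2 + sg * p.1 ^+ k) = 0.
  apply: (an_eq_quadrant hF2 (an_cst 0)).
  have m0 : 0 < Num.min r (r ^+ 2) by rewrite lt_min r0 exprn_gt0.
  apply/near0P; exists (Num.min r (r ^+ 2)) => // -[x y] [/= h1 h2] x0 y0.
  have sy : Num.sqrt y ^+ 2 = y by rewrite sqr_sqrtr// ltW.
  have := h (x, Num.sqrt y); rewrite /nfH/= sy; apply.
    split=> /=; first by apply: le_trans h1 _; rewrite ge_min lexx.
    rewrite ger0_norm ?sqrtr_ge0// -(ger0_norm (ltW r0)) -sqrtr_sqr ler_wsqrtr//.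
    by apply: le_trans (ler_norm _) (le_trans h2 _); rewrite ge_min lexx orbT.
  by rewrite gt_eqF// sqrtr_gt0.
have := near_comp H (an_fst R) (hu (- sg)) erefl (u0 (- sg)).
by apply: filterS => p /=; rewrite mulNr subrK -surjective_pairing.
Qed.

Lemma pser_zero a r M F p : pser a r M F -> (forall i j, a i j = 0) -> inbox r p -> F p = 0.
Proof.
move=> ha a0 hp; apply: cvg_unique (ha.2 p hp) _ => //=.
have -> : dsum (mono a p) = fun _ _ => 0.
  by apply/funext => m; apply/funext => n; rewrite /dsum big1// => i _; rewrite big1// => j _; rewrite /mono a0 !mul0r.
exact: cvg_cst.
Qed.

Lemma an_dX0 A : analytic2 A -> (\forall p \near (0 : R * R), dX A p = 0) ->
  \forall p \near (0 : R * R), A p = A (0, p.2).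
Proof.
move=> /analytic2_maj[r r0 [M [a ha]]] /near0P[d d0 h].
have [h1 _ _] := pser_der (half_lt r0) ha.
have r20 : 0 < r / 2 by rewrite divr_gt0.
have a0 i j : a i.+1 j = 0.
  have /eqP : dx a i j = 0.
    apply: (pser_eq0 r20 d0 h1) => p /andP[p1 p2] /andP[p3 p4]; apply: h.
    by split; rewrite gtr0_norm// ltW.
  by rewrite mulf_eq0 pnatr_eq0/= => /eqP.
have [g [hg E]] := pser_splitx r0 ha.
apply/near0P; exists r => // p hp; rewrite (E p hp).
by rewrite (pser_zero hg (fun i j => a0 i j) hp) mulr0 addr0.
Qed.

Lemma pser_mulxn a r M F n : 0 <= r -> pser a r M F ->
  pser (fun i j => if (i < n)%N then 0 else a (i - n)%N j) r (r ^+ n * M) (fun p => p.1 ^+ n * F p).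
Proof.
move=> r0 ha; elim: n => [|n IH].
  rewrite expr0 mul1r; have -> : (fun i j => if (i < 0)%N then 0 else a (i - 0)%N j) = a.
    by apply/funext => i; apply/funext => j; rewrite ltn0 subn0.
  by apply: pser_ext ha => p _; rewrite mul1r.
have := pser_mulx r0 IH; rewrite exprS -mulrA.
have -> : (fun i j => if (i < n.+1)%N then 0 else a (i - n.+1)%N j) =
   shiftx (fun i j => if (i < n)%N then 0 else a (i - n)%N j).
  by apply/funext => -[|i]; apply/funext => j //=.
by apply: pser_ext => p _; rewrite exprS mulrA.
Qed.

Lemma pser_sum (I : Type) (l : seq I) (a : I -> nat -> nat -> R) r (M : I -> R) (F : I -> R * R -> R) :
  0 <= r -> (forall i, pser (a i) r (M i) (F i)) ->
  pser (fun m e => \sum_(i <- l) a i m e) r (\sum_(i <- l) M i) (fun p => \sum_(i <- l) F i p).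
Proof.
move=> r0 h; elim: l => [|i l IH].
  rewrite big_nil; split=> [N|p hp].
    rewrite (@eq_dsum _ _ (fun _ _ => 0)); last by move=> i j; rewrite /mono big_nil !mul0r normr0.
    by rewrite /dsum big1// => j _; rewrite big1.
  rewrite big_nil (_ : (fun n => _) = fun=> 0); first exact: cvg_cst.
  apply/funext => n; rewrite (@eq_dsum _ _ (fun _ _ => 0)); last by move=> i j; rewrite /mono big_nil !mul0r.
  by rewrite /dsum big1// => j _; rewrite big1.
have := pser_add (h i) IH; rewrite big_cons.
have -> : (fun m e => \sum_(j <- i :: l) a j m e) = (fun m e => a i m e + \sum_(j <- l) a j m e).
  by apply/funext => m; apply/funext => e; rewrite big_cons.
by apply: pser_ext => p _; rewrite big_cons.
Qed.

(** Coefficient by coefficient, by induction on the power e of t: the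
   coefficient of x^(n+k-1) t^e gives (2n + k) b_(n,e) in terms of b_(n+k,e-1),
   and the coefficients of x^i with i < k - 1 then give c_i. *)
Lemma kernel_coefs B (c : nat -> R -> R) : analytic2 B -> (forall i, analytic1 (c i)) ->
  (\forall p \near (0 : R * R), \sum_(i < k.-1) p.1 ^+ i * c i p.2 + opB B p = 0) ->
  (\forall p \near (0 : R * R), B p = 0) /\ forall i, (i < k.-1)%N -> \forall t \near (0 : R), c i t = 0.
Proof.
move=> /analytic2_maj[r1 r10 [M1 hB1]] hc /near0P[d d0 E].
have hcP i : analytic2 (fun p : R * R => c i p.2).
  exact: (an1_comp2 (hc i) (an_snd R) erefl).
have [r [r0 rr1 hr]] : exists r, [/\ 0 < r, r < r1 & forall i, (i < k.-1)%N -> exists M, maj (fun p => c i p.2) r M].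
  elim: k.-1 => [|m [r [r0 rr1 hr]]].
    by exists (r1 / 2); case/andP: (half_lt r10) => _ h; split => //; rewrite divr_gt0.
  have [r' r'0 [M hM]] := analytic2_maj (hcP m).
  exists (Num.min r r'); split; first by rewrite lt_min r0.
    by rewrite gt_min rr1.
  have m0 : 0 <= Num.min r r' by rewrite le_min !ltW.
  move=> i; rewrite ltnS leq_eqVlt => /orP[/eqP->|/hr[M' hM']].
    by exists M; apply: maj_le hM => //; rewrite ge_min lexx orbT.
  by exists M'; apply: maj_le hM' => //; rewrite ge_min lexx.
case: hB1 => b hb1; have r0' : 0 <= r < r1 by rewrite ltW.
have [hdx _ _] := pser_der r0' hb1.
have hb := pser_le (ltW r0) (ltW rr1) (lexx _) hb1.
have /choice[g hg] : forall i : 'I_k.-1, exists g : (nat -> nat -> R) * R, pser g.1 r g.2 (fun p => c i p.2).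
  by move=> i; have [M [a ha]] := hr i (ltn_ord i); exists (a, M).
have g0 i m e : (g i).1 m.+1 e = 0.
  have [G [hG EG]] := pser_splitx r0 (hg i).
  apply: (pser_eq0 r0 r0 hG) => p /andP[p1 p2] /andP[p3 p4].
  have hp : inbox r p by split; rewrite gtr0_norm// ltW.
  have /eqP := EG p hp; rewrite /= -subr_eq0 opprD addNKr oppr_eq0 mulf_eq0 gt_eqF//=.
  by move/eqP.
have hT := pser_add (pser_sum (index_enum 'I_k.-1) (ltW r0) (fun i => pser_mulxn i (ltW r0) (hg i)))
  (pser_add (pser_scale 2 (pser_muly (ltW r0) hdx))
    (pser_add (pser_scale (- (2 * sg)) (pser_mulxn k (ltW r0) hdx))
       (pser_scale (- (sg * k%:R)) (pser_mulxn k.-1 (ltW r0) hb)))).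
have T0 := pser_eq0 r0 d0 hT.
have {}T0 m e := T0 _ m e.
have {}T0 : forall m e, \sum_(i < k.-1) (if (m < i)%N then 0 else (g i).1 (m - i)%N e) +
  (2 * shifty (dx b) m e + (- (2 * sg) * (if (m < k)%N then 0 else dx b (m - k)%N e) +
    - (sg * k%:R) * (if (m < k.-1)%N then 0 else b (m - k.-1)%N e))) = 0.
  move=> m e; apply: T0 => p /andP[p1 p2] /andP[p3 p4].
  have hp : inbox d p by split; rewrite gtr0_norm// ltW.
  by rewrite -[RHS](E p hp) /opB; congr (_ + _); ring.
have kpos : (0 < k)%N by exact: ltnW.
have rec n e : sg * (2 * n + k)%:R * b n e = 2 * shifty (dx b) (n + k.-1)%N e.
  have := T0 (n + k.-1)%N e; rewrite big1 ?add0r; last first.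
    move=> i _; case: ifP => // _; have := ltn_ord i => ik.
    have -> : (n + k.-1 - i = (n + k.-1 - i).-1.+1)%N by lia.
    exact: g0.
  rewrite [X in if X then _ else b _ _](_ : _ = false); last by lia.
  rewrite addnK.
  have -> : (if (n + k.-1 < k)%N then 0 else dx b (n + k.-1 - k)%N e) = n%:R * b n e.
    case: n => [|n]; first by rewrite add0n prednK// leqnn mul0r.
    rewrite ifF; last by lia.
    by rewrite /dx; have -> : (n.+1 + k.-1 - k = n)%N by lia.
  by rewrite natrD natrM => T; apply/eqP; rewrite -subr_eq0; apply/eqP; rewrite -[RHS]oppr0 -[in RHS]T; ring.
have b0 n e : b n e = 0.
  have h0 n' e' : sg * (2 * n' + k)%:R * b n' e' = 0 -> b n' e' = 0.
    move/eqP; rewrite !mulf_eq0 (negbTE (sg_neq0 R s)) pnatr_eq0/= => /orP[|/eqP//].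
    by lia.
  elim: e n => [|e IH] n; apply: h0; rewrite rec/= ?mulr0//.
  by rewrite /dx IH mulr0 mulr0.
split.
  by apply/near0P; exists r => // p hp; exact: pser_zero hb b0 hp.
move=> i ik; apply/near1P; exists r => // t ht.
have hp : inbox r (0, t) by split=> //=; rewrite normr0 ltW.
apply: (pser_zero (hg (Ordinal ik)) _ hp) => -[|m] e; last exact: g0.
have := T0 i e; rewrite (bigD1 (Ordinal ik))//= ltnn subnn big1 ?addr0; last first.
  move=> j ji; case: ifP => // ij.
  have -> : (i - j = (i - j).-1.+1)%N.
    by move: ji; rewrite -val_eqE/= => ji; lia.
  exact: g0.
have -> : shifty (dx b) i e = 0 by case: e => // e; rewrite /= /dx b0 mulr0.
rewrite ik /dx !b0 !mulr0 add0r addr0; case: ifP => _; by rewrite ?mulr0 ?addr0.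
Qed.

Lemma an_fN (Q : R * R -> Prop) : (\forall p \near (0 : R * R), Q p) ->
  \forall p \near (0 : R * R), Q (p.1, - p.2).
Proof.
move=> hQ; exact: (near_comp hQ (an_fst R) (an_opp (an_snd R)) erefl (oppr0 R)).
Qed.

(** Even and odd parts in xi vanish separately: the odd part says that the even
   part of tau does not depend on x, the even part is [kernel_coefs]. *)
Lemma cohomology_unique (c : nat -> R -> R) tau : analytic2 tau -> (forall i, analytic1 (c i)) ->
  (\forall p \near (0 : R * R), \sum_(i < k.-1) p.1 ^+ i * c i (f p) + X0 tau p = 0) ->
  (forall i, (i < k.-1)%N -> \forall t \near (0 : R), c i t = 0) /\
  exists2 h, analytic1 h & \forall p \near (0 : R * R), tau p = h (f p).
Proof.
move=> htau hc E.
have [A [B [hA hB EAB]]] := even_odd_in_f s k2 htau.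
have E1 := X0_split hA hB; have E2 := near_X0 k s EAB.
pose Q p := \sum_(i < k.-1) p.1 ^+ i * c i p.2 + opB B p.
have EQ : \forall p \near (0 : R * R), p.2 * (2 * dX A (p.1, f p)) + Q (p.1, f p) = 0.
  near=> p.
  have e0 : \sum_(i < k.-1) p.1 ^+ i * c i (f p) + X0 tau p = 0 by near: p.
  have e1 : X0 (fun p => A (p.1, f p) + p.2 * B (p.1, f p)) p =
    p.2 * (2 * dX A (p.1, f p)) + opB B (p.1, f p) by near: p.
  have e2 : X0 tau p = X0 (fun p => A (p.1, f p) + p.2 * B (p.1, f p)) p by near: p.
  by rewrite /Q/= addrCA -e1 -e2.
have fN p : f (p.1, - p.2) = f p by rewrite /nfH/= sqrrN.
have EQN : \forall p \near (0 : R * R), - p.2 * (2 * dX A (p.1, f p)) + Q (p.1, f p) = 0.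
  by have := an_fN EQ; apply: filterS => p /=; rewrite fN.
have hQ : analytic2 Q.
  apply: an_add.
    apply: an_sum => i _; apply: an_mul; first by apply: an_exp; exact: an_fst.
    exact: (an1_comp2 (hc i) (an_snd R) erefl).
  apply: an_sub; apply: an_mul => //.
  - apply: an_mul; first exact: an_cst.
    apply: an_sub; first exact: an_snd.
    by apply: an_mul; [exact: an_cst|apply: an_exp; exact: an_fst].
  - exact: an_dX.
  - by apply: an_mul; [exact: an_cst|apply: an_exp; exact: an_fst].
have Q0 : \forall p \near (0 : R * R), Q p = 0.
  apply: from_f => //; near=> p => _.
  have e1 : p.2 * (2 * dX A (p.1, f p)) + Q (p.1, f p) = 0 by near: p.
  have e2 : - p.2 * (2 * dX A (p.1, f p)) + Q (p.1, f p) = 0 by near: p.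
  lra.
have A0 : \forall p \near (0 : R * R), dX A p = 0.
  apply: from_f; first exact: an_dX.
  near=> p => p0.
  have e1 : p.2 * (2 * dX A (p.1, f p)) + Q (p.1, f p) = 0 by near: p.
  have e2 : - p.2 * (2 * dX A (p.1, f p)) + Q (p.1, f p) = 0 by near: p.
  have /eqP : p.2 * dX A (p.1, f p) = 0 by lra.
  by rewrite mulf_eq0 (negbTE p0)/= => /eqP.
have [B0 c0] := kernel_coefs hB hc Q0.
split; first exact: c0.
exists (fun t => A (0, t)).
  apply/an1P; exact: (an_comp hA (an_cst 0) (an_fst R) erefl erefl).
have A1 := near_Ff (an_dX0 hA A0); have B1 := near_Ff B0.
near=> p.
have -> : tau p = A (p.1, f p) + p.2 * B (p.1, f p) by near: p.
have -> : B (p.1, f p) = 0 by near: p.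
have -> : A (p.1, f p) = A (0, f p) by near: p.
by rewrite mulr0 addr0.
Unshelve. all: by end_near. Qed.

End Cohomology.

(** * Lie series *)

(** An elementary substitute for Stirling's formula.  It turns the bound n^n of
   n-fold Cauchy estimates into n!. *)
Lemma expnn_fact n : (n ^ n <= 4 ^ n * n`!)%N.
Proof.
have h1 : (n ^ n <= (2 * n) ^_ n)%N.
  rewrite ffact_prod -[X in (n ^ X)%N](card_ord n) -prod_nat_const; apply: leq_prod => i _.
  by have := ltn_ord i; lia.
apply: leq_trans h1 _; rewrite -bin_ffact leq_mul2r; apply/orP; right.
have -> : (4 ^ n = (1 + 1) ^ (2 * n))%N by rewrite expnM.
have nn : (n < (2 * n).+1)%N by lia.
by rewrite expnDn (bigD1 (Ordinal nn))//= !exp1n !muln1 leq_addr.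
Qed.

Section Flow.
Variable R : realType.
Implicit Types (F G u v w g h A B : R * R -> R) (p q : R * R) (r M : R).

(** The open box: iterated derivatives are compared at its points, each of which
   has a neighbourhood inside. *)
Definition obox r p := `|p.1| < r /\ `|p.2| < r.

Lemma obox_in r p : obox r p -> exists2 s, 0 <= s < r & inbox s p.
Proof.
move=> [h1 h2]; exists (Num.max `|p.1| `|p.2|).
  by rewrite le_max normr_ge0/= gt_max h1.
by split; rewrite le_max lexx ?orbT.
Qed.

Lemma obox_near r p : obox r p -> \forall q \near p, obox r q.
Proof.
move=> [h1 h2]; apply/nearboxP.
exists (Num.min ((r - `|p.1|) / 2) ((r - `|p.2|) / 2)).
  by rewrite lt_min !divr_gt0 ?subr_gt0.
move=> q [q1 q2]; split.
  apply: le_lt_trans (ler_normD _ _) _; have : `|q.1| <= (r - `|p.1|) / 2 by apply: le_trans q1 _; rewrite ge_min lexx.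
  by lra.
apply: le_lt_trans (ler_normD _ _) _; have : `|q.2| <= (r - `|p.2|) / 2 by apply: le_trans q2 _; rewrite ge_min lexx orbT.
by lra.
Qed.

Lemma near_obox (Q : R * R -> Prop) r : 0 < r -> (forall p, obox r p -> Q p) -> \forall p \near (0 : R * R), Q p.
Proof.
move=> r0 h; apply/near0P; exists (r / 2); first by rewrite divr_gt0.
by move=> p [h1 h2]; apply: h; split; case/andP: (half_lt r0) => _; apply: le_lt_trans.
Qed.

Lemma maj_diff g r M p : maj g r M -> obox r p -> differentiable g p.
Proof. by move=> hg /obox_in[s sr hp]; have [_ _ /(_ p hp)[]] := maj_der sr hg. Qed.

Variables v1 v2 tau : R * R -> R.
Hypothesis hv1 : analytic2 v1.
Hypothesis hv2 : analytic2 v2.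
Hypothesis htau : analytic2 tau.
Hypothesis v10 : v1 0 = 0.
Hypothesis v20 : v2 0 = 0.
Hypothesis tau0 : tau 0 = 0.

Definition Xop g p := v1 p * dX g p + v2 p * dY g p.

Lemma XopE g p a b : grad g p a b -> Xop g p = v1 p * a + v2 p * b.
Proof. by move=> [_ <- <-]. Qed.

Lemma an_Xop g : analytic2 g -> analytic2 (Xop g).
Proof. by move=> hg; apply: an_add; apply: an_mul => //; [exact: an_dX|exact: an_dY]. Qed.

Lemma Xop_ext g h p : (\forall q \near p, g q = h q) -> Xop g p = Xop h p.
Proof. by move=> gh; rewrite /Xop /dX /dY !(near_eq_derive _ gh). Qed.

Lemma P_Xop g r s M C : 0 < s < r -> maj v1 r C -> maj v2 r C -> maj g r M ->
  maj (Xop g) s (2 * C / (r - s) * M).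
Proof.
move=> /andP[s0 sr] h1 h2 hg; have sr' : 0 <= s < r by rewrite ltW.
have [h3 h4 _] := maj_der sr' hg.
have C1 := maj_le (ltW s0) (ltW sr) (lexx _) h1; have C2 := maj_le (ltW s0) (ltW sr) (lexx _) h2.
have := maj_add (maj_mul s0 C1 h3) (maj_mul s0 C2 h4).
by have -> : C * (M / (r - s)) + C * (M / (r - s)) = 2 * C / (r - s) * M by ring.
Qed.

(** Lose the radius in n equal steps of length r / (2n): each step costs a
   factor proportional to n / r, and n^n <= 4^n n!. *)
Lemma iter_Xop_bound g r M C n : 0 < r -> maj v1 r C -> maj v2 r C -> maj g r M ->
  maj (iter n Xop g) (r / 2) ((16 * C / r) ^+ n * n`!%:R * M).
Proof.
move=> r0 h1 h2 hg; have C0 := maj_ge0 h1; have M0 := maj_ge0 hg.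
case: n => [|n].
  rewrite expr0 !mul1r; apply: maj_le hg => //; first by rewrite divr_ge0// ltW.
  by case/andP: (half_lt r0) => _ /ltW.
(* n + 1 steps of equal length d lead from r to r / 2 *)
pose d := r / 2 / n.+1%:R; have d0 : 0 < d by rewrite !divr_gt0.
have step m : (m <= n.+1)%N -> maj (iter m Xop g) (r - m%:R * d) ((2 * C / d) ^+ m * M).
  elim: m => [|m IH] mn; first by rewrite mul0r subr0 expr0 mul1r.
  have md : m.+1%:R * d <= r / 2.
    by rewrite /d mulrCA ler_piMr ?divr_ge0 ?(ltW r0)// ler_pdivrMr// mul1r ler_nat.
  have rm : 0 < r - m.+1%:R * d < r - m%:R * d.
    apply/andP; split; last by rewrite -natr1; lra.
    by lra.
  have hle h : maj h r C -> maj h (r - m%:R * d) C.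
    move=> hh; apply: maj_le hh => //.
    - by case/andP: rm => a b; rewrite ltW// (lt_trans a b).
    - by rewrite gerBl mulr_ge0// ltW.
  have := P_Xop rm (hle _ h1) (hle _ h2) (IH (ltnW mn)).
  have -> : r - m%:R * d - (r - m.+1%:R * d) = d by rewrite -natr1; ring.
  by rewrite exprS mulrA.
have := step n.+1 (leqnn _).
have -> : r - n.+1%:R * d = r / 2 by rewrite /d; field; rewrite ?nat1r ?natr1 pnatr_eq0.
apply: maj_le; rewrite ?divr_ge0 ?(ltW r0)// ler_wpM2r//.
have -> : 2 * C / d = (4 * C / r) * n.+1%:R.
  by rewrite /d; field; rewrite ?nat1r ?natr1 pnatr_eq0/= gt_eqF.
have -> : 16 * C / r = (4 * C / r) * 4 by ring.
have b0 : 0 <= 4 * C / r by rewrite divr_ge0 ?(ltW r0)// mulr_ge0.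
move: (4 * C / r) b0 => b b0.
rewrite !exprMn -mulrA; apply: ler_wpM2l; first exact: exprn_ge0.
by rewrite -!natrX -natrM ler_nat expnn_fact.
Qed.

Definition lieT g n p := tau p ^+ n / n`!%:R * iter n Xop g p.

(** Choose the box so small that tau has majorant 1 / (2 Q), where Q is the
   geometric rate of X^n g / n!. *)
Lemma lie_maj g : analytic2 g -> exists r K, 0 < r /\
  (forall n, maj (iter n Xop g) r (K * (n`!%:R * (K ^+ n)))) /\
  forall n, maj (lieT g n) r (2^-1 ^+ n * K).
Proof.
move=> hg; have [ra [ra0 [M1 [M2 [h1 h2]]]]] := an2_maj hv1 hv2.
have [rb rb0 [M3 h3]] := analytic2_maj hg.
pose r := Num.min ra rb; have r0 : 0 < r by rewrite lt_min ra0.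
pose C := M1 + M2 + 1; have M10 := maj_ge0 h1; have M20 := maj_ge0 h2; have M30 := maj_ge0 h3.
have C0 : 0 < C by rewrite /C; lra.
have h1' : maj v1 r C by apply: maj_le h1; [exact: ltW|rewrite ge_min lexx|rewrite /C; lra].
have h2' : maj v2 r C by apply: maj_le h2; [exact: ltW|rewrite ge_min lexx|rewrite /C; lra].
have h3' : maj g r M3 by apply: maj_le h3 => //; [exact: ltW|rewrite ge_min lexx orbT].
pose Q := 16 * C / r; have Q0 : 0 < Q by rewrite divr_gt0// mulr_gt0.
have B n := iter_Xop_bound n r0 h1' h2' h3'; rewrite -/Q in B; clearbody Q.
have e0 : 0 < (2 * Q)^-1 by rewrite invr_gt0 mulr_gt0.
have [r1 r10 hr1] := an_small htau tau0 e0.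
pose t := Num.min r1 (r / 2); have t0 : 0 < t by rewrite lt_min r10 divr_gt0.
pose K := M3 + Q + 1; have K0 : 0 <= K by rewrite /K; lra.
exists t, K; split=> //; split=> n.
  apply: maj_le (B n); [exact: ltW|by rewrite ge_min lexx orbT|].
  rewrite [leRHS](_ : _ = (K ^+ n * n`!%:R) * K); last by ring.
  apply: ler_pM => //.
  - by rewrite mulr_ge0// exprn_ge0// ltW.
  - apply: ler_wpM2r => //; rewrite lerXn2r ?nnegrE// ?(ltW Q0)//; rewrite /K; lra.
  - by rewrite /K; lra.
have T : maj tau t (2 * Q)^-1 by apply: hr1; rewrite (ltW t0) ge_min lexx.
have Bt : maj (iter n Xop g) t (Q ^+ n * n`!%:R * M3).
  by apply: maj_le (B n) => //; [exact: ltW|rewrite ge_min lexx orbT].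
have := maj_mul t0 (maj_scale (n`!%:R^-1) (maj_exp n t0 T)) Bt.
move=> H; apply: maj_ext (maj_le (ltW t0) (lexx _) _ H).
  by move=> p _; rewrite /lieT mulrAC mulrC; ring.
have n0 : (n`!%:R : R) != 0 by rewrite pnatr_eq0 -lt0n fact_gt0.
rewrite normfV normr_nat.
rewrite [leLHS](_ : _ = ((2 * Q)^-1 * Q) ^+ n * M3); last first.
  rewrite exprMn; move: ((2 * Q)^-1 ^+ n) (Q ^+ n) (n`!%:R : R) n0 => z y x x0.
  by field.
have -> : (2 * Q)^-1 * Q = 2^-1 by field; rewrite gt_eqF.
by rewrite ler_wpM2l ?exprn_ge0 ?invr_ge0//; rewrite /K; lra.
Qed.

(** The Lie series sum tau^n X^n g / n!.  For constant tau it is g composed with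
   the flow of X at time tau; since tau is a function, it is g composed with p
   |-> (flow of X at time tau(p)) (p). *)
Definition Eflow g p : R := limn (fun N => \sum_(n < N) lieT g n p).

Lemma Eflow_maj g : analytic2 g -> exists r K, [/\ 0 < r,
  forall n, maj (iter n Xop g) r (K * (n`!%:R * K ^+ n)),
  forall n, maj (lieT g n) r (2^-1 ^+ n * K),
  forall N, \sum_(n < N) 2^-1 ^+ n * K <= 2 * K &
  maj (Eflow g) r (2 * K) /\
  forall p, inbox r p -> \sum_(n < N) lieT g n p @[N --> \oo] --> Eflow g p].
Proof.
move=> /lie_maj[r [K [r0 [h1 h2]]]].
have K0 : 0 <= K by have := maj_ge0 (h2 0%N); rewrite expr0 mul1r.
have geo N : \sum_(n < N) 2^-1 ^+ n * K <= 2 * K.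
  by rewrite -mulr_suml ler_wpM2r//; exact: sum_half_le2.
have [F hF c] := maj_series1_ex r0 h2 geo.
have FE p : inbox r p -> Eflow g p = F p by move=> hp; apply/cvg_lim => //; exact: c.
exists r, K; split=> //; split.
  by apply: maj_ext hF => p /FE.
by move=> p hp; rewrite FE//; exact: c.
Qed.

Lemma an_Eflow g : analytic2 g -> analytic2 (Eflow g).
Proof. by move=> /Eflow_maj[r [K [r0 _ _ _ [h _]]]]; exact: maj_analytic2 h. Qed.

Lemma Eflow0 g : Eflow g 0 = g 0.
Proof.
apply/cvg_lim => //; rewrite -cvg_shiftS/= (_ : (fun n => _) = fun=> g 0); first exact: cvg_cst.
apply/funext => N; rewrite big_ord_recl/= /lieT expr0 fact0 invr1 !mul1r big1 ?addr0// => i _.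
by rewrite tau0 exprS !mul0r.
Qed.

(** As tau and X vanish at 0, the terms with n >= 1 do not contribute to the
   first order. *)
Lemma Eflow_grad0 g : analytic2 g -> grad (Eflow g) (0 : R * R) (dX g 0) (dY g 0).
Proof.
move=> hg; have [r [K [r0 h1 h2 geo [h3 h4]]]] := Eflow_maj hg.
have hE := an_diff0 (an_Eflow hg).
have [c1 c2] := maj_series1_der (half_lt r0) h2 geo h4 (inbox0 (ltW (divr_gt0 r0 (ltr0Sn R 1)))).
have gtau := gradE (an_diff0 htau).
have gI n : grad (lieT g n) (0 : R * R) (if n is 0%N then dX g 0 else 0) (if n is 0%N then dY g 0 else 0).
  have di : differentiable (iter n Xop g) (0 : R * R).
    by apply: (maj_diff (h1 n)); split; rewrite normr0.
  have G := gradM (gradM (gradX n gtau) (grad_cst (n`!%:R^-1) _)) (gradE di).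
  apply: grad_eq G _ _; case: n di => [|[|n]] di; rewrite ?tau0 /= ?expr0 ?exprS ?fact0 ?factS.
  - by rewrite invr1; ring.
  - by rewrite /Xop v10 v20; ring.
  - by ring.
  - by rewrite invr1; ring.
  - by rewrite /Xop v10 v20; ring.
  - by ring.
split=> //.
  apply: (cvg_unique _ c1) => //=; rewrite -cvg_shiftS/= (_ : (fun n => _) = fun=> dX g 0); first exact: cvg_cst.
  apply/funext => N; rewrite big_ord_recl/=; have [_ -> _] := gI 0%N; rewrite big1 ?addr0// => i _.
  by have [_ -> _] := gI (lift ord0 i).
apply: (cvg_unique _ c2) => //=; rewrite -cvg_shiftS/= (_ : (fun n => _) = fun=> dY g 0); first exact: cvg_cst.
apply/funext => N; rewrite big_ord_recl/=; have [_ _ ->] := gI 0%N; rewrite big1 ?addr0// => i _.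
by have [_ _ ->] := gI (lift ord0 i).
Qed.

Lemma Eflow_ext g h : analytic2 g -> analytic2 h -> (\forall p \near (0 : R * R), g p = h p) ->
  \forall p \near (0 : R * R), Eflow g p = Eflow h p.
Proof.
move=> hg hh /near0P[r r0 E]; apply: (near_obox r0) => p hp.
suff I n : forall q, obox r q -> iter n Xop g q = iter n Xop h q.
  by rewrite /Eflow; congr (limn _); apply/funext => N; apply: eq_bigr => i _; rewrite /lieT I.
elim: n => [|n IH] q hq; first by apply: E; case: hq => /ltW ? /ltW.
by apply: Xop_ext; have := obox_near hq; apply: filterS => q'; exact: IH.
Qed.

(** Only the term n = 0 remains. *)
Lemma Eflow_inv g : analytic2 g -> (\forall p \near (0 : R * R), Xop g p = 0) ->
  \forall p \near (0 : R * R), Eflow g p = g p.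
Proof.
move=> hg /near0P[r r0 E]; apply: (near_obox r0) => p hp.
have I n : forall q, obox r q -> iter n Xop (Xop g) q = 0.
  elim: n => [|n IH] q hq; first by apply: E; case: hq => /ltW ? /ltW.
  rewrite iterS (@Xop_ext _ (fun=> 0)).
    by rewrite (XopE (grad_cst 0 q)) !mulr0 addr0.
  by have := obox_near hq; apply: filterS => q'; exact: IH.
apply/cvg_lim => //; rewrite -cvg_shiftS/= (_ : (fun n => _) = fun=> g p); first exact: cvg_cst.
apply/funext => N; rewrite big_ord_recl/= /lieT expr0 fact0 invr1 !mul1r big1 ?addr0// => i _.
by rewrite iterSr I// mulr0.
Qed.

Lemma EflowD g h : analytic2 g -> analytic2 h ->
  \forall p \near (0 : R * R), Eflow (fun q => g q + h q) p = Eflow g p + Eflow h p.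
Proof.
move=> hg hh; have [ra [K [ra0 g1 _ _ [_ g4]]]] := Eflow_maj hg.
have [rb [L [rb0 k1 _ _ [_ k4]]]] := Eflow_maj hh.
pose r := Num.min ra rb; have r0 : 0 < r by rewrite lt_min ra0.
have oa q : obox r q -> obox ra q by move=> []; rewrite !lt_min => /andP[? _] /andP[? _].
have ob q : obox r q -> obox rb q by move=> []; rewrite !lt_min => /andP[_ ?] /andP[_ ?].
apply: (near_obox r0) => p hp.
have I n : forall q, obox r q -> iter n Xop (fun q => g q + h q) q = iter n Xop g q + iter n Xop h q.
  elim: n => [//|n IH] q hq; rewrite iterS.
  rewrite (@Xop_ext _ (fun q => iter n Xop g q + iter n Xop h q)); last first.
    by have := obox_near hq; apply: filterS => q'; exact: IH.
  have dg := gradE (maj_diff (g1 n) (oa _ hq)); have dh := gradE (maj_diff (k1 n) (ob _ hq)).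
  by rewrite (XopE (gradD dg dh)) !iterS /Xop; ring.
have c1 := g4 p _; have c2 := k4 p _.
apply/cvg_lim => //.
rewrite (_ : (fun N => _) = fun N => \sum_(n < N) lieT g n p + \sum_(n < N) lieT h n p); last first.
  by apply/funext => N; rewrite -big_split; apply: eq_bigr => i _; rewrite /lieT I// mulrDr.
by apply: cvgD; [apply: c1; case: (oa _ hp)|apply: c2; case: (ob _ hp)] => /ltW ? /ltW.
Qed.

(** The divided iterate X^n g / n!, for which the Leibniz rule has no binomial
   coefficients. *)
Definition Dn g n p := (n`!%:R)^-1 * iter n Xop g p.

Lemma Dn_grad g r (K : nat -> R) n p : (forall n, maj (iter n Xop g) r (K n)) -> obox r p ->
  exists a b, grad (Dn g n) p a b /\ v1 p * a + v2 p * b = n.+1%:R * Dn g n.+1 p.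
Proof.
move=> h hp; have n0 : (n`!%:R : R) != 0 by rewrite pnatr_eq0 -lt0n fact_gt0.
have S0 : (n.+1%:R : R) != 0 by rewrite pnatr_eq0.
have gg := gradM (grad_cst (n`!%:R^-1) p) (gradE (maj_diff (h n) hp)).
eexists; eexists; split; first exact: gg.
rewrite /Dn iterS factS natrM invfM -mulrA mulVKf//.
by rewrite /Xop; ring.
Qed.

Lemma leibniz g h r (K L : nat -> R) : (forall n, maj (iter n Xop g) r (K n)) ->
  (forall n, maj (iter n Xop h) r (L n)) -> forall n p, obox r p ->
  Dn (fun q => g q * h q) n p = \sum_(i < n.+1) Dn g i p * Dn h (n - i)%N p.
Proof.
move=> hg hh.
have S0 n : (n.+1%:R : R) != 0 by rewrite pnatr_eq0.
elim=> [|n IH] p hp.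
  by rewrite big_ord_recl big_ord0 addr0 /Dn /= fact0 invr1 !mul1r.
have n0 m : (m`!%:R : R) != 0 by rewrite pnatr_eq0 -lt0n fact_gt0.
have E0 : forall q, obox r q -> iter n Xop (fun q => g q * h q) q =
    n`!%:R * \sum_(i < n.+1) Dn g i q * Dn h (n - i)%N q.
  by move=> q /IH <-; rewrite /Dn mulVKf.
have /choice[ag hag] : forall i : nat, exists ab : R * R, grad (Dn g i) p ab.1 ab.2 /\
    v1 p * ab.1 + v2 p * ab.2 = i.+1%:R * Dn g i.+1 p.
  by move=> i; have [a [b H]] := Dn_grad i hg hp; exists (a, b).
have /choice[ah hah] : forall i : nat, exists ab : R * R, grad (Dn h i) p ab.1 ab.2 /\
    v1 p * ab.1 + v2 p * ab.2 = i.+1%:R * Dn h i.+1 p.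
  by move=> i; have [a [b H]] := Dn_grad i hh hp; exists (a, b).
have G := gradM (grad_cst (n`!%:R) p)
  (grad_sum (index_enum 'I_n.+1) (fun i : 'I_n.+1 => gradM (hag i).1 (hah (n - i)%N).1)).
have X1 : iter n.+1 Xop (fun q => g q * h q) p =
   n`!%:R * \sum_(i < n.+1) (i.+1%:R * Dn g i.+1 p * Dn h (n - i)%N p
      + Dn g i p * ((n - i).+1%:R * Dn h (n - i).+1 p)).
  rewrite iterS (@Xop_ext _ (fun q => n`!%:R * \sum_(i < n.+1) Dn g i q * Dn h (n - i)%N q)); last first.
    by have := obox_near hp; apply: filterS => q'; exact: E0.
  rewrite (XopE G) !mulr0 !addr0 2!(mulrCA _ n`!%:R) -mulrDr; congr (_ * _).
  rewrite !mulr_sumr -big_split; apply: eq_bigr => i _ /=.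
  by rewrite -(hag i).2 -(hah (n - i)%N).2; ring.
rewrite {1}/Dn X1 factS natrM invfM -mulrA mulKf//.
apply: (mulfI (S0 n)); rewrite mulVKf//.
rewrite big_split/= mulr_sumr.
pose T i := Dn g i p * Dn h (n.+1 - i)%N p.
have -> : \sum_(i < n.+1) i.+1%:R * Dn g i.+1 p * Dn h (n - i)%N p = \sum_(i < n.+2) i%:R * T i.
  rewrite [RHS]big_ord_recl mul0r add0r; apply: eq_bigr => i _.
  by rewrite /T /= /bump/= add1n subSS mulrA.
have -> : \sum_(i < n.+1) Dn g i p * ((n - i).+1%:R * Dn h (n - i).+1 p) = \sum_(i < n.+2) (n.+1 - i)%:R * T i.
  rewrite [RHS]big_ord_recr/= subnn mul0r addr0; apply: eq_bigr => i _.
  by rewrite /T /= subSn ?leq_ord// mulrCA.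
rewrite -big_split; apply: eq_bigr => i _ /=.
by rewrite -mulrDl -natrD subnKC ?leq_ord.
Qed.

Lemma cauchy_product (a b : nat -> R) (A B K L : R) :
  (forall N, \sum_(n < N) `|a n| <= K) -> (forall N, \sum_(n < N) `|b n| <= L) ->
  (\sum_(n < N) a n @[N --> \oo] --> A) -> (\sum_(n < N) b n @[N --> \oo] --> B) ->
  \sum_(n < N) \sum_(i < n.+1) a i * b (n - i)%N @[N --> \oo] --> A * B.
Proof.
move=> hK hL hA hB.
have E N : \sum_(n < N) \sum_(i < n.+1) a i * b (n - i)%N =
    \sum_(i < N) a i * \sum_(j < (N - i)%N) b j.
  elim: N => [|N IH]; first by rewrite !big_ord0.
  rewrite big_ord_recr/= IH [RHS]big_ord_recr/=.
  have -> : \sum_(j < (N.+1 - N)%N) b j = b 0%N by rewrite subSnn big_ord1.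
  rewrite [X in _ + X = _]big_ord_recr/= subnn addrA -big_split/=; congr (_ + _).
  apply: eq_bigr => i _; rewrite subSn ?(ltnW (ltn_ord i))// big_ord_recr/= mulrDr.
  by [].
have bL m : `|\sum_(j < m) b j| <= L by apply: le_trans (ler_norm_sum _ _ _) (hL m).
have L0 : 0 <= L by apply: le_trans (bL 0%N).
pose u i (N : nat) : R := if (i < N)%N then a i * \sum_(j < (N - i)%N) b j else 0.
have cu i : u i @ \oo --> a i * B.
  rewrite -(cvg_shiftn i.+1)/= (_ : (fun n => _) = fun n => a i * \sum_(j < n.+1) b j).
    by apply: cvgMr; rewrite (@cvg_shiftS _ (fun n => \sum_(j < n) b j)).
  apply/funext => n; rewrite /u ifT; last by lia.
  by have -> : (n + i.+1 - i = n.+1)%N by lia.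
rewrite (funext E).
refine (@tannery R (fun i j N => column0 (fun i => u i N) i j) (column0 (fun i => a i * B))
   (column0 (fun i => `|a i| * L)) (K * L) (fun N => \sum_(i < N) a i * \sum_(j < (N - i)%N) b j) (A * B) _ _ _ _ _).
- move=> i j N; rewrite /column0; case: ifP => _; last by rewrite normr0.
  rewrite /u; case: ifP => _; last by rewrite normr0 mulr_ge0.
  by rewrite normrM ler_wpM2l.
- apply: absum_col0 => [i|N]; first by rewrite mulr_ge0.
  by rewrite -mulr_suml ler_wpM2r.
- move=> i j; rewrite /column0; case: ifP => _; [exact: cu|exact: cvg_cst].
- move=> N; apply/(cvg_col0 (fun i => u i N)).
  rewrite -(cvg_shiftn N)/= (_ : (fun n => _) = fun=> \sum_(i < N) a i * \sum_(j < (N - i)%N) b j).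
    exact: cvg_cst.
  apply/funext => n; rewrite addnC big_split_ord/= [X in _ + X]big1 ?addr0.
    by apply: eq_bigr => i _; rewrite /u ltn_ord.
  by move=> i _; rewrite /u ifF//; lia.
apply/(cvg_col0 (fun i => a i * B)); under eq_fun do rewrite -mulr_suml.
by apply: cvgMl.
Qed.

Lemma maj_bound_sum g r K p : (forall n, maj (lieT g n) r (2^-1 ^+ n * K)) ->
  (forall N, \sum_(n < N) 2^-1 ^+ n * K <= 2 * K) -> inbox r p ->
  forall N, \sum_(n < N) `|lieT g n p| <= 2 * K.
Proof.
move=> h geo hp N; apply: le_trans (geo N); apply: ler_sum => n _.
exact: maj_bound (h n) hp.
Qed.

(** The Leibniz rule and the Cauchy product; this makes Eflow a ring
   homomorphism, that is, a substitution. *)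
Lemma EflowM g h : analytic2 g -> analytic2 h ->
  \forall p \near (0 : R * R), Eflow (fun q => g q * h q) p = Eflow g p * Eflow h p.
Proof.
move=> hg hh; have [ra [K [ra0 g1 g2 g3 [_ g4]]]] := Eflow_maj hg.
have [rb [L [rb0 k1 k2 k3 [_ k4]]]] := Eflow_maj hh.
pose r := Num.min ra rb; have r0 : 0 < r by rewrite lt_min ra0.
have oa q : obox r q -> obox ra q by move=> []; rewrite !lt_min => /andP[? _] /andP[? _].
have ob q : obox r q -> obox rb q by move=> []; rewrite !lt_min => /andP[_ ?] /andP[_ ?].
have la n : maj (iter n Xop g) r (K * (n`!%:R * K ^+ n)).
  by apply: maj_le (g1 n) => //; [exact: ltW|rewrite ge_min lexx].
have lb n : maj (iter n Xop h) r (L * (n`!%:R * L ^+ n)).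
  by apply: maj_le (k1 n) => //; [exact: ltW|rewrite ge_min lexx orbT].
apply: (near_obox r0) => p hp.
have hpa : inbox ra p by case: (oa _ hp) => /ltW ? /ltW.
have hpb : inbox rb p by case: (ob _ hp) => /ltW ? /ltW.
have lE g' n : lieT g' n p = tau p ^+ n * Dn g' n p by rewrite /lieT /Dn mulrA.
apply/cvg_lim => //.
rewrite (_ : (fun N => _) = fun N => \sum_(n < N) \sum_(i < n.+1) lieT g i p * lieT h (n - i)%N p).
  apply: (@cauchy_product (fun n => lieT g n p) (fun n => lieT h n p) (Eflow g p) (Eflow h p) (2 * K) (2 * L)).
  - exact: maj_bound_sum g2 g3 hpa.
  - exact: maj_bound_sum k2 k3 hpb.
  - exact: g4.
  - exact: k4.
apply/funext => N; apply: eq_bigr => n _; rewrite lE (leibniz la lb)// mulr_sumr.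
apply: eq_bigr => i _; rewrite !lE [RHS]mulrACA -exprD subnKC ?leq_ord//.
Qed.

(** Termwise, X (tau^n X^n g / n!) = (X tau) tau^(n-1) X^n g / (n-1)! + tau^n
   X^(n+1) g / n!. *)
Lemma Eflow_Xop g : analytic2 g ->
  \forall p \near (0 : R * R), Xop (Eflow g) p = (1 + Xop tau p) * Eflow (Xop g) p.
Proof.
move=> hg; have [ra [K [ra0 g1 g2 g3 [_ g4]]]] := Eflow_maj hg.
have [rb [L [rb0 k1 k2 k3 [_ k4]]]] := Eflow_maj (an_Xop hg).
have [rc rc0 [M htc]] := analytic2_maj htau.
pose r := Num.min (Num.min ra rb) rc; have r0 : 0 < r by rewrite !lt_min ra0 rb0.
have oall q : obox r q -> [/\ obox ra q, obox rb q & obox rc q].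
  by move=> []; rewrite !lt_min => /andP[/andP[? ?] ?] /andP[/andP[? ?] ?].
apply: (near_obox r0) => p /oall[pa pb pc].
have [s sr hp] := obox_in pa.
have hpb : inbox rb p by case: pb => /ltW ? /ltW.
have [c1 c2] := maj_series1_der sr g2 g3 g4 hp.
have lim1 : (\sum_(n < N) Xop (lieT g n) p) @[N --> \oo] --> Xop (Eflow g) p.
  rewrite (_ : (fun N => _) = fun N => v1 p * \sum_(n < N) dX (lieT g n) p + v2 p * \sum_(n < N) dY (lieT g n) p).
    by apply: cvgD; apply: cvgMr; [exact: c1|exact: c2].
  by apply/funext => N; rewrite !mulr_sumr -big_split.
have XT n : Xop (lieT g n) p = (if n is m.+1 then Xop tau p * lieT (Xop g) m p else 0) + lieT (Xop g) n p.
  have gtau := gradE (maj_diff htc pc).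
  have dI := gradE (maj_diff (g1 n) pa).
  rewrite (XopE (gradM (gradM (gradX n gtau) (grad_cst (n`!%:R^-1) p)) dI)).
  rewrite /lieT -iterSr iterS; case: n dI => [|n] dI.
    by rewrite /= fact0 invr1 /Xop; ring.
  rewrite -!iterSr !iterS /Xop/= factS natrM.
  have n0 : (n`!%:R : R) != 0 by rewrite pnatr_eq0 -lt0n fact_gt0.
  have S0 : (n.+1%:R : R) != 0 by rewrite pnatr_eq0.
  rewrite exprS invfM; move: (n.+1%:R : R) S0 => m m0; field.
  by rewrite m0 n0.
have lim2 : (\sum_(n < N) Xop (lieT g n) p) @[N --> \oo] --> (1 + Xop tau p) * Eflow (Xop g) p.
  have c4 := k4 p hpb.
  rewrite -cvg_shiftS/= (_ : (fun N => _) = fun N => Xop tau p * \sum_(n < N) lieT (Xop g) n p + \sum_(n < N.+1) lieT (Xop g) n p).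
    rewrite mulrDl mul1r addrC; apply: cvgD; first exact: cvgMr.
    by rewrite (@cvg_shiftS _ (fun N => \sum_(n < N) lieT (Xop g) n p)).
  apply/funext => N; under eq_bigr do rewrite XT.
  by rewrite big_split/=; congr (_ + _); rewrite big_ord_recl add0r mulr_sumr.
exact: (cvg_unique _ lim1 lim2).
Qed.

End Flow.

(** * Removing a derivative along the fibres *)

Section Moser.
Variable R : realType.
Variables (k : nat) (s : bool).
Hypothesis k2 : (2 <= k)%N.
Implicit Types (F G u v w g h A B : R * R -> R) (p q : R * R) (r M : R).

Local Notation sg := ((-1) ^+ s : R).
Local Notation f := (@nfH R k s).
Local Notation X0 := (@X0 R k s).

Lemma near0W (Q : R * R -> Prop) : (forall p, Q p) -> \forall p \near (0 : R * R), Q p.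
Proof. by move=> h; apply/near0P; exists 1. Qed.

(** The densities sum_(i <= k-2) x^i c_i(f) that represent all densities modulo
   X0. *)
Definition nform (c : nat -> R -> R) p := \sum_(i < k.-1) p.1 ^+ i * c i (f p).

Lemma an_nform (c : nat -> R -> R) : (forall i, analytic1 (c i)) -> analytic2 (nform c).
Proof.
move=> hc; apply: an_sum => i _; apply: an_mul; first by apply: an_exp; exact: an_fst.
exact: (an1_comp2 (hc i) (an_f R k s) (f0 R s k2)).
Qed.

Lemma X0_f_comp (c : R -> R) : analytic1 c -> \forall p \near (0 : R * R), X0 (fun q => c (f q)) p = 0.
Proof.
move=> hc; have := an1_grad2 hc (an_f R k s) (f0 R s k2).
by apply: filterS => p /(_ _ _ (grad_f k s p)) g; rewrite (X0E k s g); ring.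
Qed.

(** Take psi = (Eflow x, Eflow xi) for the field X = X0 / N.  A germ g is good
   if Eflow g = g o psi; good germs form a ring containing x, xi, f and the
   functions of f.  The relation X (Eflow x) = (1 + X tau) Eflow (X x) gives the
   identity of densities after multiplication by xi o psi, which is then
   cancelled. *)
Lemma moser0 (c : nat -> R -> R) tau w : (forall i, analytic1 (c i)) -> analytic2 tau -> analytic2 w ->
  tau 0 = 0 -> nform c 0 != 0 -> (\forall p \near (0 : R * R), w p = nform c p + X0 tau p) ->
  exists psi, [/\ diffeo_germ psi, \forall p \near (0 : R * R), f (psi p) = f p &
    \forall p \near (0 : R * R), w p = nform c (psi p) * jac psi p].
Proof.
move=> hc htau hw tau0 N0 E.
have hN := an_nform hc; set N := nform c in hN N0 E *.
have hNi := an_inv hN N0; have Nn0 := an_neq0 hN N0.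
(* the components of the field X0 / N *)
pose v1 p := (N p)^-1 * (2 * p.2).
pose v2 p := (N p)^-1 * (- (sg * k%:R) * p.1 ^+ k.-1).
have hv1 : analytic2 v1 by apply: an_mul => //; apply: an_mul; [exact: an_cst|exact: an_snd].
have hv2 : analytic2 v2.
  by apply: an_mul => //; apply: an_mul; [exact: an_cst|apply: an_exp; exact: an_fst].
have v10 : v1 0 = 0 by rewrite /v1/= !mulr0.
have v20 : v2 0 = 0 by rewrite /v2/= expr0n; case: k k2 => [|[|k']] //= _; rewrite !mulr0.
have XN g p : Xop v1 v2 g p = (N p)^-1 * X0 g p by rewrite /Xop /v1 /v2 /X0; ring.
pose E_ := Eflow v1 v2 tau.
have hE g : analytic2 g -> analytic2 (E_ g) by exact: an_Eflow.
pose U := E_ (fun p => p.1); pose V := E_ (fun p => p.2).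
have hU : analytic2 U by exact: hE (an_fst R). have hV : analytic2 V by exact: hE (an_snd R).
pose psi p := (U p, V p).
have hpsi : analytic_map psi by split.
have psi0 : psi 0 = 0 by rewrite /psi /U /V /E_ !Eflow0.
have dpsi : diffeo_germ psi.
  apply: diffeo_idlin => //; split.
  - have := Eflow_grad0 hv1 hv2 htau v10 v20 tau0 (an_fst R).
    by have [_ -> ->] := grad_fst (0 : R * R).
  - have := Eflow_grad0 hv1 hv2 htau v10 v20 tau0 (an_snd R).
    by have [_ -> ->] := grad_snd (0 : R * R).
  - by rewrite /psi/= /U /E_ Eflow0.
  - by rewrite /psi/= /V /E_ Eflow0.
pose good g := analytic2 g /\ \forall p \near (0 : R * R), E_ g p = g (psi p).
have good_ext g h : (forall p, g p = h p) -> good g -> good h by move=> /funext ->.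
have good_inv g : analytic2 g -> (\forall p \near (0 : R * R), X0 g p = 0) ->
    \forall p \near (0 : R * R), E_ g p = g p.
  move=> hg hx; apply: Eflow_inv => //; move: hx; apply: filterS => p hp.
  by rewrite XN hp mulr0.
have good_cst a : good (fun=> a).
  split; first exact: an_cst.
  apply: good_inv; first exact: an_cst.
  by apply: near0W => p; rewrite (X0E k s (grad_cst a p)) !mulr0 subrr.
have good_fst : good (fun p => p.1) by split; [exact: an_fst|apply: near0W => p].
have good_snd : good (fun p => p.2) by split; [exact: an_snd|apply: near0W => p].
have goodM g h : good g -> good h -> good (fun p => g p * h p).
  move=> [hg Eg] [hh Eh]; split; first exact: an_mul.
  have EM := EflowM hv1 hv2 htau tau0 hg hh.
  near=> p.
  have -> : E_ (fun p => g p * h p) p = E_ g p * E_ h p by near: p.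
  have -> : E_ g p = g (psi p) by near: p.
  by have -> : E_ h p = h (psi p) by near: p.
have goodD g h : good g -> good h -> good (fun p => g p + h p).
  move=> [hg Eg] [hh Eh]; split; first exact: an_add.
  have EM := EflowD hv1 hv2 htau tau0 hg hh.
  near=> p.
  have -> : E_ (fun p => g p + h p) p = E_ g p + E_ h p by near: p.
  have -> : E_ g p = g (psi p) by near: p.
  by have -> : E_ h p = h (psi p) by near: p.
have goodX g n : good g -> good (fun p => g p ^+ n).
  move=> gg; elim: n => [|n IH]; first by apply: good_ext (good_cst 1) => p; rewrite expr0.
  by apply: good_ext (goodM _ _ gg IH) => p; rewrite exprS.
have gf : good f.
  apply: goodD; first exact: goodX.
  by apply: goodM => //; exact: goodX.
have Xf p : X0 f p = 0 by rewrite (X0E k s (grad_f k s p)); ring.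
have fpsi : \forall p \near (0 : R * R), f (psi p) = f p.
  have [_ h1] := gf; have h2 : \forall p \near (0 : R * R), E_ f p = f p.
    by apply: good_inv; [exact: an_f|apply: near0W => p; exact: Xf].
  by move: h2 h1; apply: filterS2 => p -> ->.
have gN : good N.
  suff H m : good (fun p => \sum_(i < m) p.1 ^+ i * c i (f p)) by exact: H.
  elim: m => [|m IH].
    by apply: good_ext (good_cst 0) => p; rewrite big_ord0.
  apply: good_ext (goodD _ _ IH (_ : good (fun p => p.1 ^+ m * c m (f p)))).
    by move=> p; rewrite big_ord_recr.
  apply: goodM; first exact: goodX.
  have hcf := an1_comp2 (hc m) (an_f R k s) (f0 R s k2).
  split=> //; have := good_inv _ hcf (X0_f_comp (hc m)); move: fpsi.
  by apply: filterS2 => p -> ->.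
exists psi; split=> //.
have [phi [dphi phipsi psiphi]] := diffeo_inv dpsi.
have [hphi phi0] := diffeo_an dphi.
pose D p := nform c (psi p) * jac psi p - w p.
have hD : analytic2 D.
  apply: an_sub => //; apply: an_mul; last exact: an_jac.
  exact: an_pull hN hpsi psi0.
have VD : \forall p \near (0 : R * R), V p * D p = 0.
  have XU := Eflow_Xop hv1 hv2 htau tau0 (an_fst R).
  have Xx p : Xop v1 v2 (fun p => p.1) p = v1 p by rewrite (XopE v1 v2 (grad_fst p)); ring.
  have {}XU : \forall p \near (0 : R * R), Xop v1 v2 U p = (1 + Xop v1 v2 tau p) * E_ v1 p.
    by move: XU; rewrite -/U (funext Xx).
  have Nv1 := EflowM hv1 hv2 htau tau0 hN hv1.
  have Nv1' : \forall p \near (0 : R * R), N p * v1 p = 2 * p.2.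
    by move: Nn0; apply: filterS => p hp; rewrite /v1 mulVKf.
  have h2y : analytic2 (fun p : R * R => 2 * p.2) by apply: an_mul; [exact: an_cst|exact: an_snd].
  have Ev1 := Eflow_ext v1 v2 tau (an_mul hN hv1) h2y Nv1'.
  have [_ E2V] := goodM _ _ (good_cst 2) good_snd.
  have [_ EN] := gN.
  have gU := an_grad hU; have gV := an_grad hV.
  have fpsi' := near_join fpsi.
  near=> p.
  have e1 : Xop v1 v2 U p = (1 + Xop v1 v2 tau p) * E_ v1 p by near: p.
  have e2 : E_ (fun q => N q * v1 q) p = E_ N p * E_ v1 p by near: p.
  have e3 : E_ (fun q => N q * v1 q) p = E_ (fun q => 2 * q.2) p by near: p.
  have e4 : E_ (fun q => 2 * q.2) p = 2 * V p by near: p.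
  have e5 : E_ N p = N (psi p) by near: p.
  have e6 : w p = N p + X0 tau p by near: p.
  have n0 : N p != 0 by near: p.
  have g1 : grad U p (dX U p) (dY U p) by near: p.
  have g2 : grad V p (dX V p) (dY V p) by near: p.
  have e7 : \forall q \near p, f (psi q) = f q by near: p.
  have g3 := grad_comp (grad_f k s (U p, V p)) g1 g2.
  have [e8 e9] := grad_unique (grad_ext e7 g3) (grad_f k s p).
  have X0U : X0 U p = 2 * V p * jac psi p.
    rewrite (X0E k s g1) jacE.
    have -> : sg * k%:R * p.1 ^+ k.-1 * dY U p = dY U p * (sg * (k%:R * p.1 ^+ k.-1)) by ring.
    by rewrite -e8 (mulrC (2 * p.2)) -e9 /=; ring.
  have X0U' : X0 U p = N p * Xop v1 v2 U p by rewrite XN mulVKf.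
  have X0t : N p * (1 + Xop v1 v2 tau p) = w p by rewrite e6 XN mulrDr mulr1 mulVKf.
  have NV : N (psi p) * E_ v1 p = 2 * V p by rewrite -e5 -e2 e3 e4.
  have : 2 * (V p * D p) = 0.
    rewrite /D -/N.
    transitivity (N (psi p) * (2 * V p * jac psi p) - w p * (2 * V p)); first by ring.
    by rewrite -X0U X0U' e1 -X0t -NV; ring.
  by move/eqP; rewrite mulf_eq0 pnatr_eq0/= => /eqP.
have Dphi : \forall p \near (0 : R * R), D (phi p) = 0.
  apply: (an_eq_quadrant (an_pull hD hphi phi0) (an_cst 0)).
  have := near_pull VD hphi phi0; move: psiphi; apply: filterS2 => p e1 e2 _ p2.
  move/eqP: e2; rewrite mulf_eq0 => /orP[|/eqP//].
  have -> : V (phi p) = p.2 by rewrite -[in RHS]e1.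
  by rewrite gt_eqF.
have := near_pull Dphi hpsi psi0; move: phipsi; apply: filterS2 => p -> /eqP.
by rewrite subr_eq0 => /eqP.
Unshelve. all: by end_near. Qed.

(** Reduction to tau(0) = 0: X0 tau does not change when a constant is
   subtracted. *)
Lemma moser (c : nat -> R -> R) tau w : (forall i, analytic1 (c i)) -> analytic2 tau -> analytic2 w ->
  nform c 0 != 0 -> (\forall p \near (0 : R * R), w p = nform c p + X0 tau p) ->
  exists psi, [/\ diffeo_germ psi, \forall p \near (0 : R * R), f (psi p) = f p &
    \forall p \near (0 : R * R), w p = nform c (psi p) * jac psi p].
Proof.
move=> hc htau hw N0 E; apply: (@moser0 c (fun p => tau p - tau 0)) => //.
- by apply: an_sub => //; exact: an_cst.
- by rewrite subrr.
have := an_grad htau; move: E; apply: filterS2 => p -> g; congr (_ + _).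
by rewrite (X0E k s (gradB g (grad_cst (tau 0) p))) /X0 !subr0.
Qed.

End Moser.

(** * Strict equivalence and existence of the normal form *)

Section Existence.
Variable R : realType.
Variables (k : nat) (s : bool).
Hypothesis k2 : (2 <= k)%N.
Implicit Types (F G u v w A B : R * R -> R) (p q : R * R) (r M : R) (g h : R -> R).

Local Notation sg := ((-1) ^+ s : R).
Local Notation f := (@nfH R k s).
Local Notation X0 := (@X0 R k s).
Local Notation nform := (@nform R k s).

Definition inverse_germs g h := [/\ analytic1 g, analytic1 h, g 0 = 0, h 0 = 0 &
  (\forall t \near (0 : R), h (g t) = t) /\ (\forall t \near (0 : R), g (h t) = t)].

Lemma inverse_germs_sym g h : inverse_germs g h -> inverse_germs h g.
Proof. by move=> [? ? ? ? [? ?]]. Qed.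

Lemma near1_comp (Q : R -> Prop) g : (\forall t \near (0 : R), Q t) -> analytic1 g -> g 0 = 0 ->
  \forall t \near (0 : R), Q (g t).
Proof.
move=> hQ /an1P hg g0; have := near_along hQ hg g0; by move/near_xaxis.
Qed.

Lemma inverse_germs_comp g h g' h' : inverse_germs g h -> inverse_germs g' h' ->
  inverse_germs (fun t => g' (g t)) (fun t => h (h' t)).
Proof.
move=> [g1 h1 g0 h0 [e1 e2]] [g1' h1' g0' h0' [e1' e2']]; split.
- exact: an1_comp.
- exact: an1_comp.
- by rewrite g0.
- by rewrite h0'.
split.
  have := near1_comp e1' g1 g0; move: e1; apply: filterS2 => t E1 E2; by rewrite E2.
have := near1_comp e2 h1' h0'; move: e2'; apply: filterS2 => t E1 E2; by rewrite E2.
Qed.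

Lemma near1W (Q : R -> Prop) : (forall t, Q t) -> \forall t \near (0 : R), Q t.
Proof. by move=> h; apply/near1P; exists 1. Qed.

Lemma inverse_germs_id : inverse_germs (fun t => t) (fun t => t).
Proof. by split=> //; [exact: an1_id|exact: an1_id|split; exact: near1W]. Qed.

(** Fibration-preserving equivalence of the densities w0 and w1 over the fixed
   function f: the reparametrisation g of the values of f is allowed, with its
   inverse h as a witness. *)
Definition streq w0 w1 := exists psi g h, [/\ diffeo_germ psi, inverse_germs g h,
  \forall p \near (0 : R * R), f (psi p) = g (f p) &
  \forall p \near (0 : R * R), w0 p = w1 (psi p) * jac psi p].

Lemma near_f (Q : R -> Prop) : (\forall t \near (0 : R), Q t) -> \forall p \near (0 : R * R), Q (f p).
Proof. by move=> hQ; exact: near_along hQ (an_f R k s) (f0 R s k2). Qed.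

Lemma streq_sym w0 w1 : streq w0 w1 -> streq w1 w0.
Proof.
move=> [psi [g [h [dpsi gh E1 E2]]]].
have [phi [dphi phipsi psiphi]] := diffeo_inv dpsi.
have [hpsi psi0] := diffeo_an dpsi; have [hphi phi0] := diffeo_an dphi.
exists phi, h, g; split=> //; first exact: inverse_germs_sym.
  have F1 := near_pull E1 hphi phi0.
  have [_ _ _ _ [F2 _]] := gh; have {}F2 := near_pull (near_f F2) hphi phi0.
  near=> p.
  have e1 : f (psi (phi p)) = g (f (phi p)) by near: p.
  have e2 : psi (phi p) = p by near: p.
  have e3 : h (g (f (phi p))) = f (phi p) by near: p.
  by rewrite -e3 -e1 e2.
have F1 := near_pull E2 hphi phi0.
have F2 := jac_inv hpsi hphi phi0 psiphi.
near=> p.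
have e1 : w0 (phi p) = w1 (psi (phi p)) * jac psi (phi p) by near: p.
have e2 : psi (phi p) = p by near: p.
have e3 : jac psi (phi p) * jac phi p = 1 by near: p.
by rewrite e1 e2 -mulrA e3 mulr1.
Unshelve. all: by end_near. Qed.

Lemma streq_trans w1 w0 w2 : streq w0 w1 -> streq w1 w2 -> streq w0 w2.
Proof.
move=> [psi [g [h [dpsi gh E1 E2]]]] [psi' [g' [h' [dpsi' gh' E1' E2']]]].
have [hpsi psi0] := diffeo_an dpsi; have [hpsi' psi0'] := diffeo_an dpsi'.
exists (fun p => psi' (psi p)), (fun t => g' (g t)), (fun t => h (h' t)); split.
- exact: diffeo_comp.
- exact: inverse_germs_comp.
- by have := near_pull E1' hpsi psi0; move: E1; apply: filterS2 => p <-.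
have F1 := near_pull E2' hpsi psi0; have F2 := near_jac_comp hpsi' hpsi psi0.
near=> p.
have -> : w0 p = w1 (psi p) * jac psi p by near: p.
have -> : w1 (psi p) = w2 (psi' (psi p)) * jac psi' (psi p) by near: p.
have -> : jac (fun q => psi' (psi q)) p = jac psi' (psi p) * jac psi p by near: p.
by rewrite mulrA.
Unshelve. all: by end_near. Qed.

Lemma diffeo_explicit psi phi : analytic_map psi -> analytic_map phi -> psi 0 = 0 -> phi 0 = 0 ->
  (\forall p \near (0 : R * R), phi (psi p) = p) -> (\forall p \near (0 : R * R), psi (phi p) = p) ->
  diffeo_germ psi.
Proof. by move=> h1 h2 h3 h4 h5 h6; split=> //; exists phi. Qed.

Lemma streq_sign_sym w0 w1 (a b : R) : a * a = 1 -> b * b = 1 -> a ^+ k = 1 ->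
  (\forall p \near (0 : R * R), w0 p = a * b * w1 (a * p.1, b * p.2)) -> streq w0 w1.
Proof.
move=> aa bb ak E; pose psi p := (a * p.1, b * p.2).
have hpsi : analytic_map psi.
  by split; apply: an_mul; [exact: an_cst|exact: an_fst|exact: an_cst|exact: an_snd].
have psi0 : psi 0 = 0 by rewrite /psi/= !mulr0.
have pp p : psi (psi p) = p by rewrite /psi/= !mulrA aa bb !mul1r -surjective_pairing.
exists psi, (fun t => t), (fun t => t); split.
- by apply: (diffeo_explicit hpsi hpsi) => //; exact: near0W.
- exact: inverse_germs_id.
- by apply: near0W => p; rewrite /nfH/= !exprMn ak (expr2 b) bb !mul1r.
have J p : jac psi p = a * b.
  rewrite (jac_grad (psi := psi) (gradM (grad_cst a p) (grad_fst p)) (gradM (grad_cst b p) (grad_snd p)))/=.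
  by ring.
by move: E; apply: filterS => p ->; rewrite J mulrC.
Qed.

Lemma streq_near w0 w1 : (\forall p \near (0 : R * R), w0 p = w1 p) -> streq w0 w1.
Proof.
move=> E; apply: (@streq_sign_sym _ _ 1 1); rewrite ?mulr1 ?expr1n//.
by move: E; apply: filterS => p ->; rewrite !mul1r -surjective_pairing.
Qed.

(** On x^i the operator 1 + al x d/dx is multiplication by 1 + al i >= 1, so
   that dividing the coefficients keeps the majorant. *)
Lemma an_euler (al : R) F : 0 <= al -> analytic2 F ->
  exists2 G, analytic2 G & \forall p \near (0 : R * R), G p + al * p.1 * dX G p = F p.
Proof.
move=> al0 /analytic2_maj[r r0 [M [a ha]]].
have d0 i : 0 < 1 + al * i%:R by rewrite ltr_wpDr// mulr_ge0.
pose b i j := a i j / (1 + al * i%:R).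
pose m i j (p : R * R) := b i j * (p.1 ^+ i * p.2 ^+ j * 1).
have hm i j : maj (m i j) r (`|b i j| * (r ^+ i * r ^+ j * `|1|)).
  by apply: maj_scale; apply: maj_mono; [exact: ltW|apply: maj_cst; exact: ltW].
have hB : absum (fun i j => `|b i j| * (r ^+ i * r ^+ j * `|1 : R|)) M.
  apply: le_absum ha.1 => i j; rewrite normr1 mulr1 [leLHS]normrM normr_id /mono/=.
  rewrite -(mulrA (a i j)) [leRHS]normrM; apply: ler_wpM2r => //.
  by rewrite /b normrM ler_piMr// normfV gtr0_norm// invf_le1// lerDl mulr_ge0.
have [G hG h] := maj_series_ex r0 hm hB.
exists G; first exact: maj_analytic2 hG.
apply/near0P; exists (r / 2); first by rewrite divr_gt0.
move=> p hp; have [h1 _] := maj_series_der (half_lt r0) hm hB h hp.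
have hpr : inbox r p by apply: inbox_le hp; case/andP: (half_lt r0) => _ /ltW.
have h2 : (dsum (fun i j => m i j p) n n + al * p.1 * dsum (fun i j => dX (m i j) p) n n) @[n --> \oo]
   --> G p + al * p.1 * dX G p.
  by apply: cvgD; [exact: h|exact: cvgMr].
have h3 := ha.2 p hpr.
suff E : (fun n => dsum (mono a p) n n) =
  (fun n => dsum (fun i j => m i j p) n n + al * p.1 * dsum (fun i j => dX (m i j) p) n n).
  by rewrite E in h3; apply: (cvg_unique _ h2 h3).
apply/funext => n; rewrite -dsumZ -dsumD; apply: eq_dsum => i j.
have [_ -> _] := gradM (grad_cst (b i j) p)
  (gradM (gradM (gradX i (grad_fst p)) (gradX j (grad_snd p))) (grad_cst 1 p)).
have ab : a i j = b i j * (1 + al * i%:R) by rewrite /b divfK// gt_eqF.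
rewrite /m /mono ab; case: i {ab} => [|i] /=; rewrite ?exprS; ring.
Qed.

Lemma an1_euler (al : R) c : 0 <= al -> analytic1 c ->
  exists2 e, analytic1 e & \forall t \near (0 : R), e t + al * t * derive1 e t = c t.
Proof.
move=> al0 /an1P hc; have [G hG E] := an_euler al0 hc.
exists (fun t => G (t, 0)); first exact: an1_restr.
have gG := near_xaxis (an_grad hG).
have E1 := near_xaxis E.
near=> t; rewrite (derive1_dX _ _ 0).
have g1 : grad G (t, 0) (dX G (t, 0)) (dY G (t, 0)) by near: t.
have [_ -> _] := grad_comp (u := fun p => p.1) (v := fun=> 0) (p := (t, 0)) g1 (grad_fst _) (grad_cst _ _).
rewrite mulr1 mulr0 addr0; near: t; exact: E1.
Unshelve. all: by end_near. Qed.

(** The inverse function theorem for (1 + y)^n - 1, at the positive root of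
   c(0). *)
Lemma an1_root (n : nat) c : (0 < n)%N -> analytic1 c -> 0 < c 0 ->
  exists2 e, analytic1 e & 0 < e 0 /\ \forall t \near (0 : R), e t ^+ n = c t.
Proof.
move=> n0 hc c0.
pose g (y : R) := (1 + y) ^+ n - 1.
have hg : analytic1 g.
  apply: an1_sub; last exact: an1_cst.
  by apply: an1_exp; apply: an1_add; [exact: an1_cst|exact: an1_id].
have g0 : g 0 = 0 by rewrite /g addr0 expr1n subrr.
have dg : derive1 g 0 != 0.
  rewrite (derive1_dX _ _ 0).
  have [_ -> _] := gradB (gradX n (gradD (grad_cst (1 : R) ((0, 0) : R * R)) (grad_fst ((0, 0) : R * R)))) (grad_cst 1 _).
  by rewrite /= addr0 expr1n add0r mulr1 subr0 mulr1 pnatr_eq0 -lt0n.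
have [h [hh h0 _ E1 _]] := inverse1 hg g0 dg.
pose d := c 0 `^ (n%:R^-1).
have d0 : 0 < d by rewrite powR_gt0.
have dn : d ^+ n = c 0.
  rewrite /d -powR_mulrn ?powR_ge0// -powRrM mulVf ?powRr1 ?(ltW c0)//.
  by rewrite pnatr_eq0 -lt0n.
have hu : analytic1 (fun t => c t * (c 0)^-1 - 1).
  by apply: an1_sub; [apply: an1_mul => //; exact: an1_cst|exact: an1_cst].
have u0 : c 0 * (c 0)^-1 - 1 = 0 by rewrite divff ?subrr// gt_eqF.
exists (fun t => d * (1 + h (c t * (c 0)^-1 - 1))).
  apply: an1_mul; first exact: an1_cst.
  by apply: an1_add; [exact: an1_cst|exact: an1_comp].
split; first by rewrite u0 h0 addr0 mulr1.
have := near1_comp E1 hu u0; apply: filterS => t; rewrite /g => /eqP.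
rewrite subr_eq subrK => /eqP E.
by rewrite exprMn E dn mulrCA divff ?mulr1// gt_eqF.
Qed.

(** The map psi = (l(f)^2 x, l(f)^k xi) satisfies f o psi = l(f)^(2k) f, and its
   Jacobian is D + al t D' at t = f, where D = l^(k+2) and al = 2k / (k+2).  So
   D is obtained from c_0 by [an1_euler] and l as a root of D. *)
Lemma nform_scaling (c : nat -> R -> R) : (forall i, analytic1 (c i)) -> 0 < c 0%N 0 ->
  exists ch : nat -> R -> R, [/\ forall i, analytic1 (ch i), ch 0%N = (fun=> 1) & streq (nform c) (nform ch)].
Proof.
move=> hc c0.
have kpos : (0 < k)%N by exact: ltnW.
have kn0 : (k%:R : R) != 0 by rewrite pnatr_eq0 -lt0n.
have kn2 : (k.+2%:R : R) != 0 by rewrite pnatr_eq0.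
pose al : R := 2 * k%:R / k.+2%:R.
have al0 : 0 <= al by rewrite divr_ge0// mulr_ge0.
have [D hD ED] := an1_euler al0 (hc 0%N).
have D0 : 0 < D 0 by have := nbhs_singleton ED; rewrite mulr0 mul0r addr0 => ->.
have [lam hlam [lam0 Elam]] := an1_root (ltn0Sn k.+1) hD D0.
have lamn0 : lam 0 != 0 by rewrite gt_eqF.
pose g t := t * lam t ^+ (2 * k).
have hg : analytic1 g by apply: an1_mul; [exact: an1_id|exact: an1_exp].
have g0 : g 0 = 0 by rewrite /g mul0r.
have glam := nbhs_singleton (an1_grad hlam) _ _ _ _ (grad_fst (0 : R * R)) erefl.
have dg : derive1 g 0 != 0.
  rewrite (derive1_dX _ _ 0).
  have [_ -> _] := gradM (grad_fst (0 : R * R)) (gradX (2 * k) glam).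
  by rewrite /= mul0r add0r mulr1 expf_neq0.
have [h [hh h0 _ E2 E1]] := inverse1 hg g0 dg.
have ff0 := f0 R s k2; have hf := an_f R k s.
have hlf := an1_comp2 hlam hf ff0.
pose psi p := (lam (f p) ^+ 2 * p.1, lam (f p) ^+ k * p.2).
have hmu : analytic1 (fun t => (lam (h t))^-1).
  by apply: an1_inv; [exact: an1_comp|rewrite h0].
have hmf := an1_comp2 hmu hf ff0.
pose phi p := ((lam (h (f p)))^-1 ^+ 2 * p.1, (lam (h (f p)))^-1 ^+ k * p.2).
have hpsi : analytic_map psi.
  by split; apply: an_mul; [exact: an_exp|exact: an_fst|exact: an_exp|exact: an_snd].
have hphi : analytic_map phi.
  split; apply: an_mul; [exact: (an_exp 2 hmf)|exact: an_fst|exact: (an_exp k hmf)|exact: an_snd].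
have psi0 : psi 0 = 0 by rewrite /psi/= !mulr0.
have phi0 : phi 0 = 0 by rewrite /phi/= !mulr0.
have fscale (l : R) p : f (l ^+ 2 * p.1, l ^+ k * p.2) = l ^+ (2 * k) * f p.
  have e1 : (l ^+ k * p.2) ^+ 2 = l ^+ (2 * k) * p.2 ^+ 2 by rewrite exprMn -exprM mulnC.
  have e2 : (l ^+ 2 * p.1) ^+ k = l ^+ (2 * k) * p.1 ^+ k by rewrite exprMn -exprM.
  by rewrite /nfH/= e1 e2 mulrDr [X in _ = _ + X]mulrCA.
have fpsi p : f (psi p) = g (f p) by rewrite /psi fscale /g mulrC.
have lamf : \forall p \near (0 : R * R), lam (f p) != 0 by exact: (near_f (an1_neq0 hlam lamn0)).
have lamhf : \forall p \near (0 : R * R), lam (h (f p)) != 0.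
  exact: (near_f (near1_comp (an1_neq0 hlam lamn0) hh h0)).
have E1f := near_f E1; have E2f := near_f E2.
have canV (x y : R) n : x != 0 -> x^-1 ^+ n * (x ^+ n * y) = y.
  by move=> x0; rewrite mulrA -exprMn mulVf// expr1n mul1r.
have canW (x y : R) n : x != 0 -> x ^+ n * (x^-1 ^+ n * y) = y.
  by move=> x0; rewrite mulrA -exprMn divff// expr1n mul1r.
have dpsi : diffeo_germ psi.
  apply: (diffeo_explicit hpsi hphi psi0 phi0).
    near=> p; have e : h (g (f p)) = f p by near: p.
    have n0 : lam (f p) != 0 by near: p.
    by rewrite /phi fpsi e /psi/= !canV// -surjective_pairing.
  near=> p; have e : g (h (f p)) = f p by near: p.
  have n0 : lam (h (f p)) != 0 by near: p.
  have -> : psi (phi p) = (lam (h (f p)) ^+ 2 * (phi p).1, lam (h (f p)) ^+ k * (phi p).2).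
    rewrite /psi; suff -> : f (phi p) = h (f p) by [].
    by rewrite /phi fscale -[X in _ * X = _]e /g mulrCA -exprMn mulVf// expr1n mulr1.
  by rewrite /phi/= !canW// -surjective_pairing.
have Jpsi : \forall p \near (0 : R * R), jac psi p = c 0%N (f p).
  have EDf := near_f ED; have glf := an1_grad2 hlam hf ff0.
  have gDf : \forall t \near (0 : R), derive1 D t = k.+2%:R * lam t ^+ k.+1 * derive1 lam t.
    have := near_eq_derive1 Elam; have := an1_grad hlam.
    apply: filterS2 => t gl <-.
    have {}gl := gl _ _ _ _ (grad_fst (t, 0)) erefl.
    by rewrite (derive1_dX _ _ 0); have [_ -> _] := gradX k.+2 gl; rewrite /=; ring.
  have gDff := near_f gDf; have Elamf := near_f Elam.
  near=> p.
  have gl : forall a b, grad f p a b -> grad (fun q => lam (f q)) p (derive1 lam (f p) * a) (derive1 lam (f p) * b).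
    by near: p.
  have {}gl := gl _ _ (grad_f k s p).
  have e1 : D (f p) + al * f p * derive1 D (f p) = c 0%N (f p) by near: p.
  have e2 : derive1 D (f p) = k.+2%:R * lam (f p) ^+ k.+1 * derive1 lam (f p) by near: p.
  have e3 : lam (f p) ^+ k.+2 = D (f p) by near: p.
  rewrite (jac_grad (psi := psi) (gradM (gradX 2 gl) (grad_fst p)) (gradM (gradX k gl) (grad_snd p))).
  rewrite -e1 e2 -e3.
  have -> : al * f p * (k.+2%:R * lam (f p) ^+ k.+1 * derive1 lam (f p)) =
     2 * k%:R * f p * (lam (f p) ^+ k.+1 * derive1 lam (f p)).
    by rewrite /al; field.
  have -> : 2 * k%:R * f p = k%:R * p.2 * (2 * p.2) + 2 * p.1 * (sg * (k%:R * p.1 ^+ k.-1)).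
    by rewrite /nfH; case: (k) kpos => // k' _; rewrite /= (exprS p.1); ring.
  move: (lam (f p)) (derive1 lam (f p)) => L L'; case: (k) kpos => // k' _.
  by rewrite /= !exprS; ring.
pose ch i t := if i == 0%N then 1 else c i (h t) * ((c 0%N (h t))^-1 * ((lam (h t))^-1 ^+ (2 * i))).
exists ch; split.
- case=> [|i]; first exact: an1_cst.
  apply: an1_mul; first exact: an1_comp.
  apply: an1_mul; last exact: an1_exp.
  by apply: an1_inv; [exact: an1_comp|rewrite h0 gt_eqF].
- by [].
exists psi, g, h; split=> //.
  by apply: near0W => p; exact: fpsi.
have c0f : \forall p \near (0 : R * R), c 0%N (f p) != 0.
  have n0 : c 0%N 0 != 0 by rewrite gt_eqF.
  exact: (near_f (an1_neq0 (hc 0%N) n0)).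
near=> p.
have -> : jac psi p = c 0%N (f p) by near: p.
have e1 : h (g (f p)) = f p by near: p.
have n0 : lam (f p) != 0 by near: p.
have n1 : c 0%N (f p) != 0 by near: p.
rewrite /nform mulr_suml; apply: eq_bigr => -[[|i] /= ik] _.
  by rewrite !expr0 !mul1r.
rewrite /ch/= fpsi e1 exprMn -exprM exprVn.
have n2 : lam (f p) ^+ (2 * i.+1) != 0 by rewrite expf_neq0.
move: (lam (f p) ^+ (2 * i.+1)) n2 => L n2; by field; rewrite ?n1 ?n2.
Unshelve. all: by end_near. Qed.

(** The coefficients of a normal form seen as a representative: the index 0 has
   coefficient 1. *)
Definition normal1 (c : nat -> R -> R) : nat -> R -> R := fun i => if i == 0%N then fun=> 1 else c i.

Lemma nfw_nform (c : nat -> R -> R) p : nfw k s c p = nform (normal1 c) p.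
Proof.
have km : k.-1 = (k - 2).+1 by lia.
rewrite /nfw /nform km big_ord_recl/= expr0 mul1r; congr (_ + _).
rewrite -[in LHS](addn1 (k - 2)) -{1}(add0n 1%N) big_addn addnK big_mkord.
by apply: eq_bigr => i _; rewrite /bump/= addn1.
Qed.

(** If c_0(0) < 0, the reflection of xi changes the sign of the density before
   [nform_scaling] applies. *)
Lemma normal_form_exists w : analytic2 w -> w 0 != 0 -> exists2 c : nat -> R -> R,
  analytic_family k c & streq w (nfw k s c).
Proof.
move=> hw w0; have [c [tau [hc htau E]]] := cohomology s k2 hw.
have N0 (c' : nat -> R -> R) : nform c' 0 = c' 0%N 0.
  rewrite /nform (f0 R s k2); have -> : k.-1 = (k - 2).+1 by lia.
  rewrite big_ord_recl/= expr0 mul1r big1 ?addr0// => i _.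
  by rewrite /bump/= exprS !mul0r.
have c0 : c 0%N 0 = w 0.
  have := nbhs_singleton E; rewrite -N0 /nform => ->.
  rewrite /X0 /= expr0n; case: k k2 => [|[|k']] //= _.
  by rewrite !mulr0 !mul0r subrr addr0.
have [|psi [dpsi E1 E2]] := moser k2 hc htau hw _ E; first by rewrite N0 c0.
have S1 : streq w (nform c).
  by exists psi, (fun t => t), (fun t => t); split=> //; exact: inverse_germs_id.
have [c' [hc' c'0 S2]] : exists c' : nat -> R -> R, [/\ forall i, analytic1 (c' i), 0 < c' 0%N 0 & streq w (nform c')].
  have [cp|cn] := ltP 0 (c 0%N 0); first by exists c.
  exists (fun i t => - c i t); split.
  - by move=> i; exact: an1_opp.
  - by rewrite oppr_gt0 lt_neqAle cn c0 w0.
  apply: streq_trans S1 _; apply: (@streq_sign_sym _ _ 1 (-1)); rewrite ?mulr1 ?expr1n ?mulrNN ?mulr1//.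
  apply: near0W => p; rewrite mul1r mulN1r mul1r /nform -sumrN; apply: eq_bigr => i _ /=.
  have -> : f (p.1, -1 * p.2) = f p by rewrite /nfH/= mulN1r sqrrN.
  by rewrite mulrN opprK.
have [ch [hch ch0 S3]] := nform_scaling hc' c'0.
exists ch; first by move=> i _; exact: hch.
apply: streq_trans S2 (streq_trans S3 _).
apply: streq_near; apply: near0W => p; rewrite nfw_nform.
by apply: eq_bigr => -[[|i] ik] _ //=; rewrite ch0.
Qed.

(** The rotation (x, xi) |-> (-x, -xi), which preserves f for even k and has
   Jacobian 1. *)
Lemma streq_odd_signs (c : nat -> R -> R) : ~~ odd k -> streq (nfw k s c) (nfw k s (change_odd_signs c)).
Proof.
move=> ok; have kk : (-1 : R) ^+ k = 1 by rewrite -signr_odd (negbTE ok).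
apply: (@streq_sign_sym _ _ (-1) (-1)) => //; rewrite ?mulrNN ?mulr1//.
apply: near0W => p; rewrite mul1r /nfw; congr (_ + _).
apply: eq_bigr => i _ /=.
have -> : f (-1 * p.1, -1 * p.2) = f p.
  by rewrite /nfH/= (mulN1r p.2) sqrrN exprMn kk mul1r.
rewrite /change_odd_signs mulN1r exprNn -signr_odd; case: ifP => _.
  by rewrite expr1 mulN1r mulrNN.
by rewrite expr0 mul1r.
Qed.

End Existence.

Local Opaque dX dY derive1 jac derive analytic2 analytic1.

(** * The Fuchsian equation of a map preserving the fibration *)

Section Uniqueness.
Variable R : realType.
Variables (k : nat) (s : bool).
Hypothesis k2 : (2 <= k)%N.
Implicit Types (F G u v w A B : R * R -> R) (p q : R * R) (r M : R).

Local Notation sg := ((-1) ^+ s : R).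
Local Notation f := (@nfH R k s).
Local Notation X0 := (@X0 R k s).
Local Notation nform := (@nform R k s).

Lemma near0I (Q Q' : R * R -> Prop) : (\forall p \near (0 : R * R), Q p) ->
  (\forall p \near (0 : R * R), Q' p) -> \forall p \near (0 : R * R), Q p /\ Q' p.
Proof. by apply: filterS2 => p. Qed.

(** A nonzero solution v = t^n u with u(0) <> 0 would have to satisfy B = C + K
   n; all other exponents are excluded. *)
Lemma ode_zero (B C K : R) (e v : R -> R) : analytic1 e -> analytic1 v -> e 0 = 1 ->
  (\forall t \near (0 : R), B * v t = e t * (C * v t + K * t * derive1 v t)) ->
  (forall n : nat, B != C + K * n%:R) -> \forall t \near (0 : R), v t = 0.
Proof.
move=> he hv e0 E BC; have [//|[n [u hu [u0 Eu]]]] := an1_order hv.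
have gu := an1_grad hu; have E' := near_eq_derive1 Eu.
have H : \forall t \near (0 : R), B * u t = e t * ((C + K * n%:R) * u t + K * t * derive1 u t).
  apply: an1_eq_pos.
  - by apply: an1_mul => //; exact: an1_cst.
  - apply: an1_mul => //; apply: an1_add; apply: an1_mul => //; first exact: an1_cst.
      by apply: an1_mul; [exact: an1_cst|exact: an1_id].
    exact: an1_derive.
  near=> t => t0.
  have g1 : forall w p a b, grad w p a b -> w p = t -> grad (fun q => u (w q)) p (derive1 u t * a) (derive1 u t * b).
    by near: t.
  have e1 : B * v t = e t * (C * v t + K * t * derive1 v t) by near: t.
  have e2 : v t = t ^+ n * u t by near: t.
  have e3 : derive1 v t = derive1 (fun t => t ^+ n * u t) t by near: t.
  have {}e3 : derive1 v t = t ^+ n * derive1 u t + u t * (n%:R * t ^+ n.-1).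
    rewrite e3 (derive1_dX (fun t => t ^+ n * u t) _ 0).
    have [_ E3 _] := gradM (gradX n (grad_fst (t, 0))) (g1 _ _ _ _ (grad_fst (t, 0)) erefl).
    by apply: (etrans E3); rewrite /=; ring.
  have tn : t ^+ n != 0 by rewrite expf_neq0// gt_eqF.
  apply: (mulfI tn); move: e1; rewrite e2 e3.
  have -> : K * t * (t ^+ n * derive1 u t + u t * (n%:R * t ^+ n.-1)) =
     K * t * (t ^+ n * derive1 u t) + K * u t * (n%:R * t ^+ n).
    by case: (n) => [|m]; rewrite /= ?exprS; ring.
  by move=> e1; rewrite mulrCA e1; ring.
have := nbhs_singleton H; rewrite e0 mulr0 mul0r addr0 mul1r => /(mulIf u0) /eqP.
by rewrite (negbTE (BC n)).
Unshelve. all: by end_near. Qed.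

Lemma near_ord (Q : nat -> R * R -> Prop) m : (forall i, (i < m)%N -> \forall p \near (0 : R * R), Q i p) ->
  \forall p \near (0 : R * R), forall i, (i < m)%N -> Q i p.
Proof.
elim: m => [|m IH] h; first exact: near0W.
have h1 := IH (fun i im => h i (ltnW im)); have h2 := h m (ltnSn m).
by move: h1 h2; apply: filterS2 => p a b i; rewrite ltnS leq_eqVlt => /orP[/eqP->|/a].
Qed.

(** The Euler field 2 x d/dx + k xi d/dxi multiplies x^i by 2i and f by 2k. *)
Lemma euler_nform (v : nat -> R -> R) : (forall i, analytic1 (v i)) ->
  \forall p \near (0 : R * R), grad (nform v) p (dX (nform v) p) (dY (nform v) p) /\
    2 * p.1 * dX (nform v) p + k%:R * p.2 * dY (nform v) p =
      nform (fun i t => (2 * i)%:R * v i t + 2 * k%:R * t * derive1 (v i) t) p.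
Proof.
move=> hv; have kpos : (0 < k)%N by exact: ltnW.
have H : \forall p \near (0 : R * R), forall i, (i < k.-1)%N ->
    grad (fun q => v i (f q)) p (derive1 (v i) (f p) * (sg * (k%:R * p.1 ^+ k.-1))) (derive1 (v i) (f p) * (2 * p.2)).
  apply: near_ord => i _; have := an1_grad2 (hv i) (an_f R k s) (f0 R s k2).
  by apply: filterS => p; apply; exact: grad_f.
move: H (an_grad (an_nform s k2 hv)); apply: filterS2 => p H G; split=> //.
have G' := grad_sum (index_enum 'I_k.-1) (fun i : 'I_k.-1 => gradM (gradX i (grad_fst p)) (H i (ltn_ord i))).
have [-> ->] := grad_unique G G'.
rewrite !mulr_sumr -big_split; apply: eq_bigr => i _ /=.
have -> : 2 * k%:R * f p = k%:R * p.2 * (2 * p.2) + 2 * p.1 * (sg * (k%:R * p.1 ^+ k.-1)).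
  by rewrite /nfH; case: (k) kpos => // k' _; rewrite /= (exprS p.1); ring.
by case: (nat_of_ord i) => [|m]; rewrite /= ?exprS ?natrM; ring.
Qed.

Lemma X0_scale (a : R -> R) tau : analytic1 a -> analytic2 tau ->
  \forall p \near (0 : R * R), X0 (fun q => a (f q) * tau q) p = a (f p) * X0 tau p.
Proof.
move=> ha htau; have := an1_grad2 ha (an_f R k s) (f0 R s k2).
move: (an_grad htau); apply: filterS2 => p g1 /(_ _ _ (grad_f k s p)) g2.
by rewrite (X0E k s (gradM g2 g1)) /X0; ring.
Qed.

(** A 1-form A dx + B dxi whose exterior product with df vanishes is a multiple
   K df: on the x-axis B vanishes, so xi divides B. *)
Lemma divide_df A B : analytic2 A -> analytic2 B ->
  (\forall p \near (0 : R * R), 2 * p.2 * A p = sg * (k%:R * p.1 ^+ k.-1) * B p) ->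
  exists2 K, analytic2 K & \forall p \near (0 : R * R),
    A p = sg * (k%:R * p.1 ^+ k.-1) * K p /\ B p = 2 * p.2 * K p.
Proof.
move=> hA hB E.
have k0 : (k%:R : R) != 0 by rewrite pnatr_eq0 -lt0n ltnW.
have B0 : \forall t \near (0 : R), B (t, 0) = 0.
  apply: (an1_eq_pos (an1_restr hB) (an1_cst 0)).
  have := near_xaxis E; apply: filterS => t /= e t0; move: e; rewrite mulr0 mul0r => /esym/eqP.
  by rewrite !mulf_eq0 (negbTE (sg_neq0 R s)) (negbTE k0) expf_eq0 gt_eqF// andbF/= => /eqP.
have [K' hK' EK] := an_splity hB.
have hK : analytic2 (fun p => 2^-1 * K' p) by apply: an_mul => //; exact: an_cst.
exists (fun p => 2^-1 * K' p) => //.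
have EB : \forall p \near (0 : R * R), B p = 2 * p.2 * (2^-1 * K' p).
  have := near_along B0 (an_fst R) erefl; move: EK; apply: filterS2 => p -> ->.
  by rewrite add0r; field.
have EA : \forall p \near (0 : R * R), A p = sg * (k%:R * p.1 ^+ k.-1) * (2^-1 * K' p).
  apply: an_eq_quadrant => //.
    apply: an_mul => //; apply: an_mul; first exact: an_cst.
    by apply: an_mul; [exact: an_cst|apply: an_exp; exact: an_fst].
  move: E EB; apply: filterS2 => p e1 e2 _ p2; rewrite e2 in e1.
  have n0 : 2 * p.2 != 0 by rewrite mulf_neq0 ?pnatr_eq0// gt_eqF.
  by apply: (mulfI n0); rewrite e1; ring.
by move: EA EB; apply: filterS2.
Qed.

Section Pullback.
Variables (psi : R * R -> R * R) (g h : R -> R).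
Hypothesis dpsi : diffeo_germ psi.
Hypothesis gh : inverse_germs g h.
Hypothesis fpsi : \forall p \near (0 : R * R), f (psi p) = g (f p).

Let U p := (psi p).1.
Let V p := (psi p).2.
Let J := jac psi.

Lemma pullback_analytic : [/\ analytic2 U, analytic2 V, analytic2 J, U 0 = 0 & V 0 = 0].
Proof.
have [[h1 h2] p0] := diffeo_an dpsi; split=> //; first exact: an_jac.
- by rewrite /U p0.
- by rewrite /V p0.
Qed.

Lemma dg_neq0 : derive1 g 0 != 0.
Proof.
have [hg hh g0 h0 [_ E]] := gh.
have g1 := nbhs_singleton (an1_grad hh) _ _ _ _ (grad_fst (0 : R * R)) erefl.
have g2 := nbhs_singleton (an1_grad hg) _ _ _ _ g1 h0.
have g3 := grad_ext (near_along E (an_fst R) erefl) g2.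
have [+ _] := grad_unique g3 (grad_fst 0).
by move/eqP; apply: contraTneq => ->; rewrite mul0r eq_sym oner_eq0.
Qed.

(** The factor e = g / (t g') is regular at 0, with value 1, as g has a simple
   zero. *)
Lemma reparam_factor : exists e, [/\ analytic1 e, e 0 = 1 & \forall t \near (0 : R), g t = t * e t * derive1 g t].
Proof.
have [hg hh g0 h0 _] := gh; have dg := dg_neq0.
have [g1 hg1 E] := an1_factor hg g0.
have hd := an1_derive hg; have hdi := an1_inv hd dg.
have E' := near_eq_derive1 E.
have d0 : derive1 g 0 = g1 0.
  rewrite (nbhs_singleton E') (derive1_dX _ _ 0).
  have gg1 := nbhs_singleton (an1_grad hg1) _ _ _ _ (grad_fst (0 : R * R)) erefl.
  by have [_ -> _] := gradM (grad_fst (0 : R * R)) gg1; rewrite /= mul0r add0r mulr1.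
exists (fun t => g1 t * (derive1 g t)^-1); split.
- exact: an1_mul.
- by rewrite d0 divff// -d0.
have := an1_neq0 hd dg; move: E; apply: filterS2 => t -> n0.
by rewrite -!mulrA mulVf// mulr1.
Qed.

Lemma fpsi_grad : \forall p \near (0 : R * R), [/\ grad U p (dX U p) (dY U p), grad V p (dX V p) (dY V p),
  sg * (k%:R * U p ^+ k.-1) * dX U p + 2 * V p * dX V p = derive1 g (f p) * (sg * (k%:R * p.1 ^+ k.-1)) &
  sg * (k%:R * U p ^+ k.-1) * dY U p + 2 * V p * dY V p = derive1 g (f p) * (2 * p.2)].
Proof.
have [hU hV _ _ _] := pullback_analytic; have [hg _ _ _ _] := gh.
have := near0I (an_grad hU) (near0I (an_grad hV) (near0I (an1_grad2 hg (an_f R k s) (f0 R s k2)) (near_join fpsi))).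
apply: filterS => p [G1 [G2 [G3 e]]].
have [e1 e2] := grad_unique (grad_ext e (grad_pull (grad_f k s (psi p)) G1 G2)) (G3 _ _ (grad_f k s p)).
by split.
Qed.

Lemma natE j : (2 * j + k + 2)%:R = 2 * j%:R + k%:R + 2 :> R.
Proof. by rewrite natrD natrD natrM. Qed.

Lemma J_E p : J p = dX U p * dY V p - dY U p * dX V p.
Proof. exact: jacE. Qed.

Let Pp j p := U p ^+ j * (k%:R * V p * dX U p - 2 * U p * dX V p).
Let Qq j p := U p ^+ j * (k%:R * V p * dY U p - 2 * U p * dY V p).

(** The 1-form Pp dx + Qq dxi is the pullback by psi of x^j (k xi dx - 2 x dxi).
   The first identity is the pullback of the formula for its exterior
   derivative, the second the pullback of its product with df, where psi^* df =
   g'(f) df. *)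
Lemma pull_primitive j : [/\ analytic2 (Pp j), analytic2 (Qq j),
    \forall p \near (0 : R * R), dY (Pp j) p - dX (Qq j) p = (2 * j + k + 2)%:R * (U p ^+ j * J p) &
    \forall p \near (0 : R * R), derive1 g (f p) * (2 * p.2 * Pp j p - sg * (k%:R * p.1 ^+ k.-1) * Qq j p) =
      2 * k%:R * g (f p) * (U p ^+ j * J p)].
Proof.
have [hU hV hJ U0 V0] := pullback_analytic.
have hUx := an_dX hU; have hUy := an_dY hU; have hVx := an_dX hV; have hVy := an_dY hV.
have kpos : (0 < k)%N by exact: ltnW.
have hP : analytic2 (Pp j).
  exact: (an_mul (an_exp j hU) (an_sub (an_mul (an_mul (an_cst _) hV) hUx) (an_mul (an_mul (an_cst _) hU) hVx))).
have hQ : analytic2 (Qq j).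
  exact: (an_mul (an_exp j hU) (an_sub (an_mul (an_mul (an_cst _) hV) hUy) (an_mul (an_mul (an_cst _) hU) hVy))).
split=> //.
  have := near0I (an_mixed hU) (near0I (an_mixed hV) (near0I (an_grad hU) (near0I (an_grad hV)
    (near0I (an_grad hUx) (near0I (an_grad hUy) (near0I (an_grad hVx) (an_grad hVy))))))).
  apply: filterS => p [e1 [e2 [G1 [G2 [G3 [G4 [G5 G6]]]]]]].
  have GP := gradM (gradX j G1) (gradB (gradM (gradM (grad_cst k%:R p) G2) G3) (gradM (gradM (grad_cst 2 p) G1) G5)).
  have GQ := gradM (gradX j G1) (gradB (gradM (gradM (grad_cst k%:R p) G2) G4) (gradM (gradM (grad_cst 2 p) G1) G6)).
  have [_ _ ->] := GP; have [_ -> _] := GQ; rewrite J_E e1 e2 natE.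
  move: (U p) (V p) (dX U p) (dY U p) (dX V p) (dY V p) (dY (dX U) p) (dY (dX V) p) => x1 x2 x3 x4 x5 x6 x7 x8.
  move: (k%:R : R) => kk.
  by case: (j) => [|m]; rewrite /= ?exprS; ring.
move: fpsi fpsi_grad; apply: filterS2 => p e [_ _ e1 e2].
rewrite -e /nfH -/(U p) -/(V p) J_E /Pp /Qq mulrBr.
have -> : derive1 g (f p) * (2 * p.2 * (U p ^+ j * (k%:R * V p * dX U p - 2 * U p * dX V p))) =
   (derive1 g (f p) * (2 * p.2)) * (U p ^+ j * (k%:R * V p * dX U p - 2 * U p * dX V p)) by ring.
have -> : derive1 g (f p) * (sg * (k%:R * p.1 ^+ k.-1) * (U p ^+ j * (k%:R * V p * dY U p - 2 * U p * dY V p))) =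
   (derive1 g (f p) * (sg * (k%:R * p.1 ^+ k.-1))) * (U p ^+ j * (k%:R * V p * dY U p - 2 * U p * dY V p)) by ring.
rewrite -e1 -e2; have -> : U p ^+ k = U p * U p ^+ k.-1 by rewrite -exprS prednK.
by ring.
Qed.

(** Subtract from the primitive of psi^*(x^j dxi /\ dx) the form with
   coefficients P', Q' built from e times the same representative and tau; both
   have the same product with df, so they differ by K df.  The exterior
   derivative then expresses the density (2j + k + 2) sum_i x^i M_ij(f) in two
   ways modulo X0, and the coefficients agree by [cohomology_unique]. *)
Lemma connection e (M : nat -> R -> R) tau j : analytic1 e ->
  (\forall t \near (0 : R), g t = t * e t * derive1 g t) ->
  (forall i, analytic1 (M i)) -> analytic2 tau ->
  (\forall p \near (0 : R * R), U p ^+ j * J p = nform M p + X0 tau p) ->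
  forall i, (i < k.-1)%N -> \forall t \near (0 : R),
   (2 * j + k + 2)%:R * M i t = (2 * i + k + 2)%:R * (e t * M i t) + 2 * k%:R * t * derive1 (fun t => e t * M i t) t.
Proof.
move=> he Ee hM htau Ew; have [hU hV hJ U0 V0] := pullback_analytic; have [hg _ g0 _ _] := gh.
have [hP hQ dPQ wPQ] := pull_primitive j.
pose v i t := e t * M i t.
have hv i : analytic1 (v i) by exact: an1_mul.
pose a2 t := 2 * k%:R * t * e t.
have ha2 : analytic1 a2.
  by apply: an1_mul => //; apply: an1_mul; [exact: an1_cst|exact: an1_id].
have ha2f := an1_comp2 ha2 (an_f R k s) (f0 R s k2).
have hS := an_nform s k2 hv.
have htx := an_dX htau; have hty := an_dY htau.
(* a form with the same product with df as the pulled back primitive, by f =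
   xi^2 + sg x^k *)
pose P' p := k%:R * p.2 * nform v p + a2 (f p) * dX tau p.
pose Q' p := - (2 * p.1) * nform v p + a2 (f p) * dY tau p.
have hP' : analytic2 P'.
  exact: (an_add (an_mul (an_mul (an_cst _) (an_snd R)) hS) (an_mul ha2f htx)).
have hQ' : analytic2 Q'.
  exact: (an_add (an_mul (an_opp (an_mul (an_cst _) (an_fst R))) hS) (an_mul ha2f hty)).
have kpos : (0 < k)%N by exact: ltnW.
have fE p : 2 * k%:R * f p = k%:R * p.2 * (2 * p.2) + 2 * p.1 * (sg * (k%:R * p.1 ^+ k.-1)).
  by rewrite /nfH; case: (k) kpos => // k' _; rewrite /= (exprS p.1); ring.
have vM p : nform v p = e (f p) * nform M p.
  by rewrite /nform mulr_sumr; apply: eq_bigr => i _; rewrite mulrCA.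
have [K hK EK] : exists2 K, analytic2 K & \forall p \near (0 : R * R),
    Pp j p - P' p = sg * (k%:R * p.1 ^+ k.-1) * K p /\ Qq j p - Q' p = 2 * p.2 * K p.
  apply: divide_df (an_sub hP hP') (an_sub hQ hQ') _.
  have dgn := near_f s k2 (an1_neq0 (an1_derive hg) dg_neq0).
  have Eef := near_f s k2 Ee.
  have := near0I dgn (near0I Eef (near0I wPQ Ew)); apply: filterS => p [n0 [e1 [e2 e3]]].
  have e4 : 2 * p.2 * Pp j p - sg * (k%:R * p.1 ^+ k.-1) * Qq j p =
     2 * k%:R * f p * e (f p) * (nform M p + X0 tau p).
    apply: (mulfI n0); rewrite e2 {1}e1 e3.
    by move: (nform M p + _) (derive1 g (f p)) (e (f p)) => x1 x2 x3; ring.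
  apply/eqP; rewrite -subr_eq0; apply/eqP.
  have ab (x1 x2 x3 x4 x5 x6 : R) : x1 * (x2 - x3) - x4 * (x5 - x6) = x1 * x2 - x4 * x5 - (x1 * x3 - x4 * x6) by ring.
  rewrite ab e4 /P' /Q' /a2 vM /X0 fE; move: (dX tau p) (dY tau p) (nform M p) (e (f p)) => x1 x2 x3 x4; ring.
have dK : \forall p \near (0 : R * R), (dY (Pp j) p - dX (Qq j) p) - (dY P' p - dX Q' p) = - X0 K p.
  have EK1 : \forall p \near (0 : R * R), Pp j p - P' p = sg * (k%:R * p.1 ^+ k.-1) * K p.
    by move: EK; apply: filterS => p [].
  have EK2 : \forall p \near (0 : R * R), Qq j p - Q' p = 2 * p.2 * K p.
    by move: EK; apply: filterS => p [].
  have := near0I (an_grad hP) (near0I (an_grad hQ) (near0I (an_grad hP') (near0I (an_grad hQ')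
    (near0I (an_grad hK) (near0I (near_join EK1) (near_join EK2)))))).
  apply: filterS => p [G1 [G2 [G3 [G4 [G5 [e1 e2]]]]]].
  have [_ E1] := grad_unique (grad_ext e1 (gradB G1 G3))
    (gradM (gradM (grad_cst sg p) (gradM (grad_cst k%:R p) (gradX k.-1 (grad_fst p)))) G5).
  have [E2 _] := grad_unique (grad_ext e2 (gradB G2 G4))
    (gradM (gradM (grad_cst 2 p) (grad_snd p)) G5).
  have ab (x1 x2 x3 x4 : R) : x1 - x2 - (x3 - x4) = (x1 - x3) - (x2 - x4) by ring.
  rewrite ab; apply: (etrans (congr2 (fun x y : R => x - y) E1 E2)).
  by rewrite /X0; move: (k%:R : R) (k.-1%:R : R) (dX K p) (dY K p) (K p) => ? ? x1 x2 x3; ring.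
pose L i t := (2 * i)%:R * v i t + 2 * k%:R * t * derive1 (v i) t.
have hda2 := an1_derive ha2.
have dP' : \forall p \near (0 : R * R), dY P' p - dX Q' p = (k.+2)%:R * nform v p + nform L p + derive1 a2 (f p) * X0 tau p.
  have := near0I (euler_nform hv) (near0I (an1_grad2 ha2 (an_f R k s) (f0 R s k2))
    (near0I (an_grad htx) (near0I (an_grad hty) (an_mixed htau)))).
  apply: filterS => p [[G1 E1] [G2 [G3 [G4 mm]]]].
  have {}G2 := G2 _ _ (grad_f k s p).
  have [_ _ ->] := gradD (gradM (gradM (grad_cst k%:R p) (grad_snd p)) G1) (gradM G2 G3).
  have [_ -> _] := gradD (gradM (gradN (gradM (grad_cst 2 p) (grad_fst p))) G1) (gradM G2 G4).
  rewrite -E1 mm /X0 -(natr1 k.+1) -(natr1 k) /=.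
  move: (nform v p) (dX (nform v) p) (dY (nform v) p) (a2 (f p)) (derive1 a2 (f p)) (dX tau p) (dY tau p) (dX (dY tau) p).
  by move=> x1 x2 x3 x4 x5 x6 x7 x8; ring.
pose tau' p := ((2 * j + k + 2)%:R * tau p + (K p + - (derive1 a2 (f p) * tau p))).
have hd2f := an1_comp2 hda2 (an_f R k s) (f0 R s k2).
have htau' : analytic2 tau'.
  exact: (an_add (an_mul (an_cst _) htau) (an_add hK (an_opp (an_mul hd2f htau)))).
pose N i t := (2 * j + k + 2)%:R * M i t - ((2 * i + k + 2)%:R * v i t + 2 * k%:R * t * derive1 (v i) t).
have hN i : analytic1 (N i).
  exact: (an1_sub (an1_mul (an1_cst _) (hM i)) (an1_add (an1_mul (an1_cst _) (hv i))
    (an1_mul (an1_mul (an1_cst _) (an1_id R)) (an1_derive (hv i))))).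
have NE p : nform N p = (2 * j + k + 2)%:R * nform M p - ((k.+2)%:R * nform v p + nform L p).
  rewrite /nform !mulr_sumr -big_split -sumrB; apply: eq_bigr => i _.
  rewrite /N /L !natE -(natr1 k.+1) -(natr1 k) natrM /=; ring.
have [|H _] := cohomology_unique (s := s) k2 htau' hN.
  have := near0I (an_grad htau) (near0I (an_grad hK) (near0I (an1_grad2 hda2 (an_f R k s) (f0 R s k2))
    (near0I dPQ (near0I Ew (near0I dK dP'))))).
  apply: filterS => p [G1 [G2 [G3 [e1 [e2 [e3 e4]]]]]].
  have {}G3 := G3 _ _ (grad_f k s p).
  have -> : \sum_(i < k.-1) p.1 ^+ i * N i (f p) = nform N p by [].
  have Xt : X0 tau' p = (2 * j + k + 2)%:R * X0 tau p + (X0 K p - derive1 a2 (f p) * X0 tau p).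
    rewrite (X0E k s (gradD (gradM (grad_cst (2 * j + k + 2)%:R p) G1) (gradD G2 (gradN (gradM G3 G1))))).
    by rewrite /X0; ring.
  move: e3; rewrite e1 e2 e4 NE Xt.
  move: (X0 K p) (X0 tau p) (nform M p) (nform v p) (nform L p) (derive1 a2 (f p)) ((2 * j + k + 2)%:R : R) (k.+2%:R : R).
  move=> x1 x2 x3 x4 x5 x6 x7 x8 E3.
  have -> : x1 = - (x7 * (x3 + x2) - (x8 * x4 + x5 + x6 * x2)) by rewrite E3 opprK.
  by ring.
by move=> i ik; have := H i ik; apply: filterS => t /eqP; rewrite subr_eq0 => /eqP.
Qed.

End Pullback.

End Uniqueness.

(** * Diagonality of the coefficients *)

Section Rigidity.
Variable R : realType.
Variables (k : nat) (s : bool).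
Hypothesis k2 : (2 <= k)%N.
Implicit Types (F G u v w A B : R * R -> R) (p q : R * R) (r : R).

Local Notation sg := ((-1) ^+ s : R).
Local Notation f := (@nfH R k s).
Local Notation X0 := (@X0 R k s).
Local Notation nform := (@nform R k s).

Lemma near1I (Q Q' : R -> Prop) : (\forall t \near (0 : R), Q t) ->
  (\forall t \near (0 : R), Q' t) -> \forall t \near (0 : R), Q t /\ Q' t.
Proof. by apply: filterS2 => p. Qed.

Lemma X0_sum m (a : nat -> R -> R) (tau : nat -> R * R -> R) :
  (forall i, analytic1 (a i)) -> (forall i, analytic2 (tau i)) ->
  \forall p \near (0 : R * R), X0 (fun q => \sum_(i < m) a i (f q) * tau i q) p =
    \sum_(i < m) a i (f p) * X0 (tau i) p.
Proof.
move=> ha htau; have h i : analytic2 (fun q => a i (f q) * tau i q).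
  exact: (an_mul (an1_comp2 (ha i) (an_f R k s) (f0 R s k2)) (htau i)).
have H1 := near_ord (fun i (_ : (i < m)%N) => an_grad (h i)).
have H2 := near_ord (fun i (_ : (i < m)%N) => X0_scale s k2 (ha i) (htau i)).
move: H1 H2; apply: filterS2 => p g e.
rewrite (X0E k s (grad_sum (index_enum 'I_m) (fun i : 'I_m => g i (ltn_ord i)))).
rewrite !mulr_sumr -sumrB; apply: eq_bigr => i _.
by rewrite -(e i (ltn_ord i)).
Qed.

(** The factor t^n is cancelled by analyticity. *)
Lemma an1_const n (y : R -> R) : analytic1 y -> (\forall t \near (0 : R), t ^+ n * derive1 y t = 0) ->
  \forall t \near (0 : R), y t = y 0.
Proof.
move=> hy E.
have E' : \forall t \near (0 : R), derive1 y t = 0.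
  apply: (an1_eq_pos (an1_derive hy) (an1_cst 0)).
  move: E; apply: filterS => t /eqP + t0.
  by rewrite mulf_eq0 expf_eq0 [t == 0]gt_eqF// andbF/= => /eqP.
have := near_xaxis (an_dX0 (proj1 (an1P y) hy) _); apply.
have := near_along E' (an_fst R) erefl; apply: filterS => -[x z] /= e.
by rewrite -(derive1_dX y x z).
Qed.

Section Pullback.
Variables (psi : R * R -> R * R) (g h : R -> R).
Hypothesis dpsi : diffeo_germ psi.
Hypothesis gh : inverse_germs g h.
Hypothesis fpsi : \forall p \near (0 : R * R), f (psi p) = g (f p).

Let U p := (psi p).1.
Let V p := (psi p).2.
Let J := jac psi.

(** For i <> j the exponents 2i + k + 2 and 2j + k + 2 differ by an even number
   that is not a multiple of 2k, so [ode_zero] applies to e M_ij. *)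
Lemma diagonal_decomposition : exists e M tau, [/\ analytic1 e, e 0 = 1,
    \forall t \near (0 : R), g t = t * e t * derive1 g t,
    forall j, [/\ forall i, analytic1 (M j i), analytic2 (tau j) &
      \forall p \near (0 : R * R), U p ^+ j * J p = nform (M j) p + X0 (tau j) p] &
    forall i j, (i < k.-1)%N -> (j < k.-1)%N -> i != j -> \forall t \near (0 : R), M j i t = 0].
Proof.
have [hU hV hJ U0 V0] := pullback_analytic dpsi.
have [e [he e0 Ee]] := reparam_factor gh.
have /choice[mt hmt] : forall j, exists mt : (nat -> R -> R) * (R * R -> R),
    [/\ forall i, analytic1 (mt.1 i), analytic2 mt.2 &
      \forall p \near (0 : R * R), U p ^+ j * J p = nform mt.1 p + X0 mt.2 p].
  move=> j; have [c [tau [h1 h2 h3]]] := cohomology s k2 (an_mul (an_exp j hU) hJ).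
  by exists (c, tau).
exists e, (fun j => (mt j).1), (fun j => (mt j).2); split=> // i j ik jk ij.
have [hM htau Ew] := hmt j.
have con := connection k2 dpsi gh fpsi he Ee hM htau Ew ik.
have hv : analytic1 (fun t => e t * (mt j).1 i t) by exact: an1_mul.
have v0 : \forall t \near (0 : R), e t * (mt j).1 i t = 0.
  apply: (@ode_zero R (2 * j + k + 2)%:R (2 * i + k + 2)%:R (2 * k%:R) _ _ he hv e0).
    by move: con; apply: filterS => t con; rewrite mulrCA con.
  move=> n; rewrite -!natrM -natrD eqr_nat; case: n => [|n]; first by move/eqP: ij; lia.
  by rewrite mulnS; move: (_ * n)%N => x; lia.
have en0 := an1_neq0 he; rewrite e0 in en0; move: (en0 (oner_neq0 R)) v0.
by apply: filterS2 => t n0 /eqP; rewrite mulf_eq0 (negbTE n0)/= => /eqP.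
Qed.

(** Expand the density c' o psi in the functions (psi^* x^j) jac psi, whose
   coefficients are functions of f that commute with X0; then compare with c by
   [cohomology_unique]. *)
Lemma match_coefficients (c c' : nat -> R -> R) (M : nat -> nat -> R -> R) tau : (forall i, analytic1 (c i)) -> (forall i, analytic1 (c' i)) ->
  (\forall p \near (0 : R * R), nform c p = nform c' (psi p) * J p) ->
  (forall j, [/\ forall i, analytic1 (M j i), analytic2 (tau j) &
      \forall p \near (0 : R * R), U p ^+ j * J p = nform (M j) p + X0 (tau j) p]) ->
  (forall i j, (i < k.-1)%N -> (j < k.-1)%N -> i != j -> \forall t \near (0 : R), M j i t = 0) ->
  forall j, (j < k.-1)%N -> \forall t \near (0 : R), c j t = c' j (g t) * M j j t.
Proof.
move=> hc hc' E hM M0.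
have [hg _ g0 _ _] := gh.
have hcg i : analytic1 (fun t => c' i (g t)) by exact: an1_comp.
have H1 : \forall p \near (0 : R * R), forall j, (j < k.-1)%N -> nform (M j) p = p.1 ^+ j * M j j (f p).
  apply: near_ord => j jk.
  have : \forall p \near (0 : R * R), forall i, (i < k.-1)%N -> i != j -> M j i (f p) = 0.
    apply: near_ord => i ik; have [->|ij] := eqVneq i j; first exact: near0W.
    by have := near_f s k2 (M0 i j ik jk ij); apply: filterS.
  apply: filterS => p H; rewrite /nform (bigD1 (Ordinal jk))//= big1 ?addr0// => i ij.
  by rewrite H ?mulr0.
have H2 : \forall p \near (0 : R * R), forall j, (j < k.-1)%N -> U p ^+ j * J p = nform (M j) p + X0 (tau j) p.
  by apply: near_ord => j _; have [] := hM j.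
have htau j : analytic2 (tau j) by have [] := hM j.
have H3 := X0_sum k.-1 hcg htau.
pose T q := \sum_(i < k.-1) c' i (g (f q)) * tau i q.
have hT : analytic2 T.
  by apply: an_sum => i _; exact: (an_mul (an1_comp2 (hcg i) (an_f R k s) (f0 R s k2)) (htau i)).
pose N i t := c i t - c' i (g t) * M i i t.
have hN i : analytic1 (N i).
  by have [hMi _ _] := hM i; exact: (an1_sub (hc i) (an1_mul (hcg i) (hMi i))).
have [|N0 _] := cohomology_unique (s := s) k2 (an_opp hT) hN.
  have := near0I E (near0I fpsi (near0I H1 (near0I H2 (near0I H3 (an_grad hT))))).
  apply: filterS => p [e1 [e2 [e3 [e4 [e5 e6]]]]].
  rewrite (X0E k s (gradN e6)).
  have -> : 2 * p.2 * - dX T p - sg * k%:R * p.1 ^+ k.-1 * - dY T p = - X0 T p by rewrite /X0; ring.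
  rewrite e5; have -> : \sum_(i < k.-1) p.1 ^+ i * N i (f p) =
     nform c p - \sum_(i < k.-1) c' i (g (f p)) * (p.1 ^+ i * M i i (f p)).
    rewrite /nform -sumrB; apply: eq_bigr => i _; rewrite /N; ring.
  rewrite e1 /nform e2 mulr_suml -!sumrB big1// => i _.
  rewrite -/(U p) -(e3 i (ltn_ord i)); move: (e4 i (ltn_ord i)).
  by move: (nform (M i) p) (X0 (tau i) p) (U p ^+ i) (J p) => x1 x2 x3 x4 E4; rewrite mulrAC E4; ring.
by move=> j jk; have := N0 j jk; apply: filterS => t /eqP; rewrite subr_eq0 => /eqP.
Qed.

(** For i = j = 0 and M_00 = 1 the equation says that e - 1 solves a homogeneous
   one, so e = 1, that is t g' = g.  With e = 1 the diagonal equations reduce to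
   t M_jj' = 0. *)
Lemma rigid_g e (M : nat -> nat -> R -> R) tau : (2 < k)%N -> analytic1 e -> e 0 = 1 ->
  (\forall t \near (0 : R), g t = t * e t * derive1 g t) ->
  (forall j, [/\ forall i, analytic1 (M j i), analytic2 (tau j) &
      \forall p \near (0 : R * R), U p ^+ j * J p = nform (M j) p + X0 (tau j) p]) ->
  (\forall t \near (0 : R), M 0%N 0%N t = 1) ->
  (exists2 mu, mu != 0 & \forall t \near (0 : R), g t = mu * t) /\
  (forall j, (j < k.-1)%N -> \forall t \near (0 : R), M j j t = M j j 0).
Proof.
move=> k3 he e0 Ee hM M1.
have [hg _ g0 _ _] := gh.
have kr : (2 * k%:R : R) != 0 by rewrite -natrM pnatr_eq0 -lt0n muln_gt0 (ltnW k2).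
have con j (jk : (j < k.-1)%N) : \forall t \near (0 : R), (2 * j + k + 2)%:R * M j j t =
   (2 * j + k + 2)%:R * (e t * M j j t) + 2 * k%:R * t * derive1 (fun t => e t * M j j t) t.
  by have [h1 h2 h3] := hM j; exact: (connection k2 dpsi gh fpsi he Ee h1 h2 h3 jk).
have k0 : (0 < k.-1)%N by lia.
have E1 : \forall t \near (0 : R), e t - 1 = 0.
  have hy : analytic1 (fun t => e t - 1) by exact: (an1_sub he (an1_cst 1)).
  apply: (@ode_zero R 0 (2 * 0 + k + 2)%:R (2 * k%:R) _ _ (an1_cst 1) hy erefl); last first.
    by move=> n; rewrite -natrM -natrM -natrD eq_sym pnatr_eq0; lia.
  have d1 : \forall t \near (0 : R), derive1 (fun t => e t * M 0%N 0%N t) t = derive1 (fun t => e t - 1) t.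
    have F1 : \forall t \near (0 : R), e t * M 0%N 0%N t = e t by move: M1; apply: filterS => t ->; rewrite mulr1.
    have F2 := near_eq_derive1 F1; move: F2 (an1_grad he); apply: filterS2 => t -> gl.
    have {}gl := gl _ _ _ _ (grad_fst (t, 0)) erefl.
    rewrite !(derive1_dX _ _ 0); have [_ -> _] := gradB gl (grad_cst 1 (t, 0)).
    by have [_ -> _] := gl; rewrite subr0.
  move: (near0I (near_along (con 0%N k0) (an_fst R) erefl) (near0I (near_along d1 (an_fst R) erefl) (near_along M1 (an_fst R) erefl))).
  move/near_xaxis; apply: filterS => t /= [c1 [c2 c3]].
  move: c1; rewrite c2 c3 !mulr1 mul0r mul1r => c1.
  move: (derive1 _ t) c1 => x; move: ((2 * 0 + k + 2)%:R : R) => y c1.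
  rewrite -[LHS](subrr y) {1}c1; ring.
have {}E1 : \forall t \near (0 : R), e t = 1 by move: E1; apply: filterS => t /eqP; rewrite subr_eq0 => /eqP.
split.
  have [g1 hg1 Eg] := an1_factor hg g0.
  have C1 : \forall t \near (0 : R), g1 t = g1 0.
    have := @an1_const 2 _ hg1; apply.
    have Dg := near_eq_derive1 Eg.
    have := near1I (near1I Eg Ee) (near1I (near1I Dg E1) (an1_grad hg1)).
    apply: filterS => t [[a1 a2] [[a3 a4] gl]].
    have {}gl := gl _ _ _ _ (grad_fst (t, 0)) erefl.
    move: a2; rewrite a1 a3 a4 (derive1_dX _ _ 0).
    have [_ -> _] := gradM (grad_fst (t, 0)) gl => /= a2.
    by rewrite -[RHS](subrr (t * g1 t)) {1}a2; ring.
  exists (g1 0); last by move: C1 Eg; apply: filterS2 => t <- ->; rewrite mulrC.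
  apply: contra_neq (dg_neq0 gh) => g10.
  have := near_eq_derive1 Eg => /nbhs_singleton ->; rewrite (derive1_dX _ _ 0).
  have gl := nbhs_singleton (an1_grad hg1) _ _ _ _ (grad_fst (0 : R * R)) erefl.
  by have [_ -> _] := gradM (grad_fst (0 : R * R)) gl; rewrite /= g10; ring.
move=> j jk; have [hMj _ _] := hM j.
have := @an1_const 1 _ (hMj j); apply.
have F1 : \forall t \near (0 : R), e t * M j j t = M j j t by move: E1; apply: filterS => t ->; rewrite mul1r.
have := near1I (con j jk) (near1I F1 (near_eq_derive1 F1)).
apply: filterS => t [a1 [a2 a3]]; move: a1; rewrite a2 a3 => a1.
apply: (mulfI kr); move: (derive1 _ t) a1 => x; move: (_ * M j j t) => y a1.
rewrite mulr0 -[RHS](subrr y) {1}a1; ring.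
Qed.

End Pullback.
End Rigidity.

(** * The linear part and rigidity *)

Section LinearPart.
Variable R : realType.
Variables (k : nat) (s : bool).
Hypothesis k3 : (3 <= k)%N.
Implicit Types (F G u v w A B : R * R -> R) (p q : R * R) (r : R).

Local Notation sg := ((-1) ^+ s : R).
Local Notation f := (@nfH R k s).
Local Notation X0 := (@X0 R k s).
Local Notation nform := (@nform R k s).

Let k2 : (2 <= k)%N := ltnW k3.

Lemma near_yaxis (Q : R * R -> Prop) : (\forall p \near (0 : R * R), Q p) ->
  \forall t \near (0 : R), Q (0, t).
Proof.
move=> /near0P[r r0 h]; apply/near1P; exists r => // t ht; apply: h; split=> //=.
by rewrite normr0 ltW.
Qed.

Lemma an1_restry F : analytic2 F -> analytic1 (fun t => F (0, t)).
Proof. by move=> hF; apply/an1P; exact: (an_comp hF (an_cst 0) (an_fst R) erefl erefl). Qed.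

Lemma an1_cancel n (a b : R -> R) : analytic1 a -> analytic1 b ->
  (\forall t \near (0 : R), t ^+ n * a t = t ^+ n * b t) -> \forall t \near (0 : R), a t = b t.
Proof.
move=> ha hb E; apply: (an1_eq_pos ha hb); move: E; apply: filterS => t E t0.
by apply: (mulfI _ E); rewrite expf_neq0// gt_eqF.
Qed.

Section Pullback.
Variables (psi : R * R -> R * R) (mu : R).
Hypothesis dpsi : diffeo_germ psi.
Hypothesis fpsi : \forall p \near (0 : R * R), f (psi p) = mu * f p.

Let U p := (psi p).1.
Let V p := (psi p).2.
Let J := jac psi.

(** Restrict to the x-axis, where f = sg x^k and X0 tau is divisible by x^(k-1);
   divide by x^j with j < k - 1 and evaluate at 0. *)
Lemma diag_value j (M : nat -> R -> R) tau (u : R -> R) : (j < k.-1)%N -> (forall i, analytic1 (M i)) ->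
  analytic2 tau -> analytic1 u -> (\forall t \near (0 : R), U (t, 0) = t * u t) ->
  (forall i, (i < k.-1)%N -> i != j -> \forall t \near (0 : R), M i t = 0) ->
  (\forall p \near (0 : R * R), U p ^+ j * J p = nform M p + X0 tau p) -> M j 0 = u 0 ^+ j * J 0.
Proof.
move=> jk hM htau hu EU M0 E; have [hU hV hJ U0 V0] := pullback_analytic dpsi.
have H1 : \forall p \near (0 : R * R), nform M p = p.1 ^+ j * M j (f p).
  have : \forall p \near (0 : R * R), forall i, (i < k.-1)%N -> i != j -> M i (f p) = 0.
    apply: near_ord => i ik; have [->|ij] := eqVneq i j; first exact: near0W.
    by have := near_f s k2 (M0 i ik ij); apply: filterS.
  apply: filterS => p H; rewrite /nform (bigD1 (Ordinal jk))//= big1 ?addr0// => i ij.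
  by rewrite H ?mulr0.
have hmf := an1_comp2 (hM j) (an_f R k s) (f0 R s k2).
have hJ1 : analytic1 (fun t => u t ^+ j * J (t, 0)) by exact: (an1_mul (an1_exp j hu) (an1_restr hJ)).
pose rhs t := M j (f (t, 0)) - sg * k%:R * t ^+ (k.-1 - j) * dY tau (t, 0).
have hr : analytic1 rhs.
  exact: (an1_sub (an1_restr hmf) (an1_mul (an1_mul (an1_cst _) (an1_exp _ (an1_id R))) (an1_restr (an_dY htau)))).
have E2 : \forall t \near (0 : R), u t ^+ j * J (t, 0) = rhs t.
  have := @an1_cancel j _ _ hJ1 hr; apply.
  have := near1I EU (near1I (near_xaxis E) (near_xaxis H1)); apply: filterS => t [e1 [e2 e3]].
  move: e2; rewrite e1 e3 /X0 /rhs /= mulr0 mul0r sub0r exprMn => e2; rewrite mulrA e2.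
  have -> : t ^+ k.-1 = t ^+ j * t ^+ (k.-1 - j) by rewrite -exprD subnKC// ltnW.
  by ring.
have := nbhs_singleton E2; rewrite /rhs (f0 R s k2) expr0n subn_eq0 leqNgt jk/=.
by rewrite mulr0 mul0r subr0 => <-.
Qed.

(** Restrict f o psi = mu f to the two axes.  With a, d the diagonal entries of
   the linear part, the xi-axis gives d^2 = mu and the x-axis a^k = mu; the
   lower left entry vanishes and a d = 1.  Hence a^(k+2) = 1. *)
Lemma linear_part (u : R -> R) : J 0 = 1 -> analytic1 u -> (\forall t \near (0 : R), U (t, 0) = t * u t) ->
  mu = 1 /\ (u 0 = 1 \/ u 0 = -1 /\ ~~ odd k).
Proof.
move=> J0 hu EU; have [hU hV hJ U0 V0] : [/\ analytic2 U, analytic2 V, analytic2 J, U 0 = 0 & V 0 = 0] := pullback_analytic dpsi.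
have sn0 := sg_neq0 R s.
have [b hb EV] := an1_factor (an1_restr hV) V0.
have [d hd EVy] := an1_factor (an1_restry hV) V0.
have [c hc EUy] := an1_factor (an1_restry hU) U0.
have kE : k = (k - 3).+3 by lia.
have fU p : f (psi p) = V p ^+ 2 + sg * U p ^+ k by [].
have fx t : f (t, 0) = sg * t ^+ k by rewrite /nfH/= expr0n/= add0r.
have fy t : f (0, t) = t ^+ 2 by rewrite /nfH/= expr0n gtn_eqF ?(ltnW k2)//= mulr0 addr0.
(* k >= 3, so on the xi-axis the term U^k does not contribute to order 2 *)
have d2 : d 0 ^+ 2 = mu.
  have hl : analytic1 (fun t => d t ^+ 2 + sg * (t ^+ (k - 3).+1 * c t ^+ k)).
    exact: (an1_add (an1_exp 2 hd) (an1_mul (an1_cst _) (an1_mul (an1_exp _ (an1_id R)) (an1_exp k hc)))).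
  have : \forall t \near (0 : R), d t ^+ 2 + sg * (t ^+ (k - 3).+1 * c t ^+ k) = mu.
    have := @an1_cancel 2 _ _ hl (an1_cst mu); apply.
    have := near1I EVy (near1I EUy (near_yaxis fpsi)); apply: filterS => t [e1 [e2 e3]].
    move: e3; rewrite fU e1 e2 fy => e3; rewrite [RHS]mulrC -e3.
    by rewrite !exprMn [in t ^+ k]kE !exprS; ring.
  by move=> /nbhs_singleton; rewrite expr0n/= mul0r mulr0 addr0.
(* on the x-axis V^2 has order at least k >= 3, so V has no linear term *)
have b0 : b 0 = 0.
  have hl : analytic1 (fun t => b t ^+ 2) by exact: an1_exp.
  have hr : analytic1 (fun t => t ^+ (k - 3).+1 * (sg * (mu - u t ^+ k))).
    exact: (an1_mul (an1_exp _ (an1_id R)) (an1_mul (an1_cst _) (an1_sub (an1_cst _) (an1_exp k hu)))).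
  have : \forall t \near (0 : R), b t ^+ 2 = t ^+ (k - 3).+1 * (sg * (mu - u t ^+ k)).
    have := @an1_cancel 2 _ _ hl hr; apply.
    have := near1I EV (near1I EU (near_xaxis fpsi)); apply: filterS => t [e1 [e2 e3]].
    move: e3; rewrite fU e1 e2 fx !exprMn => e3.
    have tk : t ^+ k = t ^+ 2 * t ^+ (k - 3).+1 by rewrite -exprD; congr (_ ^+ _); lia.
    transitivity (mu * (sg * t ^+ k) - sg * (t ^+ k * u t ^+ k)); first by rewrite -e3; ring.
    by rewrite tk; ring.
  by move=> /nbhs_singleton /eqP; rewrite !expr0n/= mul0r expf_eq0/= => /eqP.
have gU := nbhs_singleton (an_grad hU); have gV := nbhs_singleton (an_grad hV).
have at0 (W : R * R -> R) (y : R -> R) : analytic1 y -> grad W 0 (dX W 0) (dY W 0) ->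
    (\forall t \near (0 : R), W (t, 0) = t * y t) -> dX W 0 = y 0.
  move=> hy gW EW; have g1 := nbhs_singleton (an1_grad hy) _ _ _ _ (grad_fst (0 : R * R)) erefl.
  have g2 := gradM (grad_fst (0 : R * R)) g1.
  have g3 := grad_comp (F := W) (u := fun p => p.1) (v := fun=> 0) (p := 0) gW (grad_fst 0) (grad_cst 0 0).
  have := grad_unique g2 (grad_ext (near_along EW (an_fst R) erefl) g3).
  by case=> /= + _; rewrite mul0r add0r !mulr1 mulr0 addr0 => <-.
have at0y (W : R * R -> R) (y : R -> R) : analytic1 y -> grad W 0 (dX W 0) (dY W 0) ->
    (\forall t \near (0 : R), W (0, t) = t * y t) -> dY W 0 = y 0.
  move=> hy gW EW; have g1 := nbhs_singleton (an1_grad hy) _ _ _ _ (grad_snd (0 : R * R)) erefl.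
  have g2 := gradM (grad_snd (0 : R * R)) g1.
  have g3 := grad_comp (F := W) (u := fun=> 0) (v := fun p => p.2) (p := 0) gW (grad_cst 0 0) (grad_snd 0).
  have := grad_unique g2 (grad_ext (near_along EW (an_snd R) erefl) g3).
  by case=> /= _; rewrite mul0r add0r !mulr1 mulr0 add0r => <-.
have ux := at0 _ _ hu gU EU; have vx := at0 _ _ hb gV EV; have vy := at0y _ _ hd gV EVy.
have ad : u 0 * d 0 = 1.
  by move: J0; rewrite /J jacE -/U -/V ux vx vy b0 mulr0 subr0.
have dn0 : d 0 != 0 by apply: contra_eq_neq ad => ->; rewrite mulr0 eq_sym oner_eq0.
(* on the x-axis the xi-derivative of f o psi = mu f expresses V by U^(k-1) *)
have hVy := an_dY hV; have hUy := an_dY hU.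
have vyn : dY V 0 != 0 by rewrite vy.
pose nu t := - (sg * k%:R * u t ^+ k.-1 * dY U (t, 0)) * (2^-1 * (dY V (t, 0))^-1).
have hnu : analytic1 nu.
  exact: (an1_mul (an1_opp (an1_mul (an1_mul (an1_cst _) (an1_exp _ hu)) (an1_restr hUy)))
    (an1_mul (an1_cst _) (an1_restr (an_inv hVy vyn)))).
have EVx : \forall t \near (0 : R), V (t, 0) = t ^+ k.-1 * nu t.
  have G := near0I (an_grad hU) (near0I (an_grad hV) (near0I (near_join fpsi) (an_neq0 hVy vyn))).
  have := near1I (near_xaxis G) EU; apply: filterS => t [[G1 [G2 [G3 n0]]] e].
  have [_] := grad_unique (grad_ext G3 (grad_pull (grad_f k s (psi (t, 0))) G1 G2)) (gradM (grad_cst mu _) (grad_f k s (t, 0))).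
  rewrite -/(U _) -/(V _) e /= => e2.
  rewrite /nu; move: (dY V _) n0 e2 => y n0; rewrite exprMn => e2.
  have n1 : 2 * y != 0 by rewrite mulf_neq0 ?pnatr_eq0.
  apply: (mulfI n1); move: e2; rewrite !mulr0 add0r => e2.
  have -> : 2 * y * (t ^+ k.-1 * (- (sg * k%:R * u t ^+ k.-1 * dY U (t, 0)) * (2^-1 * y^-1))) =
    - (t ^+ k.-1 * (sg * k%:R * u t ^+ k.-1 * dY U (t, 0))) by field.
  by apply/eqP; rewrite -subr_eq0 -[X in _ == X]e2; apply/eqP; ring.
have ak : u 0 ^+ k = mu.
  have hl : analytic1 (fun t => t ^+ (k - 3).+1 * nu t ^+ 2 + sg * u t ^+ k).
    exact: (an1_add (an1_mul (an1_exp _ (an1_id R)) (an1_exp 2 hnu)) (an1_mul (an1_cst _) (an1_exp k hu))).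
  have : \forall t \near (0 : R), t ^+ (k - 3).+1 * nu t ^+ 2 + sg * u t ^+ k = mu * sg.
    have := @an1_cancel k _ _ hl (an1_cst _); apply.
    have := near1I EVx (near1I EU (near_xaxis fpsi)); apply: filterS => t [e1 [e2 e3]].
    move: e3; rewrite fU e1 e2 fx !exprMn => e3.
    have -> : t ^+ k * (mu * sg) = mu * (sg * t ^+ k) by ring.
    rewrite -e3 mulrDr; congr (_ + _); last by ring.
    have -> : k.-1 = (k - 3).+2 by lia.
    rewrite mulrA; congr (_ * _); rewrite -exprD -exprM; congr (_ ^+ _); lia.
  move=> /nbhs_singleton; rewrite expr0n/= mul0r add0r mulrC => /(mulIf sn0).
  by [].
have a1 : `|u 0| = 1.
  have : u 0 ^+ k.+2 = 1.
    by rewrite -(addn2 k) exprD ak -d2 -exprMn mulrC ad expr1n.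
  move=> E; have /eqP := congr1 Num.norm E; rewrite normrX normr1 => E'.
  by apply/eqP; move: E'; rewrite -[X in _ == X](expr1n R k.+2) eqrXn2.
have uu : u 0 * u 0 = 1 by rewrite -expr2 -real_normK ?num_real// a1 expr1n.
have du : d 0 = u 0 by rewrite -[d 0]mul1r -uu -mulrA ad mulr1.
have mu1 : mu = 1 by rewrite -d2 du expr2.
split=> //; have /eqP := uu; rewrite -expr2 sqrf_eq1 => /orP[/eqP->|/eqP u1]; [by left|right].
split=> //; move: ak; rewrite u1 mu1 -signr_odd; case: (odd k) => //= /eqP.
by rewrite expr1 eq_sym -subr_eq0 opprK (_ : 1 + 1 = 2%:R) ?pnatr_eq0// -natr1.
Qed.

End Pullback.

(** The number a is the x-derivative at 0 of the first component of psi: c_j =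
   c'_j(g) M_jj, where g is the identity and M_jj = a^j. *)
Lemma rigidity (c c' : nat -> R -> R) : (forall i, analytic1 (c i)) -> (forall i, analytic1 (c' i)) ->
  c 0%N = (fun=> 1) -> c' 0%N = (fun=> 1) -> streq k s (nform c) (nform c') ->
  exists2 a : R, a = 1 \/ a = -1 /\ ~~ odd k &
    forall j, (j < k.-1)%N -> \forall t \near (0 : R), c j t = a ^+ j * c' j t.
Proof.
move=> hc hc' c0 c0' [psi [g [h [dpsi gh fpsi E]]]].
have [hU hV hJ U0 V0] := pullback_analytic dpsi.
have [e [M [tau [he e0 Ee hM M0]]]] := diagonal_decomposition k2 dpsi gh fpsi.
have C := match_coefficients k2 gh fpsi hc hc' E hM M0.
have k0 : (0 < k.-1)%N by lia.
have M1 : \forall t \near (0 : R), M 0%N 0%N t = 1.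
  by have := C 0%N k0; apply: filterS => t; rewrite c0 c0' mul1r => <-.
have [[mu mu0 Eg] Mc] := rigid_g k2 dpsi gh fpsi k3 he e0 Ee hM M1.
have fpsi' : \forall p \near (0 : R * R), f (psi p) = mu * f p.
  by move: fpsi (near_f s k2 Eg); apply: filterS2 => p -> ->.
have [u hu EU] := an1_factor (an1_restr hU) U0.
have Mv j (jk : (j < k.-1)%N) : M j j 0 = u 0 ^+ j * jac psi 0.
  have [h1 h2 h3] := hM j.
  by apply: (diag_value dpsi jk h1 h2 hu EU _ h3) => i ik ij; exact: M0.
have J1 : jac psi 0 = 1 by have := Mv _ k0; rewrite expr0 mul1r => <-; exact: (nbhs_singleton M1).
have [mu1 ua] := linear_part dpsi fpsi' J1 hu EU.
exists (u 0) => // j jk; move: (near1I (C j jk) (near1I Eg (Mc j jk))); apply: filterS => t [-> [-> ->]].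
by rewrite Mv// J1 mulr1 mu1 mul1r mulrC.
Qed.

End LinearPart.

(** * Functions with the same leaves *)

Section Foliation.
Variable R : realType.
Variables (k : nat) (s : bool).
Hypothesis k2 : (2 <= k)%N.
Implicit Types (F G H u v w A B : R * R -> R) (p q : R * R) (r : R).

Local Notation sg := ((-1) ^+ s : R).
Local Notation f := (@nfH R k s).
Local Notation X0 := (@X0 R k s).
Local Notation nform := (@nform R k s).

Lemma grad_sqrt v p a b : grad v p a b -> 0 < v p ->
  grad (fun q => Num.sqrt (v q)) p (a / (2 * Num.sqrt (v p))) (b / (2 * Num.sqrt (v p))).
Proof.
move=> gv v0.
have d1 : differentiable (@Num.sqrt R) (v p).
  by apply/derivable1_diffP; have [] := is_derive1_sqrt v0.
have d2 : differentiable (fun q : R * R => Num.sqrt q.1) (v p, 0).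
  have [d0 _ _] := grad_fst (v p, 0).
  exact: (differentiable_comp (f := fun q : R * R => q.1) (g := @Num.sqrt R) d0 d1).
have g1 := grad_comp1 d2 gv.
have sn0 : 2 * Num.sqrt (v p) != 0 by rewrite mulf_neq0 ?pnatr_eq0// gt_eqF ?sqrtr_gt0.
suff D : derive1 (@Num.sqrt R) (v p) = (2 * Num.sqrt (v p))^-1.
  by apply: (grad_eq g1); rewrite D mulrC.
by rewrite derive1E; have [_ ->] := is_derive1_sqrt v0.
Qed.

(** Near p the level set of f contains the connected arc x |-> (x, sqrt (f p -
   sg x^k)), which lies in the leaf of p.  So H is constant along it, and
   differentiating gives X0 H = 0. *)
Lemma foliation_X0 H (U : set (R * R)) p : open U -> U p -> 0 < p.2 -> leaf U H p = leaf U f p ->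
  grad H p (dX H p) (dY H p) -> X0 H p = 0.
Proof.
move=> oU Up p2 L gH.
pose v (t : R) := f p - sg * t ^+ k.
(* the arc of the level set of f through p, as a graph over x *)
pose gam (t : R) := (t, Num.sqrt (v t)).
have vp : v p.1 = p.2 ^+ 2 by rewrite /v /nfH addrK.
have gamp : gam p.1 = p by rewrite /gam vp sqrtr_sqr gtr0_norm// -surjective_pairing.
have cv : continuous v.
  move=> t; apply: cvgB; first exact: cvg_cst.
  by apply: cvgM; [exact: cvg_cst|exact: (@exprn_continuous R k t)].
have cg : continuous gam.
  move=> t; apply: (@cvg_pair _ _ _ _ (nbhs t) (nbhs (Num.sqrt (v t)))); first exact: cvg_id.
  apply: (continuous_comp (f := v)); [exact: cv|exact: sqrt_continuous].
have [e e0 he] : exists2 e : R, 0 < e & forall t, ball p.1 e t -> U (gam t) /\ 0 < v t.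
  have n1 : \forall t \near p.1, U (gam t).
    by have := cg p.1 U; apply; rewrite gamp; exact: open_nbhs_nbhs.
  have n2 : \forall t \near p.1, 0 < v t.
    have := cv p.1 [set y | 0 < y]; apply; rewrite vp; apply: open_nbhs_nbhs; split; first exact: open_gt.
    by rewrite /= exprn_gt0.
  have /nbhs_ballP[e /= e0 he] : \forall t \near p.1, U (gam t) /\ 0 < v t.
    by move: n1 n2; apply: filterS2.
  by exists e.
have cI : connected (gam @` ball p.1 e).
  apply: connected_continuous_connected; last exact: continuous_subspaceT.
  by apply/connected_intervalP; rewrite ball_itv; exact: interval_is_interval.
have Hc t : ball p.1 e t -> H (gam t) = H p.
  move=> ht; suff : leaf U H p (gam t) by move/connected_component_sub => [].
  rewrite L; apply: (connected_component_max _ _ cI).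
  - by exists p.1; [exact: ballxx|].
  - move=> _ [t' ht' <-]; have [h1 h2] := he t' ht'; split=> //=.
    by rewrite /nfH/= sqr_sqrtr ?(ltW h2)// /v subrK.
  - by exists t.
have gv : grad (fun q => v q.1) p (0 - sg * (k%:R * p.1 ^+ k.-1)) 0.
  apply: (grad_eq (gradB (grad_cst (f p) p) (gradM (grad_cst sg p) (gradX k (grad_fst p))))); rewrite /=; ring.
have v0 : 0 < v p.1 by rewrite vp exprn_gt0.
have gs := grad_sqrt gv v0.
have gH' : grad H (p.1, Num.sqrt (v p.1)) (dX H p) (dY H p) by rewrite -/(gam p.1) gamp.
have G1 := grad_comp (F := H) (u := fun q => q.1) gH' (grad_fst p) gs.
have E : \forall q \near p, H (q.1, Num.sqrt (v q.1)) = H p.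
  have : \forall t \near p.1, H (gam t) = H p by apply/nbhs_ballP; exists e.
  exact: cvg_fst.
have [G2 _] := grad_unique (grad_ext E G1) (grad_cst (H p) p).
move: G2; rewrite vp sqrtr_sqr gtr0_norm// mulr1 sub0r /X0 => G2.
have n0 : 2 * p.2 != 0 by rewrite mulf_neq0 ?pnatr_eq0// gt_eqF.
rewrite -[RHS](mulr0 (2 * p.2)) -G2; field; exact: lt0r_neq0.
Qed.

(** By [foliation_X0] in a quadrant and the identity theorem, X0 H = 0; then
   [cohomology_unique] with c = 0. *)
Lemma foliation_first_integral H : analytic2 H -> same_foliation H f ->
  exists2 h, analytic1 h & \forall p \near (0 : R * R), H p = h (f p).
Proof.
move=> hH [U [[oU U0] L]].
have E : \forall p \near (0 : R * R), X0 H p = 0.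
  apply: (an_eq_quadrant (an_X0 k s hH) (an_cst 0)).
  have nU : \forall p \near (0 : R * R), U p by exact: open_nbhs_nbhs.
  move: nU (an_grad hH); apply: filterS2 => p Up gH _ p2.
  exact: (foliation_X0 oU Up p2 (L p Up) gH).
have [|_ //] := cohomology_unique (s := s) k2 hH (fun _ => an1_cst (0 : R)).
by move: E; apply: filterS => p ->; rewrite big1 ?addr0// => i _; rewrite mulr0.
Qed.

End Foliation.

(** * Classification *)

Section Classification.
Variable R : realType.
Variables (k : nat) (s : bool).
Hypothesis k2 : (2 <= k)%N.
Implicit Types (F G H u v w A B : R * R -> R) (p q : R * R) (r : R).

Local Notation sg := ((-1) ^+ s : R).
Local Notation f := (@nfH R k s).
Local Notation nform := (@nform R k s).

(** Take a ball on the values of which h is injective: there h(f) and f have the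
   same level sets. *)
Lemma same_foliation_comp g h : inverse_germs g h -> same_foliation (fun p => h (f p)) f.
Proof.
move=> [_ _ _ _ [_ E]].
have := near_f s k2 E => /near0P[r r0 hr].
exists (ball (0 : R * R) r); split.
  by split; [exact: ball_open|exact: ballxx].
have inj q : ball (0 : R * R) r q -> g (h (f q)) = f q.
  by move=> [b1 b2]; apply: hr; split; move: b1 b2; rewrite /ball/= !sub0r !normrN => b1 b2; exact: ltW.
move=> p Up; rewrite /leaf; congr (connected_component _ p).
apply/seteqP; split=> q /= [Uq E1]; split=> //; last by rewrite E1.
by rewrite -(inj q Uq) E1 inj.
Qed.

(** The germ h must have nonzero derivative at 0.  Otherwise h = t^2 h_2; on the
   xi-axis f o chi is divisible by t^2, so that t^2 = f(0, t) would be divisible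
   by t^4. *)
Lemma reparam_germ (chi : R * R -> R * R) h : diffeo_germ chi -> analytic1 h ->
  (\forall p \near (0 : R * R), f p = h (f (chi p))) ->
  exists2 g, inverse_germs g h & \forall p \near (0 : R * R), f (chi p) = g (f p).
Proof.
move=> dchi hh E; have [hchi chi0] := diffeo_an dchi; have [hU hV] := hchi.
have h0 : h 0 = 0 by have := nbhs_singleton E; rewrite chi0 (f0 R s k2).
have hfc := an_pull (an_f R k s) hchi chi0.
have fc0 : f (chi 0) = 0 by rewrite chi0 (f0 R s k2).
have dh : derive1 h 0 != 0.
  apply/negP => /eqP dh.
  have [h1 hh1 E1] := an1_factor hh h0.
  have h10 : h1 0 = 0.
    have := nbhs_singleton (near_eq_derive1 E1); rewrite dh (derive1_dX _ _ 0).
    have gl := nbhs_singleton (an1_grad hh1) _ _ _ _ (grad_fst (0 : R * R)) erefl.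
    by have [_ -> _] := gradM (grad_fst (0 : R * R)) gl; rewrite /= mul0r add0r mulr1.
  have [h2 hh2 E2] := an1_factor hh1 h10.
  have [v hv EV] := an1_factor (an1_restry hV) (congr1 snd chi0).
  have [u hu EU] := an1_factor (an1_restry hU) (congr1 fst chi0).
  pose G t := v t ^+ 2 + sg * (t ^+ (k - 2) * u t ^+ k).
  have hG : analytic1 G.
    exact: (an1_add (an1_exp 2 hv) (an1_mul (an1_cst _) (an1_mul (an1_exp _ (an1_id R)) (an1_exp k hu)))).
  have EF : \forall t \near (0 : R), f (chi (0, t)) = t ^+ 2 * G t.
    move: EV EU; apply: filterS2 => t e1 e2; rewrite /nfH e1 e2 /G !exprMn.
    have -> : t ^+ k = t ^+ 2 * t ^+ (k - 2) by rewrite -exprD; congr (_ ^+ _); lia.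
    by ring.
  have hfy := an1_restry hfc.
  have hr : analytic1 (fun t => t ^+ 2 * (G t ^+ 2 * h2 (f (chi (0, t))))).
    exact: (an1_mul (an1_exp 2 (an1_id R)) (an1_mul (an1_exp 2 hG) (an1_comp hh2 hfy fc0))).
  have : \forall t \near (0 : R), 1 = t ^+ 2 * (G t ^+ 2 * h2 (f (chi (0, t)))).
    have := @an1_cancel R 2 _ _ (an1_cst 1) hr; apply.
    have := near1I (near_yaxis E) (near1I EF (near1I (near1_comp E1 hfy fc0) (near1_comp E2 hfy fc0))).
    apply: filterS => t [e1 [e2 [e3 e4]]].
    have fy : f (0, t) = t ^+ 2 by rewrite /nfH/= expr0n gtn_eqF ?(ltnW k2)//= mulr0 addr0.
    rewrite mulr1 -[LHS]fy e1 e3 e4 e2; ring.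
  by move=> /nbhs_singleton /eqP; rewrite expr0n/= mul0r oner_eq0.
have [g [hg g0 _ hgE ghE]] := inverse1 hh h0 dh.
exists g; first by [].
move: E (near_along ghE hfc fc0); apply: filterS2 => p e1 e2.
by rewrite [in RHS]e1 e2.
Qed.

(** Straighten H by phi; the remaining freedom is that of [streq]. *)
Lemma fibration_streq H w w1 (phi phi' : R * R -> R * R) : diffeo_germ phi -> diffeo_germ phi' ->
  (\forall p \near (0 : R * R), phi' (phi p) = p) -> (\forall p \near (0 : R * R), phi (phi' p) = p) ->
  (\forall p \near (0 : R * R), H p = f (phi p)) ->
  fibration_equiv H w f w1 <-> streq k s (fun p => w (phi' p) * jac phi' p) w1.
Proof.
move=> dphi dphi' K1 K2 EH; have [hphi phi0] := diffeo_an dphi; have [hphi' phi'0] := diffeo_an dphi'.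
split=> [[Ht [hHt fol [psi [dpsi E1 E2]]]]|[chi [g [h [dchi gh E1 E2]]]]].
  have [h hh Eh] := foliation_first_integral k2 hHt fol; have [hpsi psi0] := diffeo_an dpsi.
  have dchi := diffeo_comp dpsi dphi'.
  have E3 : \forall p \near (0 : R * R), f p = h (f (psi (phi' p))).
    have := near0I (near_pull EH hphi' phi'0) (near0I K2 (near0I (near_pull E1 hphi' phi'0)
      (near_pull (near_pull Eh hpsi psi0) hphi' phi'0))).
    by apply: filterS => p [e1 [e2 [e3 e4]]]; rewrite -{1}e2 -e1 e3 -e4.
  have [g gh E4] := reparam_germ dchi hh E3.
  exists (fun p => psi (phi' p)), g, h; split=> //.
  have := near0I (near_pull E2 hphi' phi'0) (near_jac_comp hpsi hphi' phi'0).
  by apply: filterS => p [-> ->]; rewrite /pullback_form mulrA.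
have [hchi chi0] := diffeo_an dchi; have [hg hh g0 h0 [hgE ghE]] := gh.
exists (fun p => h (f p)); split.
- exact: (an1_comp2 hh (an_f R k s) (f0 R s k2)).
- exact: same_foliation_comp gh.
exists (fun p => chi (phi p)); split; first exact: diffeo_comp.
  have := near0I EH (near0I (near_pull E1 hphi phi0) (near_pull (near_f s k2 hgE) hphi phi0)).
  by apply: filterS => p [e1 [e2 e3]]; rewrite /pullback_fun e2 e3 e1.
have := near0I (near_pull E2 hphi phi0) (near0I K1 (near0I (near_jac_comp hchi hphi phi0)
  (jac_inv hphi' hphi phi0 K1))).
apply: filterS => p [e1 [e2 [e3 e4]]].
by rewrite /pullback_form e3 mulrA -e1 e2 -mulrA e4 mulr1.
Qed.

Lemma an_map_id : analytic_map (fun p : R * R => p).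
Proof. by split; [exact: an_fst|exact: an_snd]. Qed.

Lemma nf_equiv_streq (c c' : nat -> R -> R) :
  nf_equiv k s c c' <-> streq k s (nfw k s c) (nfw k s c').
Proof.
have did : diffeo_germ (fun p : R * R => p).
  by apply: (diffeo_explicit an_map_id an_map_id) => //; exact: near0W.
have E : streq k s (nfw k s c) (fun p => nfw k s c p * jac (fun q => q) p).
  by apply: streq_near => //; apply: near0W => p; rewrite jac_id mulr1.
have FE := @fibration_streq f (nfw k s c) (nfw k s c') _ _ did did (near0W (fun=> erefl)) (near0W (fun=> erefl)) (near0W (fun=> erefl)).
split=> [/FE|] h; first exact: (streq_trans E h).
by apply/FE; apply: (streq_trans _ h); exact: streq_sym.
Qed.

Lemma near_nfw (c c' : nat -> R -> R) : same_germs k c c' ->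
  \forall p \near (0 : R * R), nfw k s c p = nfw k s c' p.
Proof.
move=> E; have : \forall p \near (0 : R * R), forall i, (i < k.-1)%N -> (1 <= i)%N -> c i (f p) = c' i (f p).
  apply: near_ord => i ik; case: (ltnP 0 i) => i0; last first.
    by apply: near0W => p i1.
  have ii : inv_index k i by rewrite /inv_index i0; lia.
  by have := near_f s k2 (E i ii); apply: filterS.
apply: filterS => p e; rewrite /nfw; congr (_ + _).
by apply: eq_big_nat => i /andP[i1 i2]; rewrite e//; lia.
Qed.

(** Rigidity requires k >= 3; for k = 2 there is no invariant and nothing to
   compare. *)
Lemma streq_nfw_germs (c c' : nat -> R -> R) : analytic_family k c -> analytic_family k c' ->
  streq k s (nfw k s c) (nfw k s c') <->
  same_germs k c c' \/ (~~ odd k /\ same_germs k c (change_odd_signs c')).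
Proof.
move=> hc hc'; split; last first.
  case=> [/near_nfw|[ok /near_nfw]] h; first exact: streq_near.
  apply: (streq_trans (streq_near k s h)).
  by apply: streq_sym => //; exact: streq_odd_signs.
move=> E; have [k3|k3] := ltnP 2 k; last first.
  by left=> i; rewrite /inv_index; lia.
(* only the meaningful members of the families are known to be analytic *)
pose ext (c : nat -> R -> R) : nat -> R -> R := normal1 (fun i => if inv_index k i then c i else fun=> 0).
have hext (d : nat -> R -> R) : analytic_family k d -> forall i, analytic1 (ext d i).
  move=> hd i; rewrite /ext /normal1; case: ifP => _; first exact: an1_cst.
  by case: ifP => [/hd//|_]; exact: an1_cst.
have Eext (d : nat -> R -> R) p : nfw k s d p = nform (ext d) p.
  rewrite /ext -nfw_nform // /nfw; congr (_ + _); apply: eq_big_nat => i /andP[i1 i2].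
  by rewrite /inv_index i1 -ltnS i2.
have {}E : streq k s (nform (ext c)) (nform (ext c')).
  move: E; suff e (d : nat -> R -> R) : nfw k s d = nform (ext d) by rewrite !e.
  by apply/funext => p; exact: Eext.
have [a ha Ea] := rigidity k3 (hext c hc) (hext c' hc') erefl erefl E.
have {}Ea i : inv_index k i -> \forall t \near (0 : R), c i t = a ^+ i * c' i t.
  move=> ii; have ik : (i < k.-1)%N by move: ii; rewrite /inv_index; lia.
  have := Ea i ik; rewrite /ext /normal1 ii; case: eqP => // i0.
  by move: ii; rewrite i0.
case: ha => [a1|[a1 ok]]; [left|right; split=> //] => i /Ea; apply: filterS => t ->; rewrite a1.
  by rewrite expr1n mul1r.
rewrite /change_odd_signs -signr_odd; case: (odd i); first by rewrite expr1 mulN1r.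
by rewrite expr0 mul1r.
Qed.

Lemma same_taylor_germs (c c' : nat -> R -> R) : analytic_family k c -> analytic_family k c' ->
  same_taylor k c c' <-> same_germs k c c'.
Proof.
move=> hc hc'; split=> E i ii; first by apply/(an1_taylorP (hc i ii) (hc' i ii)); exact: E.
by apply/(an1_taylorP (hc i ii) (hc' i ii)); exact: E.
Qed.

Lemma analytic_change_odd_signs (c : nat -> R -> R) : analytic_family k c -> analytic_family k (change_odd_signs c).
Proof.
move=> hc i ii; rewrite /change_odd_signs; case: (odd i); last exact: hc.
exact: (an1_opp (hc i ii)).
Qed.

Lemma normal_form_theorem H w : symplectic w -> A_singularity k s H ->
  exists c : nat -> R -> R, [/\ analytic_family k c, has_normal_form k s H w c &
    forall c' : nat -> R -> R, analytic_family k c' ->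
      (has_normal_form k s H w c' <-> same_germs k c' c \/ (~~ odd k /\ same_germs k c' (change_odd_signs c)))].
Proof.
move=> [hw wn0] [phi [dphi EH]].
have [phi' [dphi' K1 K2]] := diffeo_inv dphi; have [hphi' phi'0] := diffeo_an dphi'.
pose wt p := w (phi' p) * jac phi' p.
have hwt : analytic2 wt by exact: (an_mul (an_pull hw hphi' phi'0) (an_jac hphi')).
have wt0 : wt 0 != 0.
  rewrite /wt phi'0; apply: mulf_neq0; last exact: diffeo_jac0.
  exact: (nbhs_singleton wn0).
have [c hc Ec] := normal_form_exists s k2 hwt wt0.
have FE c' : has_normal_form k s H w c' <-> streq k s wt (nfw k s c').
  exact: (@fibration_streq H w (nfw k s c') phi phi' dphi dphi' K1 K2 EH).
exists c; split=> //; first by apply/FE.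
move=> c' hc'; rewrite -streq_nfw_germs//; split=> [/FE|] h.
  by apply: (streq_trans _ Ec); exact: streq_sym.
by apply/FE; apply: (streq_trans Ec); exact: streq_sym.
Qed.

(** Compare the zero family with the family whose only nonzero member is t^n at
   index i. *)
Lemma odd_minimal : odd k -> minimal_invariants R k s.
Proof.
move=> ok i n ii.
pose c (j : nat) (t : R) := 0 * t ^+ 0%N.
pose c' (j : nat) (t : R) := (j == i)%:R * t ^+ n.
have hm (b : R) m : analytic1 (fun t => b * t ^+ m).
  exact: (an1_mul (an1_cst b) (an1_exp m (an1_id R))).
exists c, c'; split=> [j _|j _|j m jj jm|]; [exact: hm|exact: hm| |].
  rewrite /c /c' !derive1n_monomial mulr0 if_same; case: eqP => // mn.
  have [ji|ji] := eqVneq j i; last by rewrite mulr0.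
  by move: jm; rewrite ji mn eqxx.
move/nf_equiv_streq; rewrite streq_nfw_germs; [|by move=> j _; exact: hm..].
rewrite ok; case=> [E|[]//].
have := near_eq_derive1n n (E i ii); rewrite /c /c' !derive1n_monomial eqxx mulr0 if_same eqxx mulr1 => /esym/eqP.
by rewrite pnatr_eq0 eqn0Ngt fact_gt0.
Qed.

End Classification.

Theorem theorem3p6 (R : realType) (k : nat) (s : bool) (hk : (2 <= k)%N) :
  (forall H w : R * R -> R,
     analytic2 H -> symplectic w -> A_singularity k s H ->
     exists c : nat -> R -> R,
       [/\ analytic_family k c,
           has_normal_form k s H w c &
           forall c' : nat -> R -> R, analytic_family k c' ->
             (has_normal_form k s H w c' <->
              same_germs k c' c \/
              (~~ odd k /\ same_germs k c' (change_odd_signs c)))]) /\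
  (odd k ->
     (forall c c' : nat -> R -> R,
        analytic_family k c -> analytic_family k c' ->
        (nf_equiv k s c c' <-> same_taylor k c c')) /\
     minimal_invariants R k s) /\
  (forall l : nat, k = (2 * l)%N ->
     forall c c' : nat -> R -> R,
       analytic_family k c -> analytic_family k c' ->
       (nf_equiv k s c c' <->
        same_taylor k c c' \/ same_taylor k c (change_odd_signs c'))).
Proof.
split; first by move=> H w _; exact: normal_form_theorem.
split=> [ok|l kl].
  split; last exact: odd_minimal.
  move=> c c' hc hc'; rewrite nf_equiv_streq// streq_nfw_germs// same_taylor_germs// ok.
  by split=> [[//|[]//]|]; left.
move=> c c' hc hc'; rewrite nf_equiv_streq// streq_nfw_germs// !same_taylor_germs//; last exact: analytic_change_odd_signs.
have -> : ~~ odd k by rewrite kl mul2n odd_double.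
by split=> -[h|h]; [left|right; case: h|left|right].
Qed.
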